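(* Let $(\Omega,\mu)$ be a measure space with $\mu(\Omega)=1$. Let $E$ be an r.i. space, $b\in SV(0,1)$, $1<p_0<p_1<\infty$ and $\alpha,\beta>0$. Put $\rho(u)=u^{\frac1{p_0}-\frac1{p_1}}\ell^{\frac{\beta}{p_1}-\frac{\alpha}{p_0}}(u)$, $u\in(0,1)$. (a) If $0<\theta<1$, then $\big(L^{p_0),\alpha},L^{p_1),\beta}\big)_{\theta,b,E}=L_{p,B_\theta,E}$, where $\frac1p=\frac{1-\theta}{p_0}+\frac{\theta}{p_1}$ and $B_\theta(u)=\ell^{-\left[\frac{\alpha(1-\theta)}{p_0}+\frac{\beta\theta}{p_1}\right]}(u)\,b(\rho(u))$, $u\in(0,1)$. (b) If $\theta=0$, then $\big(L^{p_0),\alpha},L^{p_1),\beta}\big)_{0,b,E}=L^{\mathcal R,\mathcal L}_{p_0,\,b\circ\rho,\,E,\,\ell^{-\alpha/p_0}(u),\,L_\infty,\,1,\,L_{p_0}}$. (c) If $\theta=1$ and $\|b\|_{\widetilde E(0,1)}<\infty$, then $$\big(L^{p_0),\alpha},L^{p_1),\beta}\big)_{1,b,E}=L^{\mathcal R}_{p_1,B_1,E,1,L_{p_1}}\cap L^{\mathcal R,\mathcal R}_{p_1,\,b\circ\rho,\,E,\,\ell^{-\beta/p_1}(u),\,L_\infty,\,1,\,L_{p_1}},$$ where $B_1(u)=\ell^{-\beta/p_1}(u)\,b(\rho(u))$, $u\in(0,1)$.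
   Context: Notation. $\ell(t)=1+|\log t|$, $\ell^\sigma(t)=(\ell(t))^\sigma$. An r.i. space $E$ is a rearrangement invariant Banach function space on $(0,\infty)$ with the Fatou property; $\widetilde E$ is the corresponding space for the measure $dt/t$, with $\|g\|_{\widetilde E}=\|g^\star\|_E$ ($g^\star$ the non-increasing rearrangement with respect to $dt/t$); for an interval $I$, $\|g\|_{\widetilde E(I)}=\|g\chi_I\|_{\widetilde E}$. So $\|g\|_{\widetilde L_q(I)}=(\int_I|g(s)|^q\,ds/s)^{1/q}$ and $\widetilde L_\infty=L_\infty$. A positive finite measurable $b$ on $(0,1)$ is in $SV(0,1)$ if for all $\varepsilon>0$, $t^\varepsilon b(t)$ is equivalent to a non-decreasing function and $t^{-\varepsilon}b(t)$ to a non-increasing one on $(0,1)$. In $b(\rho(u))$, $b$ is understood as extended to $[1,\infty)$ by $b(s)=1$ for $s\ge1$ (the choice of slowly varying extension is immaterial up to equivalence of norms). Interpolation spaces: for (quasi-)Banach spaces with $Y_1\hookrightarrow Y_0$, $(Y_0,Y_1)_{\theta,b,E}$ is the set of $f\in Y_0$ with $\|t^{-\theta}b(t)K(t,f;Y_0,Y_1)\|_{\widetilde E(0,1)}<\infty$, $0\le\theta\le1$, where $K$ is Peetre's $K$-functional. Function spaces: $f^*$ is the non-increasing rearrangement of a $\mu$-measurable function $f$ on $\Omega$. Each space is the set of measurable $f$ with finite indicated norm (innermost norm in $s$, next in $t$, outermost in $u$), $1<p<\infty$: - $L_{p,b,E}$: $\|t^{1/p}b(t)f^*(t)\|_{\widetilde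 E(0,1)}$; - $L^{\mathcal R}_{p,b,E,a,F}$: $\big\|b(t)\|s^{1/p}a(s)f^*(s)\|_{\widetilde F(t,1)}\big\|_{\widetilde E(0,1)}$; - $L^{\mathcal R,\mathcal R}_{p,c,E,b,F,a,G}$: $\Big\|c(u)\big\|b(t)\|s^{1/p}a(s)f^*(s)\|_{\widetilde G(t,1)}\big\|_{\widetilde F(u,1)}\Big\|_{\widetilde E(0,1)}$; - $L^{\mathcal R,\mathcal L}_{p,c,E,b,F,a,G}$: $\Big\|c(u)\big\|b(t)\|s^{1/p}a(s)f^*(s)\|_{\widetilde G(t,u)}\big\|_{\widetilde F(0,u)}\Big\|_{\widetilde E(0,1)}$; - grand Lebesgue space $L^{p),\alpha}$ ($\alpha>0$): $\Big\|\ell^{-\alpha/p}(t)\|s^{1/p}f^*(s)\|_{\widetilde L_p(t,1)}\Big\|_{L_\infty(0,1)}$. Equality of spaces means equality as sets with equivalent norms. *)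

(* Defs.v *)
From HB Require Import structures.
From mathcomp Require Import all_boot all_order all_algebra.
From mathcomp Require Import all_classical all_reals all_analysis.
From mathcomp Require Import measurable_realfun.

Set Implicit Arguments.
Unset Strict Implicit.
Unset Printing Implicit Defensive.

Import Order.TTheory GRing.Theory Num.Theory.
Import numFieldNormedType.Exports.

Local Open Scope classical_set_scope.
Local Open Scope ring_scope.
Local Open Scope ereal_scope.

Definition distr d (T : measurableType d) (R : realType)
    (mu : {measure set T -> \bar R}) (f : T -> \bar R) (s : R) : \bar R :=
  mu [set x | s%:E < `|f x|].

Definition rearr d (T : measurableType d) (R : realType)
    (mu : {measure set T -> \bar R}) (f : T -> \bar R) (t : R) : \bar R :=
  ereal_inf [set s%:E | s in [set s : R | (0 <= s)%R /\ distr mu f s <= t%:E]].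

Definition Mplus d (T : measurableType d) (R : realType) : set (T -> \bar R) :=
  [set f : T -> \bar R | measurable_fun setT f /\ forall x, 0 <= f x].
Arguments Mplus {d} T R.

(* A space is represented by its Banach function norm in the sense of Bennett
   and Sharpley, whose axioms include the Fatou property.  The norm is only
   constrained on [Mplus]. *)
Record ri_space d (T : measurableType d) (R : realType)
    (mu : {measure set T -> \bar R}) := RISpace {
  ri_norm :> (T -> \bar R) -> \bar R ;
  ri_norm_ge0 : forall f, Mplus T R f -> 0 <= ri_norm f ;
  ri_norm_eq0 : forall f, Mplus T R f ->
    (ri_norm f = 0 <-> {ae mu, forall x, f x = 0}) ;
  ri_normZ : forall (c : R) f, (0 <= c)%R -> Mplus T R f ->
    ri_norm (fun x => c%:E * f x) = c%:E * ri_norm f ;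
  ri_normD : forall f g, Mplus T R f -> Mplus T R g ->
    ri_norm (fun x => f x + g x) <= ri_norm f + ri_norm g ;
  ri_norm_le : forall f g, Mplus T R f -> Mplus T R g ->
    {ae mu, forall x, g x <= f x} -> ri_norm g <= ri_norm f ;
  ri_norm_fatou : forall (f_ : nat -> T -> \bar R) f,
    (forall n, Mplus T R (f_ n)) -> Mplus T R f ->
    {ae mu, forall x, nondecreasing_seq (f_ ^~ x)} ->
    {ae mu, forall x, f_ ^~ x @ \oo --> f x} ->
    ri_norm (f_ n) @[n --> \oo] --> ri_norm f ;
  ri_norm_indic : forall A : set T, measurable A -> mu A < +oo ->
    ri_norm (fun x => (\1_A x)%:E) < +oo ;
  ri_norm_integral : forall A : set T, measurable A -> mu A < +oo ->
    exists2 C : R, (0 < C)%R &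
      forall f, Mplus T R f -> \int[mu]_(x in A) f x <= C%:E * ri_norm f ;
  ri_norm_rearr : forall f g, Mplus T R f -> Mplus T R g ->
    (forall s, distr mu f s = distr mu g s) -> ri_norm f = ri_norm g
}.

(* [halfline] is dt and [dtt] is dt/t.  Both are measures on the whole of R
   that do not charge the non-positive reals, so that functions on the half-line
   are encoded as functions on R. *)

Definition halfline (R : realType) :
    {measure set (measurableTypeR R) -> \bar R} :=
  mrestr (@lebesgue_measure R) (measurable_itv `]0%R, +oo[).
Arguments halfline : clear implicits.

Definition dtt (R : realType) (A : set (measurableTypeR R)) : \bar R :=
  \int[lebesgue_measure]_(t in A `&` `]0%R, +oo[) (t^-1)%:E.
Arguments dtt : clear implicits.

Fact dtt0 (R : realType) : dtt R set0 = 0.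
Proof. by rewrite /dtt set0I integral_set0. Qed.

Fact dtt_ge0 (R : realType) (A : set R) : 0 <= dtt R A.
Proof.
apply: integral_ge0 => t [_]; rewrite /= in_itv/= andbT => t0.
by rewrite lee_fin invr_ge0 ltW.
Qed.

Fact measurable_inv_halfline (R : realType) :
  measurable_fun (`]0%R, +oo[ : set (measurableTypeR R))
    (fun t : R => (t^-1)%:E).
Proof.
apply/measurable_EFinP; apply: open_continuous_measurable_fun.
  exact: interval_open.
move=> t; rewrite inE/= in_itv/= andbT => t0.
by apply: inv_continuous; rewrite gt_eqF.
Qed.

Fact dtt_sigma_additive (R : realType) : semi_sigma_additive (dtt R).
Proof.
move=> F mF tF mUF; rewrite /dtt setI_bigcupl.
apply: cvg_toP.
  apply: ereal_nondecreasing_is_cvgn => m n mn.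
  by apply: lee_sum_nneg_natr => // k _ _; exact: dtt_ge0.
rewrite ge0_integral_bigcup//=.
- by move=> n; exact: measurableI.
- rewrite -setI_bigcupl.
  by apply: measurable_funS (measurable_inv_halfline (R := R)).
- move=> t [n _] [_]; rewrite /= in_itv/= andbT => t0.
  by rewrite lee_fin invr_ge0 ltW.
- exact: trivIset_setIr.
Qed.

HB.instance Definition _ (R : realType) :=
  isMeasure.Build _ _ _ (dtt R) (dtt0 R) (@dtt_ge0 R) (@dtt_sigma_additive R).

Definition tilde (R : realType) (E : ri_space (halfline R))
    (g : R -> \bar R) : \bar R :=
  E (rearr (dtt R) g).

Definition Ltilde (R : realType) (q : \bar R) (g : R -> \bar R) : \bar R :=
  Lnorm (dtt R) q g.

Definition norm_itv (R : realType) (N : (R -> \bar R) -> \bar R) (a b : R)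
    (g : R -> \bar R) : \bar R :=
  N (g \_ `]a, b[).

Definition equiv01 (R : realType) (g h : R -> R) : Prop :=
  exists c C : R, [/\ (0 < c)%R, (0 < C)%R &
    forall t, (0 < t < 1)%R -> (c * g t <= h t <= C * g t)%R].

Definition SV01 (R : realType) (b : R -> R) : Prop :=
  [/\ measurable_fun (`]0%R, 1%R[ : set R) b,
      forall t, (0 < t < 1)%R -> (0 < b t)%R &
      forall e, (0 < e)%R ->
        (exists2 g : R -> R, {in `]0%R, 1%R[ &, {homo g : x y / (x <= y)%R}} &
          equiv01 (fun t => t `^ e * b t)%R g) /\
        (exists2 h : R -> R, {in `]0%R, 1%R[ &, {homo h : x y /~ (x <= y)%R}} &
          equiv01 (fun t => t `^ (- e) * b t)%R h)].

(* A function on ]0, 1[ is extended by 1 to [1, +oo[. *)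
Definition extend1 (R : realType) (b : R -> R) (s : R) : R :=
  if (s < 1)%R then b s else 1%R.

Definition ell (R : realType) (sigma t : R) : R :=
  ((1 + `|ln t|) `^ sigma)%R.

(* A (quasi-)normed space is a subset of an ambient group together with its
   norm, whose values are meaningful on the carrier only. *)

Record nspace (V : zmodType) (R : realType) := NSpace {
  ncarrier : set V ;
  nnorm : V -> \bar R
}.

Definition nspace_eq (V : zmodType) (R : realType) (X Y : nspace V R) : Prop :=
  ncarrier X = ncarrier Y /\
  exists c C : R, [/\ (0 < c)%R, (0 < C)%R &
    forall f, ncarrier X f ->
      c%:E * nnorm X f <= nnorm Y f /\ nnorm Y f <= C%:E * nnorm X f].

Definition nspace_cap (V : zmodType) (R : realType) (X Y : nspace V R) :=
  NSpace (ncarrier X `&` ncarrier Y) (fun f => maxe (nnorm X f) (nnorm Y f)).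

Definition Kfun (V : zmodType) (R : realType) (Y0 Y1 : nspace V R)
    (t : R) (f : V) : \bar R :=
  ereal_inf [set k | exists f0 f1 : V,
    [/\ ncarrier Y0 f0, ncarrier Y1 f1, f = (f0 + f1)%R &
        k = nnorm Y0 f0 + t%:E * nnorm Y1 f1]].

Definition interp_norm (V : zmodType) (R : realType) (Y0 Y1 : nspace V R)
    (theta : R) (b : R -> R) (E : ri_space (halfline R)) (f : V) : \bar R :=
  norm_itv (tilde E) 0 1 (fun t => (t `^ (- theta) * b t)%:E * Kfun Y0 Y1 t f).

Definition interp (V : zmodType) (R : realType) (Y0 Y1 : nspace V R)
    (theta : R) (b : R -> R) (E : ri_space (halfline R)) : nspace V R :=
  let N := interp_norm Y0 Y1 theta b E in
  NSpace (ncarrier Y0 `&` [set f | N f < +oo]) N.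

(* Functions are representatives: functions equal almost everywhere are not
   identified, and norms do not distinguish them.  In [space_L], [space_R],
   [space_RR] and [space_RL] the arguments [E], [F], [G] are norms with respect
   to dt/t, of the form [tilde E] or [Ltilde q]. *)
Definition fspace d (Omega : measurableType d) (R : realType)
    (N : (Omega -> R) -> \bar R) : nspace (Omega -> R) R :=
  NSpace [set f | measurable_fun setT f /\ N f < +oo] N.

Definition fstar d (Omega : measurableType d) (R : realType)
    (mu : probability Omega R) (f : Omega -> R) : R -> \bar R :=
  rearr mu (EFin \o f).

Definition space_L d (Omega : measurableType d) (R : realType)
    (mu : probability Omega R) (p : R) (b : R -> R)
    (E : (R -> \bar R) -> \bar R) :=
  fspace (fun f : Omega -> R =>
    norm_itv E 0 1 (fun t => (t `^ p^-1 * b t)%:E * fstar mu f t)).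

Definition space_R d (Omega : measurableType d) (R : realType)
    (mu : probability Omega R) (p : R)
    (b : R -> R) (E : (R -> \bar R) -> \bar R)
    (a : R -> R) (F : (R -> \bar R) -> \bar R) :=
  fspace (fun f : Omega -> R =>
    norm_itv E 0 1 (fun t => (b t)%:E *
      norm_itv F t 1 (fun s => (s `^ p^-1 * a s)%:E * fstar mu f s))).

Definition space_RR d (Omega : measurableType d) (R : realType)
    (mu : probability Omega R) (p : R)
    (c : R -> R) (E : (R -> \bar R) -> \bar R)
    (b : R -> R) (F : (R -> \bar R) -> \bar R)
    (a : R -> R) (G : (R -> \bar R) -> \bar R) :=
  fspace (fun f : Omega -> R =>
    norm_itv E 0 1 (fun u => (c u)%:E *
      norm_itv F u 1 (fun t => (b t)%:E *
        norm_itv G t 1 (fun s => (s `^ p^-1 * a s)%:E * fstar mu f s)))).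

Definition space_RL d (Omega : measurableType d) (R : realType)
    (mu : probability Omega R) (p : R)
    (c : R -> R) (E : (R -> \bar R) -> \bar R)
    (b : R -> R) (F : (R -> \bar R) -> \bar R)
    (a : R -> R) (G : (R -> \bar R) -> \bar R) :=
  fspace (fun f : Omega -> R =>
    norm_itv E 0 1 (fun u => (c u)%:E *
      norm_itv F 0 u (fun t => (b t)%:E *
        norm_itv G t u (fun s => (s `^ p^-1 * a s)%:E * fstar mu f s)))).

(* The outer norm is that of L_oo(0,1): dt/t and dt have the same null sets
   in (0,1), so Ltilde +oo is the usual essential supremum. *)
Definition grand_L d (Omega : measurableType d) (R : realType)
    (mu : probability Omega R) (p alpha : R) :=
  fspace (fun f : Omega -> R =>
    norm_itv (Ltilde +oo) 0 1 (fun t => (ell (- (alpha / p)) t)%:E *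
      norm_itv (Ltilde p%:E) t 1 (fun s => (s `^ p^-1)%:E * fstar mu f s))).

(* Main.v *)
Require Import Defs.
From mathcomp Require Import all_boot all_order all_algebra.
From mathcomp Require Import all_classical all_reals all_analysis.
From mathcomp Require Import measurable_realfun ess_sup_inf.
From mathcomp Require Import ring lra.

(** Cut (0,1) into the cells ]e^-(k+1), e^-k], which have mass one for dt/t, and
    put x_k = f*(e^-k). A step function on these cells is equimeasurable with a
    step function on the unit cells of the half-line, so the norm of E induces a
    lattice norm [eseq] on sequences which does not increase under injective
    reindexing. All the functions of the statement vary by at most a constant
    factor within a cell, up to a shift by one or two cells, so that every norm
    is an [eseq] norm and the change of variables t = rho(u) is a finite-to-one
    reindexing.

    Truncating f at the height x_k from above, and using
    (f0 + f1)*(s) <= f0*(s/e) + f1*(s/e) from below, one finds that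
    K(rho(e^-k), f) is equivalent to the sum of
    sup_(m > k) l^(-alpha/p0)(e^-m) |f*|_(L_p0(e^-m, e^-k)) and
    rho(e^-k) sup_(m <= k) l^(-beta/p1)(e^-m) |f*|_(L_p1(e^-m, 1)).
    Each summand dominates the local term e^(-k/p0) l^(-alpha/p0)(e^-k) x_k.
    Conversely the first one is at most the sum of the local terms of index
    j >= k, the second one at most the sum of those of index j <= k with weights
    rho(e^-k) / rho(e^-j). As rho is essentially geometric in k, Hardy's
    inequalities bound the first summand by the local terms if theta > 0 and the
    second one if theta < 1. *)

Set Implicit Arguments.
Unset Strict Implicit.
Unset Printing Implicit Defensive.

Import Order.TTheory GRing.Theory Num.Theory.
Import numFieldNormedType.Exports.

Local Open Scope ring_scope.

(** * Rearrangements and step functions *)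

(** Three obstacles shape the proof. The functions inside [tilde] are never shown to be measurable,
    so they are only compared pointwise with step functions, for which monotonicity suffices. The
    rearrangement inside [tilde] is not additive, so the triangle inequality and the Fatou property
    of E are used on the unit cells of the half-line, where E acts on the step function itself.
    Finally, the power of the logarithm may make rho non-monotone and larger than 1: -ln rho is
    controlled only up to an additive constant, and weights and K are considered at t = e^-r for
    every real r.

    The form of rho is forced: it is the quotient of the local weights t^(1/p0) l^(-alpha/p0)(t) and
    t^(1/p1) l^(-beta/p1)(t), so one local term can be read in either space. Since l^1 embeds in
    l^p, the power sums in the inner norms are bounded by linear sums of local terms, and geometric
    weights make Hardy's inequality a mere sum of shifts. Shifts of the index are harmless because
    f*(1) = 0 on a probability space, so that the entry lost at index 0 vanishes. *)

Section rearrangement.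
Local Open Scope classical_set_scope.
Local Open Scope ring_scope.
Local Open Scope ereal_scope.
Context d (T : measurableType d) (R : realType).
Variable mu : {measure set T -> \bar R}.
Implicit Types (f g : T -> \bar R).

Lemma measurable_distr_set f s : measurable_fun setT f ->
  measurable [set x | s%:E < `|f x|].
Proof.
move=> mf; have := measurableT_comp (@abse_measurable R setT) mf.
move=> /(_ measurableT (`]s%:E, +oo[)%classic (emeasurable_itv _)).
rewrite setTI => mA; rewrite (_ : [set x | _] = (abse \o f) @^-1` `]s%:E, +oo[)//.
by apply/seteqP; split => x /=; rewrite in_itv/= andbT.
Qed.

Lemma distr_anti f r s : measurable_fun setT f -> (r <= s)%R ->
  distr mu f s <= distr mu f r.
Proof.
move=> mf rs; apply: le_measure; rewrite ?inE; try exact: measurable_distr_set.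
by move=> x /=; apply: le_lt_trans; rewrite lee_fin.
Qed.

Lemma rearr_ge0 f t : 0 <= rearr mu f t.
Proof. by apply: le_ereal_inf_tmp => _ [s [s0 _] <-]; rewrite lee_fin. Qed.

Lemma rearr_anti f r s : (r <= s)%R -> rearr mu f s <= rearr mu f r.
Proof.
move=> rs; apply: le_ereal_inf => _ [u [u0 uf] <-]; exists u => //; split => //.
by rewrite (le_trans uf)// lee_fin.
Qed.

Lemma le_rearr f g t :
  (forall s, (0 <= s)%R -> distr mu f s <= distr mu g s) ->
  rearr mu f t <= rearr mu g t.
Proof.
move=> fg; apply: le_ereal_inf => _ [u [u0 uf] <-]; exists u => //; split => //.
by rewrite (le_trans _ uf)// fg.
Qed.

(** Right continuity of the distribution function: the set where |f| > s is the increasing union of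
    the sets [F n], so the infimum defining [rearr] is attained. *)
Lemma rearr_leP f s t : measurable_fun setT f -> (0 <= s)%R ->
  rearr mu f t <= s%:E <-> distr mu f s <= t%:E.
Proof.
move=> mf s0; split => [fs|fs]; last by apply: ereal_inf_lbound; exists s.
pose F n := [set x | (s + n.+1%:R^-1)%:E < `|f x|].
have mF n : measurable (F n) by exact: measurable_distr_set.
have eF : \bigcup_n F n = [set x | s%:E < `|f x|].
  apply/seteqP; split => [x [n _]|x] /=.
    by apply: le_lt_trans; rewrite lee_fin lerDl.
  case fx: `|f x| => [r| |] //; last by exists 0%N => //=; rewrite /F/= fx ltry.
  rewrite lte_fin => sr; exists (Num.truncn (r - s)^-1) => //=.
  rewrite /F/= fx lte_fin -ltrBrDl -[ltRHS]invrK ltf_pV2 ?posrE ?invr_gt0 ?subr_gt0//.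
  exact: truncnS_gt.
have cF : mu \o F @ \oo --> mu (\bigcup_n F n).
  apply: nondecreasing_cvg_mu => //; first exact: bigcupT_measurable.
  move=> m n mn; apply/subsetPset => x /=; apply: le_lt_trans.
  by rewrite lee_fin lerD2l lef_pV2 ?posrE// ler_nat.
rewrite /distr -eF -(cvg_lim _ cF)//; apply: lime_le; first by apply/cvg_ex; exists (mu (\bigcup_n F n)).
apply: nearW => n; rewrite /=.
have : rearr mu f t < (s + n.+1%:R^-1)%:E.
  by apply: le_lt_trans fs _; rewrite lte_fin ltrDl invr_gt0.
move=> /ereal_inf_lt[_ [r [r0 fr] <-]]; rewrite lte_fin => /ltW rs.
exact: le_trans (distr_anti mf rs) fr.
Qed.

Lemma lt_rearrP f s t : measurable_fun setT f -> (0 <= s)%R ->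
  (s%:E < rearr mu f t) = (t%:E < distr mu f s).
Proof.
by move=> mf s0; apply/idP/idP; rewrite !ltNge; apply: contra => /rearr_leP; exact.
Qed.

Lemma measurable_rearr f : measurable_fun (setT : set (measurableTypeR R)) (rearr mu f).
Proof.
apply: (measurability _ (ErealGenOInfty.measurableE R)).
move=> /= _ [_ [y ->]] <-; apply: measurableI => //.
apply: is_interval_measurable => s t/=.
rewrite !in_itv/= !andbT => fs ft u /andP[su ut].
by rewrite in_itv/= andbT (lt_le_trans ft)// rearr_anti.
Qed.

Lemma Mplus_rearr f : Mplus (measurableTypeR R) R (rearr mu f).
Proof. by split; [exact: measurable_rearr|move=> ?; exact: rearr_ge0]. Qed.

End rearrangement.

(** * Step functions on a countable family of disjoint cells of mass one *)

Section step_functions.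
Local Open Scope classical_set_scope.
Local Open Scope ring_scope.
Local Open Scope ereal_scope.
Context d (T : measurableType d) (R : realType).
Variable mu : {measure set T -> \bar R}.
Variable idx : T -> option nat.

Definition cell k : set T := [set x | idx x = Some k].

(** Points labelled [None] lie in no cell; with the value 0 they belong to no level set above s >=
    0. *)
Definition step (a : nat -> \bar R) (x : T) : \bar R := oapp a 0 (idx x).

Hypothesis mcell : forall k, measurable (cell k).
Hypothesis cell1 : forall k, mu (cell k) = 1.

Lemma trivIset_cell D : trivIset D cell.
Proof. by move=> i j _ _ [x []]; rewrite /cell/= => -> [->]. Qed.

Lemma measurable_step a : measurable_fun setT (step a).
Proof.
move=> _ Y mY; rewrite setTI.
have eY : step a @^-1` Y = \bigcup_(k in [set k | Y (a k)]) cell k `|`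
    (if `[< Y 0 >] then ~` \bigcup_k cell k else set0).
  apply/seteqP; split => x /=; rewrite /step.
    case ix: (idx x) => [k|] /= Yk; first by left; exists k.
    by right; rewrite asboolT// => -[k _]; rewrite /cell/= ix.
  case=> [[k /= Yk kx]|]; first by rewrite (kx : idx x = Some k).
  case: ifPn => //= /asboolP Y0 nx.
  case ix: (idx x) => [k|//]; exfalso; apply: nx.
  by exists k.
rewrite eY; apply: measurableU; first exact: bigcup_measurable.
by case: ifP => // _; apply: measurableC; exact: bigcup_measurable.
Qed.

(** The right-hand side only counts indices, so step functions with the same values on two families
    of unit cells are equimeasurable, whatever the underlying measures. *)
Lemma distr_step a s : (0 <= s)%R ->
  distr mu (step a) s = \esum_(k in [set k | s%:E < `|a k|]) 1.
Proof.
move=> s0; rewrite /distr.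
have -> : [set x | s%:E < `|step a x|] =
    \bigcup_(k in [set k | s%:E < `|a k|]) cell k.
  apply/seteqP; split => x /=; rewrite /step.
    case ix: (idx x) => [k|] /=; first by exists k.
    by rewrite normr0 lte_fin ltNge s0.
  by case=> k /= ak kx; rewrite (kx : idx x = Some k).
rewrite measure_bigcup//; last exact: trivIset_cell.
by rewrite nneseries_esum// set_mem_set; under eq_esum do rewrite cell1.
Qed.

Lemma integral_step a : (forall k, 0 <= a k) ->
  \int[mu]_x step a x = \sum_(k <oo) a k.
Proof.
move=> a0.
transitivity (\int[mu]_(x in \bigcup_k cell k) step a x).
  rewrite [RHS]integral_mkcond; apply: eq_integral => x _.
  rewrite patchE; case: ifPn => //; rewrite notin_setE /step => nx.
  by case ix: (idx x) => [k|//]; exfalso; apply: nx; exists k.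
rewrite ge0_integral_bigcup//; last 3 first.
- by apply: measurable_funTS; exact: measurable_step.
- by move=> x _; rewrite /step; case: (idx x) => /=.
- exact: trivIset_cell.
apply: eq_eseriesr => k _.
rewrite (eq_integral (cst (a k))) ?integral_cst ?cell1 ?mule1//.
by move=> x; rewrite inE /cell/= /step => ->.
Qed.

End step_functions.

(** * Logarithmic cells of (0,1] and unit cells of the half-line *)

Section blocks.
Local Open Scope classical_set_scope.
Local Open Scope ring_scope.
Local Open Scope ereal_scope.
Context (R : realType).

(** Each cell contains its right endpoint, so the cell of index 0 contains t = 1, which is outside
    (0,1). This is why lower bounds below start from the cell of index 1. *)
Definition didx (t : measurableTypeR R) : option nat :=
  if (0 < t <= 1)%R then Some (Num.truncn (- ln t)) else None.

Definition hidx (x : measurableTypeR R) : option nat :=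
  if (0 <= x)%R then Some (Num.truncn x) else None.

Lemma cell_didxE k :
  cell didx k = `]expR (- k.+1%:R), expR (- k%:R)]%classic.
Proof.
apply/seteqP; split => t; rewrite /cell/= in_itv/= /didx.
  case: ifPn => // /andP[t0 t1] [<-].
  have l0 : (0 <= - ln t)%R by rewrite oppr_ge0 ln_le0.
  have /andP[] := truncn_itv l0; set k' := Num.truncn _ => k1 k2.
  rewrite -(lnK (x := t)) ?posrE// ltr_expR ler_expR lerNr k1 andbT.
  by rewrite ltrNl.
move=> /andP[kt tk]; have t0 : (0 < t)%R by exact: lt_trans (expR_gt0 _) kt.
have t1 : (t <= 1)%R by rewrite (le_trans tk)// -[leRHS]expR0 ler_expR oppr_le0.
rewrite t0 t1/=; congr Some; apply: truncn_def.
rewrite lerNr -ler_expR lnK ?posrE// tk/= ltrNl -ltr_expR lnK ?posrE//.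
Qed.

Lemma cell_hidxE k : cell hidx k = `[k%:R, k.+1%:R[%classic.
Proof.
apply/seteqP; split => t; rewrite /cell/= in_itv/= /hidx.
  by case: ifPn => // t0 [<-]; exact: truncn_itv.
move=> /andP[kt tk]; rewrite (le_trans _ kt)//; congr Some; apply: truncn_def.
by rewrite kt.
Qed.

Lemma measurable_cell_didx k : measurable (cell didx k).
Proof. by rewrite cell_didxE. Qed.

Lemma measurable_cell_hidx k : measurable (cell hidx k).
Proof. by rewrite cell_hidxE. Qed.

Lemma halfline_cell k : halfline R (cell hidx k) = 1.
Proof.
rewrite /halfline/= /mrestr cell_hidxE.
case: k => [|k].
  rewrite (_ : _ `&` _ = `]0%R, 1%R[%classic).
    by rewrite lebesgue_measure_itv/= lte01 oppr0 addr0.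
  apply/seteqP; split => x /=; rewrite !in_itv/= ?andbT.
    by move=> [/andP[_ ->] ->].
  by move=> /andP[x0 ->]; rewrite x0 ltW.
rewrite setIidl; last first.
  move=> x /=; rewrite !in_itv/= andbT => /andP[+ _].
  exact: lt_le_trans.
rewrite lebesgue_measure_itv/= lte_fin ltr_nat leqnn -EFinB.
by rewrite -natrB// subSnn.
Qed.

Lemma dtt_cell k : dtt R (cell didx k) = 1.
Proof.
set a : R := expR (- k.+1%:R); set b : R := expR (- k%:R).
have a0 : (0 < a)%R by exact: expR_gt0.
have ab : (a < b)%R by rewrite ltr_expR ltrN2 ltr_nat.
have b0 : (0 < b)%R by exact: expR_gt0.
rewrite /dtt cell_didxE -/a -/b setIidl; last first.
  by move=> x /=; rewrite !in_itv/= andbT => /andP[+ _]; exact: lt_trans.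
have cinv x : (0 < x)%R -> {for x, continuous (fun t : R => t^-1)%R}.
  by move=> x0; apply: inv_continuous; rewrite gt_eqF.
rewrite integral_itv_obnd_cbnd; last first.
  by apply: measurable_funS (@measurable_inv_halfline R) => // x /=;
    rewrite !in_itv/= andbT => /andP[+ _]; apply: lt_trans.
rewrite (@continuous_FTC2 _ _ (@ln R))//.
- by rewrite -EFinB !expRK opprK addrC -natrB// subSnn.
- apply: continuous_in_subspaceT => x; rewrite inE/= in_itv/= => /andP[ax _].
  by apply: cinv; exact: lt_le_trans ax.
- split.
  + move=> x; rewrite in_itv/= => /andP[ax _].
    by apply: ex_derive; apply: is_derive1_ln; exact: lt_trans ax.
  + by apply: cvg_at_right_filter; exact: continuous_ln.
  + by apply: cvg_at_left_filter; exact: continuous_ln.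
- move=> x; rewrite in_itv/= => /andP[ax _].
  rewrite derive1E; apply: derive_val; apply: is_derive1_ln; exact: lt_trans ax.
Qed.

(** The sets need not be measurable: the integral of a nonnegative function is a supremum over the
    simple functions below it. This frees [le_tilde] from any measurability hypothesis. *)
Lemma le_dtt (A B : set (measurableTypeR R)) : A `<=` B -> dtt R A <= dtt R B.
Proof.
move=> AB; have inv0 (D : set (measurableTypeR R)) x : (D `&` `]0%R, +oo[) x -> 0 <= (x^-1)%:E.
  by move=> [_]; rewrite /= in_itv/= andbT => x0; rewrite lee_fin invr_ge0 ltW.
rewrite /dtt !ge0_integralE; try exact: inv0.
apply: le_ereal_sup => _ [h hx <-]; exists h => //= x.
apply: le_trans (hx x) _; rewrite !patchE; case: ifPn => [|_].
  by rewrite inE => -[Ax x0]; rewrite mem_set//; split => //; exact: AB.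
by case: ifPn => //; rewrite inE => /inv0.
Qed.

End blocks.

(** * The sequence norm induced by E *)

Section lattice_norm.
Local Open Scope classical_set_scope.
Local Open Scope ring_scope.
Local Open Scope ereal_scope.
Context (R : realType) (E : ri_space (halfline R)).
Implicit Types (g h : R -> \bar R) (a : nat -> \bar R).

Lemma le_tilde g h : (forall t, `|g t| <= `|h t|) -> tilde E g <= tilde E h.
Proof.
move=> gh; apply: ri_norm_le; try exact: Mplus_rearr.
apply: aeW => t; apply: le_rearr => s s0; apply: le_dtt => u /=.
by move=> /lt_le_trans; apply.
Qed.

Lemma esum1_pinfty : \esum_(k in [set: nat]) (1 : \bar R) = +oo.
Proof.
rewrite -nneseries_esumT//.
have : forall n, n%:R%:E <= \sum_(k <oo) (1 : \bar R).
  move=> n; rewrite -[n%:R](_ : \sum_(0 <= i < n) 1%R = _)%R; last first.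
    by rewrite big_const_nat subn0 iter_addr_0.
  by rewrite -sumEFin; exact: nneseries_lim_ge.
case: (\sum_(k <oo) (1 : \bar R)) => [r /(_ (Num.truncn r).+1)|//|/(_ 0%N)//].
by rewrite lee_fin leNgt truncnS_gt.
Qed.

Lemma dtt_setT : dtt R setT = +oo.
Proof.
apply/eqP; rewrite -leye_eq -esum1_pinfty.
have := @distr_step _ _ _ (dtt R) _ (@measurable_cell_didx R) (@dtt_cell R) (fun=> 1) 0%R (lexx _).
rewrite (_ : [set k | _] = setT); last by apply/seteqP; split => k //= _; rewrite normr1 lte_fin.
by move=> <-; exact: le_dtt.
Qed.

Lemma distr_rearr g s : measurable_fun setT g ->
  distr (halfline R) (rearr (dtt R) g) s = distr (dtt R) g s.
Proof.
(* [ri_norm_rearr] asks for every real level. Below 0 both level sets are the whole space, of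
   infinite mass; at s >= 0 the level set of the rearrangement is an interval starting at 0 of
   length [distr (dtt R) g s]. *)
move=> mg; have [s0|s0] := leP 0%R s; last first.
  rewrite /distr (_ : [set x | _] = setT); last first.
    by apply/seteqP; split => x //= _; apply: lt_le_trans (abse_ge0 _); rewrite lte_fin.
  rewrite (_ : [set x | _] = setT); last first.
    by apply/seteqP; split => x //= _; apply: lt_le_trans (abse_ge0 _); rewrite lte_fin.
  rewrite /halfline/= /mrestr setTI lebesgue_measure_itv/= ltry.
  exact: esym dtt_setT.
rewrite -[LHS]/(lebesgue_measure
  ([set x | s%:E < `|rearr (dtt R) g x|] `&` `]0%R, +oo[)).
have -> : [set x | s%:E < `|rearr (dtt R) g x|] = [set x | x%:E < distr (dtt R) g s].
  by apply/seteqP; split => x /=; rewrite gee0_abs ?rearr_ge0// lt_rearrP.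
have : 0 <= distr (dtt R) g s by exact: measure_ge0.
move: (distr (dtt R) g s) => [r| |] //= r0.
  rewrite (_ : _ `&` _ = `]0%R, r[%classic).
    rewrite lebesgue_measure_itv/= lte_fin; case: ltP => [_|r0'].
      by rewrite oppr0 addr0.
    by apply/eqP; rewrite eq_le r0/= lee_fin.
  by apply/seteqP; split => x /=; rewrite !in_itv/= ?andbT ?lte_fin; [case=> -> ->|move=> /andP[]].
rewrite (_ : _ `&` _ = `]0%R, +oo[%classic).
  by rewrite lebesgue_measure_itv/= ltry.
by apply/seteqP; split => x /=; rewrite !in_itv/= ?andbT ?ltry; [case|].
Qed.

Definition eseq a : \bar R := tilde E (step (@didx R) a).

Definition nnseq a := forall k, 0 <= a k.

Lemma Mplus_hstep a : nnseq a -> Mplus (measurableTypeR R) R (step (@hidx R) a).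
Proof.
move=> a0; split; first exact: (measurable_step (@measurable_cell_hidx R)).
by move=> x; rewrite /step; case: hidx => /=.
Qed.

(** Both step functions have the same distribution by [distr_step]. The right-hand side is linear in
    the step function before E is applied, which gives access to [ri_normD] and [ri_norm_fatou]. *)
Lemma eseqE a : nnseq a -> eseq a = E (step (@hidx R) a).
Proof.
move=> a0; apply: ri_norm_rearr; [exact: Mplus_rearr|exact: Mplus_hstep|] => s.
have mD := measurable_step (@measurable_cell_didx R) a.
rewrite distr_rearr//.
have [s0|s0] := leP 0%R s.
  rewrite (distr_step (@measurable_cell_didx R) (@dtt_cell R))//.
  by rewrite (distr_step (@measurable_cell_hidx R) (@halfline_cell R)).
rewrite /distr (_ : [set x | _] = setT); last first.
  by apply/seteqP; split => x //= _; apply: lt_le_trans (abse_ge0 _); rewrite lte_fin.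
rewrite (_ : [set x | _] = setT); last first.
  by apply/seteqP; split => x //= _; apply: lt_le_trans (abse_ge0 _); rewrite lte_fin.
rewrite /halfline/= /mrestr setTI lebesgue_measure_itv/= ltry.
exact: dtt_setT.
Qed.

Lemma eseq_ge0 a : 0 <= eseq a.
Proof. by apply: ri_norm_ge0; exact: Mplus_rearr. Qed.

(** At every level s >= 0, [phi] embeds the indices where a exceeds s into those where a' does, and
    the norm depends on these counts monotonically. *)
Lemma eseq_inj a a' (D : set nat) (phi : nat -> nat) : nnseq a -> nnseq a' ->
  set_inj D phi -> (forall k, D k -> a k <= a' (phi k)) ->
  (forall k, ~ D k -> a k = 0) -> eseq a <= eseq a'.
Proof.
move=> a0 a'0 iphi Da nDa; apply: ri_norm_le; try exact: Mplus_rearr.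
apply: aeW => t; apply: le_rearr => s s0.
rewrite !(distr_step (@measurable_cell_didx R) (@dtt_cell R))//.
(* Indices above the level lie in D, as a vanishes elsewhere and s >= 0; so [phi] is injective on
   them. *)
rewrite -(esum_image _ phi (fun=> 1)); last first.
  move=> i j; rewrite !inE/= => si sj; apply: iphi; rewrite inE.
    apply: contrapT => nD; move: si; rewrite nDa// abse0 lte_fin.
    by rewrite ltNge s0.
  apply: contrapT => nD; move: sj; rewrite nDa// abse0 lte_fin.
  by rewrite ltNge s0.
rewrite esum_mkcond [leRHS]esum_mkcond; apply: le_esum => j _.
case: ifPn => [|_]; last by case: ifPn.
rewrite inE/= => -[k sk <-]; rewrite mem_set//=; apply: (lt_le_trans sk).
rewrite !gee0_abs//; apply: Da; apply: contrapT => nD; move: sk.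
by rewrite nDa// abse0 lte_fin ltNge s0.
Qed.

Lemma le_eseq a a' : nnseq a -> (forall k, a k <= a' k) -> eseq a <= eseq a'.
Proof.
move=> a0 aa'; apply: (@eseq_inj _ _ setT id) => //.
- by move=> k; exact: le_trans (a0 k) (aa' k).
- by move=> k; case.
Qed.

Lemma eseqZ (c : R) a : (0 <= c)%R -> nnseq a ->
  eseq (fun k => c%:E * a k) = c%:E * eseq a.
Proof.
move=> c0 a0; rewrite !eseqE//; last by move=> k; rewrite mule_ge0.
rewrite -ri_normZ//; last exact: Mplus_hstep.
by congr (ri_norm E _); apply/funext => x; rewrite /step; case: hidx => //=; rewrite mule0.
Qed.

Lemma eseqD a a' : nnseq a -> nnseq a' ->
  eseq (fun k => a k + a' k) <= eseq a + eseq a'.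
Proof.
move=> a0 a'0; rewrite !eseqE//; last by move=> k; rewrite adde_ge0.
apply: le_trans (ri_normD E (Mplus_hstep a0) (Mplus_hstep a'0)).
rewrite le_eqVlt; apply/orP; left; apply/eqP.
by congr (ri_norm E _); apply/funext => x; rewrite /step; case: hidx => //=; rewrite adde0.
Qed.

Lemma eseq_sum n (a : nat -> nat -> \bar R) : (forall i, nnseq (a i)) ->
  eseq (fun k => \sum_(0 <= i < n) a i k) <= \sum_(0 <= i < n) eseq (a i).
Proof.
move=> a0; elim: n => [|n IH].
  under [X in eseq X]eq_fun do rewrite big_nil.
  rewrite big_nil.
  (* The zero sequence has norm 0 by homogeneity with the scalar 0. *)
  have -> : (fun=> 0) = (fun k : nat => 0%R%:E * (0 : \bar R)).
    by apply/funext => k; rewrite mul0e.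
  by rewrite eseqZ// mul0e.
rewrite big_nat_recr//=.
under [X in eseq X]eq_fun do rewrite big_nat_recr//=.
apply: le_trans (eseqD _ _) _ => //; last by rewrite leeD2r.
by move=> k; apply: sume_ge0 => i _; exact: a0.
Qed.

(** The Fatou property turns the finite triangle inequality into one for series. *)
Lemma eseq_series (a : nat -> nat -> \bar R) : (forall i, nnseq (a i)) ->
  eseq (fun k => \sum_(i <oo) a i k) <= \sum_(i <oo) eseq (a i).
Proof.
move=> a0; have S0 n : nnseq (fun k => \sum_(0 <= i < n) a i k).
  by move=> k; apply: sume_ge0 => i _; exact: a0.
have S1 : nnseq (fun k => \sum_(i <oo) a i k).
  by move=> k; apply: nneseries_ge0 => i _ _; exact: a0.
have mono k : nondecreasing_seq (fun n => \sum_(0 <= i < n) a i k).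
  by move=> m n mn; apply: lee_sum_nneg_natr => // i _ _; exact: a0.
have cv : ri_norm E (step (@hidx R) (fun k => \sum_(0 <= i < n) a i k)) @[n --> \oo]
    --> ri_norm E (step (@hidx R) (fun k => \sum_(i <oo) a i k)).
  apply: ri_norm_fatou.
  - by move=> n; exact: Mplus_hstep.
  - exact: Mplus_hstep.
  - by apply: aeW => x m n mn; rewrite /step; case: hidx => //= k; exact: mono.
  - apply: aeW => x; rewrite /step; case: hidx => [k|] /=; last exact: cvg_cst.
    exact: ereal_nondecreasing_is_cvgn.
rewrite eseqE// -(cvg_lim _ cv)//; apply: lime_le; first by apply/cvg_ex; eexists; exact: cv.
apply: nearW => n; rewrite -eseqE//; apply: le_trans (eseq_sum _ _) _ => //.
by apply: nneseries_lim_ge => i _ _; exact: eseq_ge0.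
Qed.

(** E embeds locally into L1: the axiom [ri_norm_integral] on a single cell bounds the entry by the
    norm. This later shows that finite target norm implies membership in the larger grand space. *)
Lemma eseq_lty a k : nnseq a -> eseq a < +oo -> a k < +oo.
Proof.
move=> a0; rewrite eseqE// => ea.
have [||C C0 /(_ _ (Mplus_hstep a0))] := @ri_norm_integral _ _ _ _ E (cell (@hidx R) k).
- exact: measurable_cell_hidx.
- by rewrite halfline_cell ltry.
rewrite (eq_integral (cst (a k))); last first.
  by move=> x; rewrite inE /cell/= /step => ->.
rewrite integral_cst; last exact: measurable_cell_hidx.
move=> H; have : a k * 1 <= C%:E * E (step (@hidx R) a) by rewrite -(halfline_cell R k).
rewrite mule1 => /le_lt_trans; apply; apply: lte_mul_pinfty => //.
by rewrite lee_fin ltW.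
Qed.

End lattice_norm.

(** * Inner norms on the cells *)

Section cellwise_norms.
Local Open Scope classical_set_scope.
Local Open Scope ring_scope.
Local Open Scope ereal_scope.
Context (R : realType).
Implicit Types (g : R -> \bar R) (a : nat -> \bar R).

Lemma didx_cell t : (0 < t <= 1)%R -> exists k, cell (@didx R) k t.
Proof. by move=> t01; exists (Num.truncn (- ln t)); rewrite /cell/= /didx t01. Qed.

Lemma cellP k t :
  cell (@didx R) k t <-> (expR (- k.+1%:R) < t <= expR (- k%:R))%R.
Proof. by rewrite cell_didxE/= in_itv. Qed.

Lemma cell_gt0 k t : cell (@didx R) k t -> (0 < t)%R.
Proof. by move/cellP => /andP[+ _]; apply: lt_trans; exact: expR_gt0. Qed.

Lemma expRNn_le1 k : (expR (- k%:R) <= 1 :> R)%R.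
Proof. by rewrite -[leRHS]expR0 ler_expR oppr_le0. Qed.

Lemma expRNn_lt1 k : (expR (- k.+1%:R) < 1 :> R)%R.
Proof. by rewrite -[ltRHS]expR0 ltr_expR oppr_lt0. Qed.

Lemma cellS_lt1 k t : cell (@didx R) k.+1 t -> (t < 1)%R.
Proof. by move/cellP => /andP[_ /le_lt_trans]; apply; exact: expRNn_lt1. Qed.

Lemma norm_itv_tilde_ub (E : ri_space (halfline R)) g a : nnseq a ->
  (forall k t, cell (@didx R) k t -> (t < 1)%R -> `|g t| <= a k) ->
  norm_itv (tilde E) 0 1 g <= eseq E a.
Proof.
move=> a0 ga; apply: le_tilde => t; rewrite patchE; case: ifPn.
  rewrite inE/= in_itv/= => /andP[t0 t1].
  have [|k kt] := @didx_cell t; first by rewrite t0 ltW.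
  by rewrite /step (kt : didx t = Some k)/= (le_trans (ga _ _ kt _))// lee_abs.
by rewrite abse0 abse_ge0.
Qed.

(** The restriction of g to (0,1) vanishes at t = 1, so the cell of index 0 cannot be used; moving a
    by one index keeps its norm by [eseq_inj]. *)
Lemma norm_itv_tilde_lb (E : ri_space (halfline R)) g a : nnseq a ->
  (forall k t, cell (@didx R) k.+1 t -> a k <= `|g t|) ->
  eseq E a <= norm_itv (tilde E) 0 1 g.
Proof.
move=> a0 ga; pose a' k := if k is k'.+1 then a k' else 0.
have a'0 : nnseq a' by case.
apply: (@le_trans _ _ (eseq E a')).
  apply: (@eseq_inj _ _ _ _ setT S) => //; last by move=> k; case.
  by move=> i j _ _ [].
apply: le_tilde => t; rewrite /step.
case it : didx => [[|k]|] /=; rewrite ?normr0 ?abse_ge0//.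
rewrite gee0_abs// patchE mem_set/=; first exact: (ga k t it).
by rewrite /= in_itv/= (cell_gt0 it) (cellS_lt1 it).
Qed.

Lemma ge0_le_integralT d (T : measurableType d) (mu : {measure set T -> \bar R})
    (f g : T -> \bar R) : (forall x, 0 <= f x) -> (forall x, f x <= g x) ->
  \int[mu]_x f x <= \int[mu]_x g x.
Proof.
move=> f0 fg; rewrite !ge0_integralE//; last by move=> x _; exact: le_trans (fg x).
apply: le_ereal_sup => _ [h hx <-]; exists h => //= x.
by have /= hx' := hx; apply: le_trans (hx' x) _; rewrite !patchT ?inE.
Qed.

Lemma Linf_ub u v g (M : \bar R) : 0 <= M ->
  (forall t, (u < t < v)%R -> `|g t| <= M) ->
  norm_itv (Ltilde +oo) u v g <= M.
Proof.
move=> M0 gM; rewrite /norm_itv /Ltilde unlock; case: ifPn => // _.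
apply/ess_supP; apply: aeW => t /=; rewrite patchE; case: ifPn.
  by rewrite inE/= in_itv/=; exact: gM.
by rewrite abse0.
Qed.

(** An essential supremum below M would put a whole cell, of mass one, inside a null set. *)
Lemma Linf_lb u v g (M : \bar R) k :
  (forall t, cell (@didx R) k t -> (u < t < v)%R /\ M <= `|g t|) ->
  M <= norm_itv (Ltilde +oo) u v g.
Proof.
move=> gM; rewrite /norm_itv /Ltilde unlock ifT; last first.
  by rewrite (_ : _ setT = +oo)//; exact: dtt_setT.
set h := abse \o _.
have [//|lt_supM] := leP M (ess_sup (dtt R) h).
have [N [mN N0 hN]] := ess_sup_ge (dtt R) h.
have : cell (@didx R) k `<=` N.
  move=> t /gM [uv Mg]; apply: hN => /=; apply/negP.
  rewrite -ltNge; apply: (lt_le_trans lt_supM); rewrite /h /= patchE.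
  by case: ifPn => //; rewrite notin_setE /= in_itv.
move=> /le_dtt; rewrite dtt_cell => dN.
have : (1 : \bar R) <= 0 by rewrite -[leRHS]N0.
by rewrite lee_fin ler10.
Qed.

Lemma eseries_itv (u : nat -> R) k m :
  \sum_(j <oo) (if (k <= j < m)%N then (u j)%:E else 0) =
  (\sum_(k <= j < m) u j)%:E.
Proof.
apply: cvg_lim => //; apply: cvg_near_cst; near=> n.
have mn : (m <= n)%N by near: n; exact: nbhs_infty_ge.
rewrite -sumEFin (big_nat_widen k m n)// (big_nat_widenl k 0 n)//.
by rewrite [RHS]big_mkcond; apply: eq_bigr => j _; rewrite andbC.
Unshelve. all: by end_near. Qed.

End cellwise_norms.

(** * Discrete power sums and logarithmic weights *)

Section block_sums.
Local Open Scope classical_set_scope.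
Local Open Scope ring_scope.
Context (R : realType).
Implicit Types (p sigma : R) (x : nat -> R).

(** For [x j] = f*(e^-j) this is, up to constants and a shift of x, the p-th power of the norm of
    s^(1/p) f*(s) in the space L_p for ds/s on (e^-m, e^-k). *)
Definition blocksum p x k m : R :=
  \sum_(k <= j < m) expR (- j%:R) * x j `^ p.

(** The value of [ell (- sigma)] at e^-k. *)
Definition logweight sigma k : R := (1 + k%:R) `^ (- sigma).

Lemma blocksum_ge0 p x k m : 0 <= blocksum p x k m.
Proof. by apply: sumr_ge0 => j _; rewrite mulr_ge0 ?expR_ge0 ?powR_ge0. Qed.

Lemma logweight_gt0 sigma k : 0 < logweight sigma k.
Proof. by rewrite powR_gt0// ltr_wpDr. Qed.

Lemma le_logweight sigma k m : 0 <= sigma -> (k <= m)%N ->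
  logweight sigma m <= logweight sigma k.
Proof.
move=> s0 km; rewrite /logweight !powRN lef_pV2 ?posrE ?powR_gt0 ?ltr_wpDr//.
by apply: ge0_ler_powR => //; rewrite ?nnegrE ?addr_ge0// lerD2l ler_nat.
Qed.

Lemma logweightS sigma k : 0 <= sigma ->
  logweight sigma k <= 2 `^ sigma * logweight sigma k.+1.
Proof.
move=> s0; rewrite /logweight !powRN ler_pdivlMr ?powR_gt0 ?ltr_wpDr//.
rewrite mulrC ler_pdivrMr ?powR_gt0 ?ltr_wpDr// -powRM ?addr_ge0//.
apply: ge0_ler_powR; rewrite ?nnegrE ?mulr_ge0 ?addr_ge0//.
by rewrite -natr1; have := ler0n R k; lra.
Qed.

Lemma ell_cell sigma k t : 0 <= sigma -> cell (@didx R) k t ->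
  logweight sigma k.+1 <= ell (- sigma) t <= logweight sigma k.
Proof.
move=> s0 kt; have t0 := cell_gt0 kt; have /cellP /andP[kt1 kt2] := kt.
have /andP[l1 l2] : k%:R <= - ln t <= k.+1%:R.
  rewrite lerNr -ler_expR lnK ?posrE// kt2/= lerNl -ler_expR lnK ?posrE//.
  exact: ltW.
have l0 : 0 <= - ln t by exact: le_trans l1.
rewrite /ell /logweight !powRN -[ln t]opprK normrN ger0_norm//.
rewrite !lef_pV2 ?posrE ?powR_gt0 ?ltr_wpDr//.
by apply/andP; split; apply: ge0_ler_powR => //; rewrite ?nnegrE ?addr_ge0// lerD2l.
Qed.

Lemma blocksum_shift p x k m : blocksum p (fun j => x j.+1) k m =
  expR 1 * blocksum p x k.+1 m.+1.
Proof.
rewrite /blocksum big_add1/= mulr_sumr; apply: eq_bigr => j _.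
by rewrite mulrA -expRD -natr1 opprD addrCA subrr addr0.
Qed.

Lemma powR_powRV (y p : R) : 0 < p -> 0 <= y -> (y `^ p^-1) `^ p = y.
Proof. by move=> p0 y0; rewrite -powRrM mulVf ?gt_eqF// powRr1. Qed.

Lemma le_blocksum p x k k' m m' : (k' <= k)%N -> (m <= m')%N ->
  blocksum p x k m <= blocksum p x k' m'.
Proof.
move=> kk mm; rewrite /blocksum (big_nat_widen k m m')// (big_nat_widenl k k' m')//.
rewrite big_mkcond/=; apply: ler_sum => j _.
by case: ifP => // _; rewrite mulr_ge0 ?expR_ge0 ?powR_ge0.
Qed.

End block_sums.

(** * Inner norms of a nonincreasing function [X], playing the role of f*, as block sums *)

Section inner_norms.
Local Open Scope classical_set_scope.
Local Open Scope ring_scope.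
Local Open Scope ereal_scope.
Context (R : realType) (X : R -> \bar R) (x : nat -> R).
Hypothesis X_ge0 : forall t, 0 <= X t.
Hypothesis X_anti : forall s t, (s <= t)%R -> X t <= X s.
Hypothesis XE : forall k, X (expR (- k%:R)) = (x k)%:E.
Hypothesis x00 : x 0%N = 0%R.
Implicit Types (p sigma : R).

Lemma seq_ge0 k : (0 <= x k)%R.
Proof. by rewrite -lee_fin -XE. Qed.

Lemma X_cell k t : cell (@didx R) k t -> (x k)%:E <= X t <= (x k.+1)%:E.
Proof.
by move/cellP => /andP[kt tk]; rewrite -!XE !X_anti// ltW.
Qed.

Definition Lpitv p a b : \bar R :=
  norm_itv (Ltilde p%:E) a b (fun s => (s `^ p^-1)%:E * X s).

Lemma integrand_ge0 p t : 0 <= (t `^ p^-1)%:E * X t.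
Proof. by rewrite mule_ge0// lee_fin powR_ge0. Qed.

(** The points of ]a, b[ lie in the cells of index k <= j < m, where the integrand is dominated by a
    constant. *)
Lemma Lpitv_ub p a b k m : (0 < p)%R -> (expR (- m%:R) <= a)%R ->
  (b <= expR (- k%:R))%R ->
  Lpitv p a b <= ((expR 1 * blocksum p x k.+1 m.+1) `^ p^-1)%:E.
Proof.
move=> p0 ma bk; rewrite -blocksum_shift -poweR_EFin.
rewrite /Lpitv /norm_itv /Ltilde unlock.
(* On the cell of index j, t is at most e^-j and X is at most its value [x j.+1] at the left end. *)
pose c j := if (k <= j < m)%N then (expR (- j%:R) * x j.+1 `^ p)%:E else 0.
have c0 : nnseq c.
  by move=> j; rewrite /c; case: ifP => // _; rewrite lee_fin mulr_ge0 ?expR_ge0 ?powR_ge0.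
rewrite /blocksum -eseries_itv -/c.
rewrite -(integral_step (@measurable_cell_didx R) (@dtt_cell R) c0).
have s0 t : 0 <= step (@didx R) c t by rewrite /step; case: didx => /=.
apply: gt0_ler_poweR; rewrite ?invr_ge0 ?(ltW p0)//.
- by rewrite in_itv/= leey andbT integral_ge0// => t _; exact: poweR_ge0.
- by rewrite in_itv/= leey andbT integral_ge0.
apply: ge0_le_integralT => t; first exact: poweR_ge0.
rewrite patchE; case: ifPn => [|_]; last by rewrite abse0 poweR0r ?gt_eqF.
rewrite inE/= in_itv/= => /andP[at_ tb].
have t0 : (0 < t)%R by apply: lt_trans at_; apply: lt_le_trans ma; exact: expR_gt0.
have [|j jt] := @didx_cell R t.
  by rewrite t0 (le_trans (ltW tb))// (le_trans bk)// expRNn_le1.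
have /cellP/andP[jt1 jt2] := jt.
rewrite /step (jt : didx t = Some j)/= /c ifT; last first.
  apply/andP; split.
    have : (expR (- j.+1%:R) < expR (- k%:R) :> R)%R.
      by apply: lt_trans jt1 _; apply: lt_le_trans tb bk.
    by rewrite ltr_expR ltrN2 ltr_nat ltnS.
  have : (expR (- m%:R) < expR (- j%:R) :> R)%R.
    by apply: le_lt_trans ma _; apply: lt_le_trans at_ jt2.
  by rewrite ltr_expR ltrN2 ltr_nat.
have /andP[_ Xx] := X_cell jt.
rewrite gee0_abs ?integrand_ge0//.
rewrite -(@powR_powRV R (expR (- j%:R) * x j.+1 `^ p) p)//; last first.
  by rewrite mulr_ge0 ?expR_ge0 ?powR_ge0.
rewrite -[leRHS]poweR_EFin; apply: gt0_ler_poweR; rewrite ?(ltW p0)//.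
- by rewrite in_itv/= leey andbT integrand_ge0.
- by rewrite in_itv/= leey andbT lee_fin powR_ge0.
rewrite powRM ?expR_ge0 ?powR_ge0// -powRrM mulfV ?gt_eqF// powRr1 ?seq_ge0//.
rewrite EFinM lee_pmul ?lee_fin ?powR_ge0//.
by apply: ge0_ler_powR; rewrite ?invr_ge0 ?nnegrE ?expR_ge0// ltW.
Qed.

(** The bound on b is strict because the interval is open while a cell contains its right
    endpoint. *)
Lemma Lpitv_lb p a b k m : (0 < p)%R -> (a <= expR (- m%:R))%R ->
  (expR (- k%:R) < b)%R ->
  ((expR (-1) * blocksum p x k m) `^ p^-1)%:E <= Lpitv p a b.
Proof.
move=> p0 ma bk; rewrite -poweR_EFin.
rewrite /Lpitv /norm_itv /Ltilde unlock.
(* The factor e^-1 pays for t > e^-(j+1); X is at least its value [x j] at the right end. *)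
pose c j := if (k <= j < m)%N then (expR (-1) * (expR (- j%:R) * x j `^ p))%:E else 0.
have c0 : nnseq c.
  by move=> j; rewrite /c; case: ifP => // _; rewrite lee_fin !mulr_ge0 ?expR_ge0 ?powR_ge0.
rewrite /blocksum mulr_sumr -eseries_itv -/c.
rewrite -(integral_step (@measurable_cell_didx R) (@dtt_cell R) c0).
have s0 t : 0 <= step (@didx R) c t by rewrite /step; case: didx => /=.
apply: gt0_ler_poweR; rewrite ?invr_ge0 ?(ltW p0)//.
- by rewrite in_itv/= leey andbT integral_ge0.
- by rewrite in_itv/= leey andbT integral_ge0// => t _; exact: poweR_ge0.
apply: ge0_le_integralT => t //.
rewrite /step; case jt : (didx t) => [j|] /=; last exact: poweR_ge0.
rewrite /c; case: ifPn => [/andP[kj jm]|_]; last exact: poweR_ge0.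
have /cellP/andP[jt1 jt2] := jt.
rewrite patchE mem_set/=; last first.
  rewrite in_itv/=; apply/andP; split.
    apply: le_lt_trans jt1; apply: (le_trans ma).
    by rewrite ler_expR lerN2 ler_nat.
  apply: (le_lt_trans jt2); apply: le_lt_trans bk.
  by rewrite ler_expR lerN2 ler_nat.
have /andP[xX _] := X_cell jt.
rewrite gee0_abs ?integrand_ge0//.
rewrite -(@powR_powRV R (expR (- 1) * (expR (- j%:R) * x j `^ p)) p)//; last first.
  by rewrite !mulr_ge0 ?expR_ge0 ?powR_ge0.
rewrite -[leLHS]poweR_EFin; apply: gt0_ler_poweR; rewrite ?(ltW p0)//.
- by rewrite in_itv/= leey andbT lee_fin powR_ge0.
- by rewrite in_itv/= leey andbT integrand_ge0.
rewrite mulrA -expRD powRM ?expR_ge0 ?powR_ge0// -powRrM mulfV ?gt_eqF// powRr1 ?seq_ge0//.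
rewrite EFinM lee_pmul ?lee_fin ?powR_ge0 ?seq_ge0//.
apply: ge0_ler_powR; rewrite ?invr_ge0 ?nnegrE ?expR_ge0 ?(ltW p0) ?(ltW (cell_gt0 jt))//.
by rewrite -opprD [(1 + _)%R]addrC natr1 ltW.
Qed.

Definition wsum p sigma k m : \bar R :=
  (logweight sigma m * blocksum p x k m `^ p^-1)%:E.

(** Discrete counterpart of [RLnorm]; the indices m <= k give empty blocks and contribute 0. *)
Definition supR p sigma k : \bar R := ereal_sup (range (wsum p sigma k)).

(** Discrete counterpart of [RRnorm]: all blocks start at 0, that is at t = 1. *)
Definition supL p sigma k : \bar R :=
  ereal_sup (wsum p sigma 0 @` [set m | (m <= k)%N]).

Lemma wsum_ge0 p sigma k m : 0 <= wsum p sigma k m.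
Proof. by rewrite lee_fin mulr_ge0 ?powR_ge0. Qed.

Lemma wsum_supR p sigma k m : wsum p sigma k m <= supR p sigma k.
Proof. by apply: ereal_sup_ubound; exists m. Qed.

Lemma wsum_supL p sigma k m : (m <= k)%N -> wsum p sigma 0 m <= supL p sigma k.
Proof. by move=> mk; apply: ereal_sup_ubound; exists m. Qed.

Lemma supR_ge0 p sigma k : 0 <= supR p sigma k.
Proof. exact: le_trans (wsum_ge0 p sigma k 0) (wsum_supR _ _ _ _). Qed.

Lemma supL_ge0 p sigma k : 0 <= supL p sigma k.
Proof. by apply: le_trans (wsum_ge0 p sigma 0 0) (wsum_supL _ _ _). Qed.

(* [wconst] absorbs the loss caused by moving a weight or a block by two. *)
Definition wconst p sigma : R := (2 `^ sigma * 2 `^ sigma * expR 1 `^ p^-1)%R.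

Lemma wconst_gt0 p sigma : (0 < wconst p sigma)%R.
Proof. by rewrite !mulr_gt0// powR_gt0// expR_gt0. Qed.

(** The upper index moves by two: once because the cell of t reaches down to e^-(m+1), once because
    X is bounded by its value at the next endpoint. *)
Lemma Lpitv_cell_ub p sigma t u k m : (0 < p)%R -> (0 <= sigma)%R ->
  cell (@didx R) m t -> (u <= expR (- k%:R))%R ->
  (ell (- sigma) t)%:E * Lpitv p t u <=
  (wconst p sigma)%:E * wsum p sigma k.+1 m.+2.
Proof.
move=> p0 s0 mt uk; have /cellP/andP[mt1 _] := mt.
have /andP[_ l2] := ell_cell s0 mt.
apply: (@le_trans _ _ ((logweight sigma m)%:E * ((expR 1 * blocksum p x k.+1 m.+2) `^ p^-1)%:E)).
  apply: lee_pmul; rewrite ?lee_fin ?powR_ge0 ?Lnorm_ge0//.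
  by apply: Lpitv_ub => //; exact: ltW.
rewrite -!EFinM lee_fin powRM ?expR_ge0 ?blocksum_ge0// /wconst.
have h : (logweight sigma m <= 2 `^ sigma * 2 `^ sigma * logweight sigma m.+2)%R.
  rewrite (le_trans (logweightS _ _))// -mulrA ler_pM2l ?powR_gt0//.
  exact: logweightS.
have e0 : (0 <= expR 1 `^ p^-1 * blocksum p x k.+1 m.+2 `^ p^-1)%R.
  by rewrite mulr_ge0 ?powR_ge0.
by apply: (le_trans (ler_wpM2r e0 h)); rewrite le_eqVlt; apply/orP; left; apply/eqP; ring.
Qed.

Lemma Lpitv_cell_lb p sigma t u k m : (0 < p)%R -> (0 <= sigma)%R ->
  cell (@didx R) m t -> (expR (- k%:R) < u)%R ->
  wsum p sigma k m <=
  (wconst p sigma)%:E * ((ell (- sigma) t)%:E * Lpitv p t u).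
Proof.
move=> p0 s0 mt uk; have /cellP/andP[_ mt2] := mt.
have /andP[l1 _] := ell_cell s0 mt.
apply: (@le_trans _ _ ((wconst p sigma)%:E * ((logweight sigma m.+1)%:E *
    ((expR (- 1) * blocksum p x k m) `^ p^-1)%:E))); last first.
  rewrite lee_pmul2l ?lte_fin ?wconst_gt0//.
  apply: lee_pmul; rewrite ?lee_fin ?powR_ge0//.
  by apply: Lpitv_lb.
rewrite -!EFinM lee_fin powRM ?expR_ge0 ?blocksum_ge0// /wconst.
(* One shift of the weight is enough; the second factor 2^sigma >= 1 only makes the constant agree
   with the upper bound. *)
have h : (logweight sigma m <= 2 `^ sigma * 2 `^ sigma * logweight sigma m.+1)%R.
  rewrite (le_trans (logweightS _ _))// ler_wpM2r ?powR_ge0// ler_peMr ?powR_ge0//.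
  by rewrite -[leLHS](powRr0 2) ler_powR// ler1n.
apply: (le_trans (ler_wpM2r (powR_ge0 _ _) h)).
have : (expR 1 `^ p^-1 * expR (- 1) `^ p^-1 = 1)%R.
  by rewrite -powRM ?expR_ge0// -expRD subrr expR0 powR1.
move: (expR 1 `^ _)%R (expR (- 1) `^ _)%R => e e' ee'.
move: (logweight _ _) (2 `^ sigma)%R (blocksum _ _ _ _ `^ _)%R => w q s.
rewrite (_ : q * q * e * (w * (e' * s)) = q * q * w * s * (e * e'))%R; last by ring.
by rewrite ee' mulr1.
Qed.

(** At u = 1, with X = f*, this is the norm of the grand Lebesgue space with alpha / p = sigma. *)
Definition RLnorm p sigma u : \bar R :=
  norm_itv (Ltilde +oo) 0 u (fun t => (ell (- sigma) t)%:E * Lpitv p t u).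

Definition RRnorm p sigma u : \bar R :=
  norm_itv (Ltilde +oo) u 1 (fun t => (ell (- sigma) t)%:E * Lpitv p t 1).

Lemma ellLp_ge0 p sigma t u : 0 <= (ell (- sigma) t)%:E * Lpitv p t u.
Proof. by rewrite mule_ge0 ?lee_fin ?powR_ge0 ?Lnorm_ge0. Qed.

Lemma wsum_ge p sigma k m : (0 < p)%R -> (m <= k)%N -> wsum p sigma k m = 0.
Proof.
move=> p0 mk; rewrite /wsum /blocksum big_geq// powR0 ?mulr0//.
by rewrite invr_eq0 gt_eqF.
Qed.

(** The first term vanishes: [x 0] stands for f*(1), which is 0 on a probability space. *)
Lemma blocksum1 p m : (0 < p)%R -> blocksum p x 1 m = blocksum p x 0 m.
Proof.
move=> p0; rewrite /blocksum; case: m => [|m]; first by rewrite !big_geq.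
by rewrite [RHS]big_ltn// x00 powR0 ?gt_eqF// mulr0 add0r.
Qed.

Lemma RLnorm_ub p sigma k u : (0 < p)%R -> (0 <= sigma)%R ->
  cell (@didx R) k u ->
  RLnorm p sigma u <= (wconst p sigma)%:E * supR p sigma k.+1.
Proof.
move=> p0 s0 ku; have /cellP/andP[_ ku2] := ku.
apply: Linf_ub => [|t /andP[t0 tu]].
  by rewrite mule_ge0 ?supR_ge0// lee_fin ltW ?wconst_gt0.
have [|m mt] := @didx_cell R t.
  by rewrite t0 (le_trans (ltW tu))// (le_trans ku2)// expRNn_le1.
rewrite gee0_abs ?ellLp_ge0//; apply: (le_trans (Lpitv_cell_ub _ _ mt ku2)) => //.
by rewrite lee_pmul2l ?lte_fin ?wconst_gt0// wsum_supR.
Qed.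

Lemma RLnorm_lb p sigma k u : (0 < p)%R -> (0 <= sigma)%R ->
  cell (@didx R) k u ->
  supR p sigma k.+1 <= (wconst p sigma)%:E * RLnorm p sigma u.
Proof.
move=> p0 s0 ku; have /cellP/andP[ku1 _] := ku.
apply: ge_ereal_sup => _ [m _ <-].
have [mk|km] := leqP m k.+1.
  by rewrite wsum_ge// mule_ge0 ?Lnorm_ge0// lee_fin ltW ?wconst_gt0.
rewrite -lee_pdivrMl ?wconst_gt0//; apply: (@Linf_lb _ _ _ _ _ m) => t mt.
have /cellP/andP[_ mt2] := mt; split.
  rewrite (cell_gt0 mt)/= (le_lt_trans mt2)// (le_lt_trans _ ku1)//.
  by rewrite ler_expR lerN2 ler_nat ltnW.
rewrite gee0_abs ?ellLp_ge0// lee_pdivrMl ?wconst_gt0//.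
exact: Lpitv_cell_lb.
Qed.

Lemma Lpitv_cell1_ub p sigma t k : (0 < p)%R -> (0 <= sigma)%R ->
  cell (@didx R) k t ->
  (ell (- sigma) t)%:E * Lpitv p t 1 <= (wconst p sigma)%:E * supL p sigma k.+2.
Proof.
move=> p0 s0 kt; apply: (le_trans (@Lpitv_cell_ub p sigma t 1%R 0%N k p0 s0 kt _)).
  by rewrite oppr0 expR0.
rewrite lee_pmul2l ?lte_fin ?wconst_gt0// /wsum blocksum1//.
exact: wsum_supL.
Qed.

Lemma le_supL p sigma k m : (k <= m)%N -> supL p sigma k <= supL p sigma m.
Proof.
move=> km; apply: le_ereal_sup => _ [i /= ik <-]; exists i => //=.
exact: leq_trans km.
Qed.

Lemma RRnorm_ub p sigma k u : (0 < p)%R -> (0 <= sigma)%R ->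
  cell (@didx R) k u ->
  RRnorm p sigma u <= (wconst p sigma)%:E * supL p sigma k.+2.
Proof.
move=> p0 s0 ku; have /cellP/andP[ku1 _] := ku.
apply: Linf_ub => [|t /andP[ut t1]].
  by rewrite mule_ge0 ?supL_ge0// lee_fin ltW ?wconst_gt0.
have [|m mt] := @didx_cell R t.
  by rewrite (ltW t1) (lt_trans (cell_gt0 ku)).
have /cellP/andP[_ mt2] := mt.
rewrite gee0_abs ?ellLp_ge0//; apply: (le_trans (Lpitv_cell1_ub _ _ mt)) => //.
rewrite lee_pmul2l ?lte_fin ?wconst_gt0// le_supL// ltnS ltnS.
have : (expR (- k.+1%:R) < expR (- m%:R) :> R)%R.
  by apply: lt_trans ku1 _; exact: lt_le_trans mt2.
by rewrite ltr_expR ltrN2 ltr_nat.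
Qed.

Lemma RRnorm_lb p sigma k u : (0 < p)%R -> (0 <= sigma)%R ->
  cell (@didx R) k.+1 u ->
  supL p sigma k <= (wconst p sigma)%:E * RRnorm p sigma u.
Proof.
move=> p0 s0 ku; have /cellP/andP[_ ku2] := ku.
apply: ge_ereal_sup => _ [m /= mk <-].
(* The index 0 is set apart because its cell contains t = 1, outside ]u, 1[; its block is empty. *)
case: m mk => [_|m mk].
  by rewrite wsum_ge// mule_ge0 ?Lnorm_ge0// lee_fin ltW ?wconst_gt0.
rewrite -lee_pdivrMl ?wconst_gt0//; apply: (@Linf_lb _ _ _ _ _ m.+1) => t mt.
have /cellP/andP[mt1 _] := mt; split.
  rewrite (cellS_lt1 mt) andbT (le_lt_trans _ mt1)// (le_trans ku2)//.
  by rewrite ler_expR lerN2 ler_nat.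
rewrite gee0_abs ?ellLp_ge0// lee_pdivrMl ?wconst_gt0// /wsum -blocksum1//.
by apply: Lpitv_cell_lb => //; exact: expRNn_lt1.
Qed.

End inner_norms.

(** * Comparison of sequences, slow variation and Hardy inequalities *)

Section geometric_sums.
Local Open Scope classical_set_scope.
Local Open Scope ring_scope.
Context (R : realType).
Implicit Types (delta : R).

Definition geosum delta : R := (1 - expR (- delta))^-1.

Lemma geosum_gt0 delta : 0 < delta -> 0 < geosum delta.
Proof. by move=> d0; rewrite invr_gt0 subr_gt0 -[ltRHS]expR0 ltr_expR oppr_lt0. Qed.

Lemma ler_geosum delta n : 0 < delta ->
  \sum_(0 <= i < n) expR (- (delta * i%:R)) <= geosum delta.
Proof.
move=> d0; rewrite -[leRHS]mul1r ler_pdivlMr; last by rewrite -invr_gt0 geosum_gt0.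
suff -> : (\sum_(0 <= i < n) expR (- (delta * i%:R))) * (1 - expR (- delta)) =
    1 - expR (- (delta * n%:R)) by rewrite gerBl expR_ge0.
elim: n => [|n IH]; first by rewrite big_geq// mul0r mulr0 oppr0 expR0 subrr.
rewrite big_nat_recr//= mulrDl IH.
have -> : expR (- (delta * n.+1%:R)) = expR (- (delta * n%:R)) * expR (- delta).
  by rewrite -expRD -natr1; congr expR; ring.
ring.
Qed.

Lemma sum_expR_le delta k m : 0 < delta ->
  \sum_(k <= j < m) expR (- (delta * (j%:R - k%:R))) <= geosum delta.
Proof.
move=> d0; rewrite -[k in \sum_(k <= _ < _) _]add0n big_addn.
under eq_bigr do rewrite natrD addrK.
exact: ler_geosum.
Qed.

Lemma sum_expR_rev_le delta k m : 0 < delta -> (m <= k.+1)%N ->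
  \sum_(0 <= j < m) expR (- (delta * (k%:R - j%:R))) <= geosum delta.
Proof.
move=> d0 mk; apply: (@le_trans _ _ (\sum_(0 <= j < k.+1) expR (- (delta * (k%:R - j%:R))))).
  rewrite (big_nat_widen 0 m k.+1)//= big_mkcond/=.
  by apply: ler_sum => j _; case: ifP; rewrite ?expR_ge0.
rewrite big_nat_rev/= add0n.
rewrite (eq_big_nat _ _ (F2 := fun i => expR (- (delta * i%:R)))); first exact: ler_geosum.
by move=> i /andP[_ ik]; rewrite subSS natrB// opprB addrCA subrr addr0.
Qed.

End geometric_sums.

(** * Finite-to-one reindexing and Hardy inequalities *)

Section sequence_comparison.
Local Open Scope classical_set_scope.
Local Open Scope ring_scope.
Local Open Scope ereal_scope.
Context (R : realType) (E : ri_space (halfline R)).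
Implicit Types (a : nat -> \bar R).

(** Indices with the same image differ by less than N, so [phi] is injective on each residue class
    modulo N. Cutting a along these N classes reduces the claim to [eseq_inj]. *)
Lemma eseq_finite_to_one (N : nat) (C : R) a a' (phi : nat -> nat) :
  (0 <= C)%R -> (0 < N)%N -> nnseq a -> nnseq a' ->
  (forall i j, (i < j)%N -> phi i = phi j -> (j - i < N)%N) ->
  (forall k, a k <= C%:E * a' (phi k)) ->
  eseq E a <= (N%:R * C)%:E * eseq E a'.
Proof.
move=> C0 N0 a0 a'0 iphi aa'.
pose A i k := if (k %% N == i)%N then a k else 0.
have A0 i : nnseq (A i) by move=> k; rewrite /A; case: ifP.
have -> : a = (fun k => \sum_(0 <= i < N) A i k).
  apply/funext => k; rewrite (bigD1_seq (k %% N)%N)/= ?iota_uniq//; last first.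
    by rewrite mem_index_iota/= ltn_mod.
  by rewrite /A eqxx big1 ?adde0// => i; rewrite eq_sym => /negPf ->.
apply: le_trans (eseq_sum E _ _) _ => //.
have Ca0 : nnseq (fun k => C%:E * a' k) by move=> k; rewrite mule_ge0.
apply: (@le_trans _ _ (\sum_(0 <= i < N) (C%:E * eseq E a'))).
  apply: lee_sum => i _; rewrite -(eseqZ E C0 a'0).
  apply: (@eseq_inj _ _ _ _ [set k | (k %% N)%N = i] phi) => //; last 2 first.
  - by move=> k /= ki; rewrite /A ki eqxx.
  - by move=> k /= /eqP/negPf ki; rewrite /A ki.
  move=> k l; rewrite !inE/= => ki li kl.
  have key u v : (u < v)%N -> phi u = phi v -> (u %% N = v %% N)%N -> False.
    move=> uv puv muv; have vN := iphi _ _ uv puv.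
    have : (v - u == 0 %[mod N])%N by rewrite -(eqn_modDr u) subnK ?(ltnW uv)// add0n muv.
    by rewrite mod0n modn_small// subn_eq0 leqNgt uv.
  by case: (ltngtP k l) => // [/key|/key] h; exfalso; apply: h; rewrite ?ki ?li.
have Ea0 := eseq_ge0 E a'.
rewrite le_eqVlt; apply/orP; left; apply/eqP.
rewrite EFinM -muleA; elim: (N) => [|n IH]; first by rewrite big_geq// mul0e.
rewrite big_nat_recr//= IH -natr1 EFinD ge0_muleDl ?lee_fin//; first by rewrite mul1e.
Qed.

(** Common core of the two Hardy inequalities: a is dominated by a geometric series of sequences
    none of which exceeds a' in norm. For shifts of a' this last condition is [eseq_inj], so no
    further property of E enters. *)
Lemma eseq_geometric (delta C : R) a a' (T : nat -> nat -> \bar R) :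
  (0 < delta)%R -> (0 <= C)%R -> nnseq a ->
  (forall i, nnseq (T i)) -> (forall i, eseq E (T i) <= eseq E a') ->
  (forall k, a k <= \sum_(i <oo) (C * expR (- (delta * i%:R)))%:E * T i k) ->
  eseq E a <= (C * geosum delta)%:E * eseq E a'.
Proof.
move=> d0 C0 a0 T0 Ta' aT; apply: le_trans (le_eseq E a0 aT) _.
have c0 i : (0 <= C * expR (- (delta * i%:R)))%R by rewrite mulr_ge0 ?expR_ge0.
apply: le_trans (eseq_series E _) _.
  by move=> i k; rewrite mule_ge0 ?lee_fin//; exact: T0.
apply: lime_le.
  apply: is_cvg_nneseries => i _ _; exact: eseq_ge0.
apply: nearW => n.
apply: (@le_trans _ _ (\sum_(0 <= i < n) ((C * expR (- (delta * i%:R)))%:E * eseq E a'))).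
  by apply: lee_sum => i _; rewrite (eseqZ E (c0 i) (T0 i)) lee_wpmul2l ?lee_fin.
rewrite -ge0_sume_distrl; last by move=> i _; rewrite lee_fin.
rewrite lee_wpmul2r ?eseq_ge0// sumEFin lee_fin -mulr_sumr.
by rewrite ler_wpM2l// ler_geosum.
Qed.

Lemma eseq_hardy_up (delta C : R) a a' : (0 < delta)%R -> (0 <= C)%R ->
  nnseq a -> nnseq a' ->
  (forall k, a k <= \sum_(i <oo) (C * expR (- (delta * i%:R)))%:E * a' (k + i)%N) ->
  eseq E a <= (C * geosum delta)%:E * eseq E a'.
Proof.
move=> d0 C0 a0 a'0.
apply: (@eseq_geometric delta C a a' (fun i k => a' (k + i)%N) d0 C0 a0).
  by move=> i k; exact: a'0.
move=> i; apply: (@eseq_inj _ _ _ _ setT (addn^~ i)) => //; last by move=> k; case.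
by move=> k l _ _ /addIn.
Qed.

Lemma eseq_hardy_down (delta C : R) a a' : (0 < delta)%R -> (0 <= C)%R ->
  nnseq a -> nnseq a' ->
  (forall k, a k <= \sum_(0 <= j < k.+1)
     (C * expR (- (delta * (k%:R - j%:R))))%:E * a' j) ->
  eseq E a <= (C * geosum delta)%:E * eseq E a'.
Proof.
move=> d0 C0 a0 a'0 aa'.
(* The shift to the right by i, with zeros inserted at the first i places. *)
pose T i k := if (i <= k)%N then a' (k - i)%N else 0.
have T0 i : nnseq (T i) by move=> k; rewrite /T; case: ifP.
apply: (@eseq_geometric delta C a a' T d0 C0 a0 T0) => [i|k].
  apply: (@eseq_inj _ _ _ _ [set k | (i <= k)%N] (subn^~ i)) => //.
  - move=> k l; rewrite !inE/= => ik il kl.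
    by rewrite -(subnK ik) kl subnK.
  - by move=> k /= ik; rewrite /T ik.
  - by move=> k /= /negP/negPf ik; rewrite /T ik.
have c0 i : 0 <= (C * expR (- (delta * i%:R)))%:E * T i k.
  by rewrite mule_ge0 ?T0// lee_fin mulr_ge0 ?expR_ge0.
apply: le_trans (aa' k) _.
apply: le_trans (nneseries_lim_ge k.+1 _) => //.
rewrite big_nat_rev/= add0n le_eqVlt; apply/orP; left; apply/eqP.
apply: eq_big_nat => i /andP[_ ik]; rewrite ltnS in ik.
by rewrite /T ik subSS natrB// opprB [(_ + (_ - _))%R]addrCA subrr addr0.
Qed.

End sequence_comparison.

(** * The exponent of rho on the logarithmic scale *)

Section logarithmic_rate.
Local Open Scope classical_set_scope.
Local Open Scope ring_scope.
Context (R : realType) (a gam : R).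
Hypothesis a0 : 0 < a.

Lemma expR_powR (x y : R) : expR x `^ y = expR (y * x).
Proof. by rewrite /powR gt_eqF ?expR_gt0// expRK. Qed.

Lemma ln1D_le (e : R) : 0 < e ->
  exists2 C : R, 0 <= C & forall x, 0 <= x -> ln (1 + x) <= e * x + C.
Proof.
(* Apply ln(1 + y) <= y to y = e (1 + x) - 1, which gives ln(1 + x) <= e x + (e - 1 - ln e). *)
move=> e0; exists `|e - 1 - ln e| => // x x0.
have x1 : 0 < 1 + x by lra.
have e1 : -1 < e * (1 + x) - 1 by have := mulr_gt0 e0 x1; lra.
have := le_ln1Dx e1; rewrite addrC subrK lnM ?posrE// => h.
by have := ler_norm (e - 1 - ln e); lra.
Qed.

(** Because (1 + x)(1 + (y - x)) exceeds 1 + y by x (y - x). *)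
Lemma ln1D_sub (x y : R) : 0 <= x -> x <= y ->
  0 <= ln (1 + y) - ln (1 + x) <= ln (1 + (y - x)).
Proof.
move=> x0 xy; have x1 : 0 < 1 + x by lra.
have y1 : 0 < 1 + y by lra.
have d1 : 0 < 1 + (y - x) by lra.
apply/andP; split; first by rewrite subr_ge0 ler_ln ?posrE//; lra.
rewrite lerBlDr -lnM ?posrE// ler_ln ?posrE ?mulr_gt0//.
by have := mulr_ge0 x0 (_ : 0 <= y - x); rewrite subr_ge0 => /(_ xy); lra.
Qed.

(** This is -ln rho(e^-x), see [expR_lrate]. If gam > a it is decreasing and negative near 0+, which
    is where rho exceeds 1. *)
Definition lrate (x : R) : R := a * x - gam * ln (1 + x).

Lemma lrate0 : lrate 0 = 0.
Proof. by rewrite /lrate mulr0 addr0 ln1 mulr0 subr0. Qed.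

(** The logarithm is absorbed by half of the linear growth and a constant; this replaces the missing
    monotonicity. *)
Lemma lrate_growth : exists2 C : R, 0 <= C & forall x y, 0 <= x -> x <= y ->
  a / 2 * (y - x) - C <= lrate y - lrate x.
Proof.
(* The slope is such that its product with |gam| is at most a / 2. *)
have e0 : 0 < a / 2 / (`|gam| + 1) by rewrite !divr_gt0// ltr_wpDl.
have [C C0 lnC] := ln1D_le e0.
exists (`|gam| * C) => [|x y x0 xy]; first by rewrite mulr_ge0.
have /andP[l0 l1] := ln1D_sub x0 xy.
have yx : 0 <= y - x by rewrite subr_ge0.
have l2 := le_trans l1 (lnC _ yx).
have : gam * (ln (1 + y) - ln (1 + x)) <= `|gam| * (a / 2 / (`|gam| + 1) * (y - x) + C).
  apply: (@le_trans _ _ (`|gam| * (ln (1 + y) - ln (1 + x)))).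
    by rewrite ler_wpM2r// ler_norm.
  by rewrite ler_wpM2l.
have : `|gam| * (a / 2 / (`|gam| + 1) * (y - x)) <= a / 2 * (y - x).
  rewrite mulrA ler_wpM2r// mulrCA ger_pMr ?divr_gt0//.
  by rewrite ler_pdivrMr ?mul1r ?ltr_wpDl// lerDl.
rewrite /lrate; lra.
Qed.

Lemma lrate_lip x y : 0 <= x -> x <= y ->
  `|lrate y - lrate x| <= (a + `|gam|) * (y - x).
Proof.
move=> x0 xy; have /andP[l0 l1] := ln1D_sub x0 xy.
have yx : 0 <= y - x by rewrite subr_ge0.
have l2 : ln (1 + (y - x)) <= y - x by apply: le_ln1Dx; lra.
rewrite (_ : lrate y - lrate x = a * (y - x) - gam * (ln (1 + y) - ln (1 + x))); last first.
  by rewrite /lrate; ring.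
apply: (le_trans (ler_normB _ _)); rewrite mulrDl lerD//.
  by rewrite normrM (gtr0_norm a0) ger0_norm.
by rewrite normrM (ger0_norm l0) ler_wpM2l// (le_trans l1).
Qed.

Definition srate (k : nat) : R := lrate k%:R.

Lemma srate0 : srate 0 = 0. Proof. exact: lrate0. Qed.

Lemma srate_growth : exists2 C : R, 0 <= C & forall i j, (i <= j)%N ->
  a / 2 * (j%:R - i%:R) - C <= srate j - srate i.
Proof.
have [C C0 h] := lrate_growth; exists C => // i j ij.
by apply: h; rewrite ?ler_nat.
Qed.

Lemma srate_lip i j : (i <= j)%N ->
  `|srate j - srate i| <= (a + `|gam|) * (j%:R - i%:R).
Proof. by move=> ij; apply: lrate_lip; rewrite ?ler_nat. Qed.

Lemma near_srate : exists2 M : R, 0 <= M &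
  exists phi : nat -> nat, forall k, `|srate k - (phi k)%:R| <= M.
Proof.
have [C C0 h] := srate_growth; exists (1 + C); first by lra.
exists (fun k => Num.truncn (srate k)) => k.
have [s0|s0] := leP 0 (srate k).
  have /andP[t1 t2] := truncn_itv s0.
  by rewrite ler_norml; move: t2; rewrite -natr1 => t2; apply/andP; split; lra.
(* Truncation sends negative values to 0, and growth from index 0 keeps [srate k] above -C. *)
have -> : Num.truncn (srate k) = 0%N.
  by rewrite truncn_floor ifF//; apply/negbTE; rewrite -ltNge.
have := h 0%N k isT; rewrite srate0 !subr0 ltr0_norm// => hk.
by have := mulr_ge0 (ltW a0) (ler0n R k); lra.
Qed.

(** [srate] tends to infinity with increments at most a + |gam|, so the first index where it reaches
    m overshoots m by at most one increment. *)
Lemma srate_near : exists2 M : R, 0 <= M &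
  exists phi : nat -> nat, forall m, `|m%:R - srate (phi m)| <= M.
Proof.
have [C C0 h] := srate_growth; exists (a + `|gam|); first by rewrite addr_ge0 // ltW.
have ex m : exists k, m%:R <= srate k.
  have q0 : 0 <= (m%:R + C) / (a / 2) by rewrite divr_ge0// ?addr_ge0// divr_ge0// ltW.
  exists (Num.truncn ((m%:R + C) / (a / 2))).+1.
  have := h 0%N (Num.truncn ((m%:R + C) / (a / 2))).+1 isT; rewrite srate0 !subr0.
  have := truncnS_gt ((m%:R + C) / (a / 2)).
  by rewrite ltr_pdivrMr ?divr_gt0//; lra.
exists (fun m => ex_minn (ex m)) => m; case: ex_minnP => -[|k] mk kmin.
  rewrite srate0 in mk *; have -> : m%:R = 0 :> R by apply/eqP; rewrite eq_le mk ler0n.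
  by rewrite subr0 normr0 addr_ge0// ltW.
have km : srate k < m%:R.
  by rewrite ltNge; apply/negP => /kmin; rewrite ltnn.
have e : k.+1%:R - k%:R = 1 :> R by rewrite -natr1; ring.
have := srate_lip (leqnSn k); rewrite e mulr1 => lip.
by rewrite ler0_norm ?subr_le0//; move: lip; rewrite ler_norml; lra.
Qed.

Lemma expR_lrate u : 0 < u -> u <= 1 -> u `^ a * ell gam u = expR (- lrate (- ln u)).
Proof.
move=> u0 u1; have l0 : 0 <= - ln u by rewrite oppr_ge0 ln_le0.
rewrite /ell -[in `|ln u|](opprK (ln u)) normrN ger0_norm// -{1}(lnK u0).
have e1 : 0 < 1 - ln u by rewrite ltr_wpDr.
rewrite expR_powR -[in X in _ * X](lnK e1) expR_powR -expRD /lrate.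
by congr expR; ring.
Qed.

Lemma lrate_cell k u : cell (@didx R) k u ->
  `|lrate (- ln u) - srate k| <= a + `|gam|.
Proof.
move=> ku; have u0 := cell_gt0 ku; have /cellP/andP[ku1 ku2] := ku.
have l1 : k%:R <= - ln u by rewrite lerNr -ler_expR lnK ?posrE.
have l2 : - ln u <= k%:R + 1.
  by rewrite natr1 lerNl -ler_expR lnK ?posrE// ltW.
apply: le_trans (lrate_lip (ler0n R k) l1) _.
by rewrite ger_pMr ?ltr_wpDr//; lra.
Qed.

End logarithmic_rate.

(** * Change of variables for tempered functions *)

Section tempered.
Local Open Scope classical_set_scope.
Local Open Scope ring_scope.
Local Open Scope ereal_scope.
Context (R : realType) (E : ri_space (halfline R)).

(** On the logarithmic scale: ln H is Lipschitz with constant c, up to the additive error ln C.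
    Hence H takes comparable values at points within a bounded distance. *)
Definition tempered (c C : R) (H : R -> \bar R) := forall r s,
  H r <= (C * expR (c * `|r - s|))%:E * H s.

(** K is chosen before H: later H depends on f, and the equivalence of norms must be uniform in
    f. *)
Lemma eseq_tempered_le (delta C0 M c C : R) (s1 s2 : nat -> R) (phi : nat -> nat) :
  (0 < delta)%R -> (0 <= C0)%R -> (0 <= M)%R -> (0 <= c)%R -> (0 < C)%R ->
  (forall i j, (i <= j)%N -> delta * (j%:R - i%:R) - C0 <= s1 j - s1 i)%R ->
  (forall k, `|s1 k - s2 (phi k)| <= M)%R ->
  exists2 K : R, (0 < K)%R & forall H : R -> \bar R,
    (forall r, 0 <= H r) -> tempered c C H ->
    eseq E (H \o s1) <= K%:E * eseq E (H \o s2).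
Proof.
move=> d0 C00 M0 c0 C_gt0 grow near_.
(* If [phi i = phi j], then [s1 i] and [s1 j] are within 2 M of each other, so the growth of [s1]
   forces j - i <= q. *)
pose q := ((2 * M + C0) / delta)%R; pose N := (Num.truncn q).+1.
exists (N%:R * (C * expR (c * M)))%R; first by rewrite !mulr_gt0 ?expR_gt0 ?ltr0n.
move=> H H0 tH; apply: (@eseq_finite_to_one _ _ N _ _ _ phi) => //.
- by rewrite mulr_ge0 ?expR_ge0 ?ltW.
- by move=> k; exact: H0.
- by move=> k; exact: H0.
- move=> i j ij pij; rewrite -(ltr_nat R) natrB ?(ltnW ij)//.
  apply: le_lt_trans (truncnS_gt q); rewrite ler_pdivlMr// mulrC.
  have := grow _ _ (ltnW ij); have := near_ i; have := near_ j; rewrite pij.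
  by rewrite !ler_norml => /andP[? ?] /andP[? ?]; lra.
- move=> k; apply: le_trans (tH _ (s2 (phi k))) _; rewrite lee_wpmul2r// lee_fin.
  by rewrite ler_pM2l// ler_expR ler_wpM2l.
Qed.

(** The change of variables t = rho(u): each of the grids [m%:R] and [srate] lies within bounded
    distance of the other, and each grows linearly, so the preceding comparison applies in both
    directions. *)
Lemma eseq_srate (a gam c C : R) : (0 < a)%R -> (0 <= c)%R -> (0 < C)%R ->
  exists2 K : R, (0 < K)%R & forall H : R -> \bar R,
    (forall r, 0 <= H r) -> tempered c C H ->
    eseq E (fun m => H m%:R) <= K%:E * eseq E (H \o srate a gam) /\
    eseq E (H \o srate a gam) <= K%:E * eseq E (fun m => H m%:R).
Proof.
move=> a0 c0 C0.
have [M1 M10 [phi1 near1]] := near_srate gam a0.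
have [M2 M20 [phi2 near2]] := srate_near gam a0.
have [D D0 grow] := srate_growth gam a0.
have grow1 i j : (i <= j)%N -> (1 * (j%:R - i%:R) - 0 <= j%:R - i%:R :> R)%R.
  by rewrite mul1r subr0.
have [K1 K10 h1] := eseq_tempered_le ltr01 (lexx 0%R) M20 c0 C0 grow1 near2.
have a20 : (0 < a / 2)%R by rewrite divr_gt0.
have [K2 K20 h2] := eseq_tempered_le a20 D0 M10 c0 C0 grow near1.
exists (K1 + K2)%R => [|H H0 tH]; first by rewrite addr_gt0.
split; [apply: le_trans (h1 _ H0 tH) _|apply: le_trans (h2 _ H0 tH) _].
  by rewrite lee_wpmul2r ?eseq_ge0// lee_fin lerDl ltW.
by rewrite lee_wpmul2r ?eseq_ge0// lee_fin lerDr ltW.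
Qed.

End tempered.

(** * Slowly varying weights on the logarithmic scale *)

Section slowly_varying.
Local Open Scope classical_set_scope.
Local Open Scope ring_scope.
Context (R : realType) (b : R -> R).
Hypothesis hb : SV01 b.

(** With t = e^-x, slow variation says that b is tempered with arbitrarily small rate: the
    nondecreasing half of [SV01] gives the case y <= x, the nonincreasing half the case x < y. *)
Lemma SV01_log (e : R) : 0 < e -> exists2 C : R, 0 < C &
  forall x y, 0 < x -> 0 < y ->
  b (expR (- x)) <= C * expR (e * `|x - y|) * b (expR (- y)).
Proof.
move=> e0; have [_ _ /(_ _ e0)[[g gm [c1 [C1 [c10 C10 h1]]]] [h hm [c2 [C2 [c20 C20 h2]]]]]] := hb.
have e01 (z : R) : 0 < z -> 0 < expR (- z) < 1.
  by move=> z0; rewrite expR_gt0 -[ltRHS]expR0 ltr_expR oppr_lt0.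
exists (C1 / c1 + C2 / c2); first by rewrite addr_gt0 ?divr_gt0.
move=> x y x0 y0; have [bx by_] : 0 <= b (expR (- x)) /\ 0 <= b (expR (- y)).
  by have [_ + _] := hb => bp; split; apply/ltW/bp/e01.
have c1' : 0 <= C1 / c1 by rewrite divr_ge0 ?ltW.
have c2' : 0 <= C2 / c2 by rewrite divr_ge0 ?ltW.
have [xy|yx] := leP y x.
  have := gm (expR (- x)) (expR (- y)); rewrite !in_itv/= !e01// => /(_ isT isT).
  rewrite ler_expR lerN2 => /(_ xy) gxy.
  have /andP[g1 _] := h1 _ (e01 _ x0); have /andP[_ g2] := h1 _ (e01 _ y0).
  have := le_trans g1 (le_trans gxy g2); rewrite !expR_powR => k1.
  have k2 : b (expR (- x)) <= C1 / c1 * expR (e * (x - y)) * b (expR (- y)).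
    have := ler_wpM2l (mulr_ge0 (ltW (_ : 0 < c1^-1)) (expR_ge0 (e * x))) k1.
    rewrite invr_gt0 => /(_ c10).
    have -> : c1^-1 * expR (e * x) * (c1 * (expR (e * - x) * b (expR (- x)))) =
        (c1^-1 * c1) * (expR (e * x) * expR (e * - x)) * b (expR (- x)) by ring.
    rewrite -expRD mulrN subrr expR0 mulVf ?gt_eqF// !mul1r => /le_trans; apply.
    have -> : expR (e * (x - y)) = expR (e * x) * expR (e * - y).
      by rewrite -expRD; congr expR; ring.
    by rewrite le_eqVlt; apply/orP; left; apply/eqP; ring.
  apply: (le_trans k2); rewrite ger0_norm ?subr_ge0// ler_wpM2r// ler_wpM2r ?expR_ge0//.
  by rewrite lerDl.
have := hm (expR (- x)) (expR (- y)); rewrite !in_itv/= !e01// => /(_ isT isT).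
rewrite ler_expR lerN2 => /(_ (ltW yx)) hxy.
have /andP[g1 _] := h2 _ (e01 _ x0); have /andP[_ g2] := h2 _ (e01 _ y0).
have := le_trans g1 (le_trans hxy g2); rewrite !expR_powR => k1.
have k2 : b (expR (- x)) <= C2 / c2 * expR (e * (y - x)) * b (expR (- y)).
  have := ler_wpM2l (mulr_ge0 (ltW (_ : 0 < c2^-1)) (expR_ge0 (- (e * x)))) k1.
  rewrite invr_gt0 => /(_ c20).
  have -> : c2^-1 * expR (- (e * x)) * (c2 * (expR (- e * - x) * b (expR (- x)))) =
      (c2^-1 * c2) * (expR (- (e * x)) * expR (- e * - x)) * b (expR (- x)) by ring.
  rewrite -expRD mulrNN addNr expR0 mulVf ?gt_eqF// !mul1r => /le_trans; apply.
  have -> : expR (e * (y - x)) = expR (- (e * x)) * expR (- e * - y).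
    by rewrite -expRD; congr expR; ring.
  by rewrite le_eqVlt; apply/orP; left; apply/eqP; ring.
apply: (le_trans k2); rewrite distrC ger0_norm ?subr_ge0 ?(ltW yx)//.
by rewrite ler_wpM2r// ler_wpM2r ?expR_ge0// lerDr.
Qed.

(* [b] at [expR (- r)], frozen for [r <= 1/2]: [SV01] says nothing about [b 1]. *)
Definition svlog (r : R) : R := b (expR (- Num.max r 2^-1)).

Lemma max_half_gt0 (r : R) : 0 < Num.max r 2^-1.
Proof. by rewrite lt_max invr_gt0 ltr0n orbT. Qed.

Lemma svlog_gt0 r : 0 < svlog r.
Proof.
have [_ bp _] := hb; apply: bp.
by rewrite expR_gt0 -[ltRHS]expR0 ltr_expR oppr_lt0 max_half_gt0.
Qed.

Lemma svlog_tempered (e : R) : 0 < e -> exists2 C : R, 0 < C &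
  forall r s, svlog r <= C * expR (e * `|r - s|) * svlog s.
Proof.
move=> e0; have [C C0 h] := SV01_log e0; exists C => // r s.
apply: le_trans (h _ _ (max_half_gt0 r) (max_half_gt0 s)) _.
rewrite ler_wpM2r ?(ltW (svlog_gt0 _))// ler_pM2l// ler_expR ler_pM2l//.
rewrite ler_norml; have := ler_norm (r - s); have := ler_norm (s - r); rewrite distrC.
by rewrite /Num.max /Order.max; case: ifPn; case: ifPn; rewrite -?leNgt; lra.
Qed.

Lemma svlog_cell : exists2 K : R, 0 < K & forall k t, cell (@didx R) k t -> t < 1 ->
  b t <= K * svlog k%:R /\ svlog k%:R <= K * b t.
Proof.
have [C C0 h] := SV01_log ltr01; exists (C * expR 1); first by rewrite mulr_gt0 ?expR_gt0.
move=> k t kt t1; have t0 := cell_gt0 kt; have /cellP/andP[kt1 kt2] := kt.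
have [_ bp _] := hb.
have l1 : k%:R <= - ln t by rewrite lerNr -ler_expR lnK ?posrE.
have l2 : - ln t <= k%:R + 1.
  by rewrite natr1 lerNl -ler_expR lnK ?posrE// ltW.
have l0 : 0 < - ln t by rewrite oppr_gt0 ln_lt0// t0.
have d : `|- ln t - Num.max k%:R 2^-1| <= 1.
  by rewrite ler_norml /Num.max /Order.max; have := ler0n R k; case: ifPn; rewrite -?leNgt; lra.
have bt : b t = b (expR (- - ln t)) by rewrite opprK lnK.
split; rewrite bt.
  apply: le_trans (h _ _ l0 (max_half_gt0 k%:R)) _.
  rewrite ler_wpM2r ?(ltW (svlog_gt0 _))// ler_pM2l// ler_expR mul1r//.
apply: le_trans (h _ _ (max_half_gt0 k%:R) l0) _.
by rewrite ler_wpM2r -?bt ?(ltW (bp _ _)) ?t0// ler_pM2l// ler_expR mul1r// distrC.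
Qed.

Lemma svlog_extend1 (a gam : R) : 0 < a -> exists2 K : R, 0 < K &
  forall k t, cell (@didx R) k t ->
  extend1 b (expR (- lrate a gam (- ln t))) <= K * svlog (srate a gam k) /\
  svlog (srate a gam k) <= K * extend1 b (expR (- lrate a gam (- ln t))).
Proof.
move=> a0; have [C C0 h] := SV01_log ltr01.
have [C' C'0 h'] := svlog_tempered ltr01.
set L := a + `|gam|; have L0 : 0 < L by rewrite ltr_wpDr.
have [D D0 hD] : exists2 D : R, 0 < D & forall r,
    extend1 b (expR (- r)) <= D * svlog r /\ svlog r <= D * extend1 b (expR (- r)).
  have b0 := svlog_gt0 0.
  have Ce0 : 0 < C * expR 1 by rewrite mulr_gt0 ?expR_gt0.
  have b0V : 0 < (svlog 0)^-1 by rewrite invr_gt0.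
  (* The first summand serves r > 0, where max(r, 1/2) is within 1 of r. The others serve r <= 0,
     where the extension of b equals 1 and [svlog] is frozen at [svlog 0]. *)
  exists (C * expR 1 + svlog 0 + (svlog 0)^-1); first by rewrite !addr_gt0.
  move=> r; rewrite /extend1 -[X in (_ < X)%R]expR0 ltr_expR oppr_lt0.
  have [r0|r0] := ltP 0 r.
    have d : `|r - Num.max r 2^-1| <= 1.
      by rewrite ler_norml /Num.max /Order.max; case: ifPn; rewrite -?leNgt; lra.
    have br : 0 < b (expR (- r)).
      by have [_ bp _] := hb; apply: bp; rewrite expR_gt0 -[ltRHS]expR0 ltr_expR oppr_lt0.
    have CD : C * expR 1 <= C * expR 1 + svlog 0 + (svlog 0)^-1 by lra.
    split.
      apply: le_trans (h _ _ r0 (max_half_gt0 r)) _; rewrite -/(svlog r).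
      apply: (le_trans _ (ler_wpM2r (ltW (svlog_gt0 r)) CD)).
      by rewrite ler_wpM2r ?(ltW (svlog_gt0 _))// ler_pM2l// ler_expR mul1r.
    apply: le_trans (h _ _ (max_half_gt0 r) r0) _.
    apply: (le_trans _ (ler_wpM2r (ltW br) CD)).
    by rewrite ler_wpM2r ?(ltW br)// ler_pM2l// ler_expR mul1r distrC.
  have -> : svlog r = svlog 0.
    rewrite /svlog; congr (b (expR (- _))).
    by rewrite /Num.max /Order.max; case: ifPn; case: ifPn; rewrite -?leNgt; lra.
  split; last by rewrite mulr1; lra.
  rewrite 2!mulrDl mulVf ?gt_eqF// lerDr.
  by rewrite addr_ge0// mulr_ge0// ltW.
exists (D * (C' * expR L)); first by rewrite !mulr_gt0 ?expR_gt0.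
move=> k t kt; have dr := lrate_cell gam a0 kt.
have [e1 e2] := hD (lrate a gam (- ln t)); split.
  apply: (le_trans e1); rewrite -mulrA ler_pM2l//.
  apply: (le_trans (h' _ (srate a gam k))); rewrite ler_wpM2r ?(ltW (svlog_gt0 _))//.
  by rewrite ler_pM2l// ler_expR mul1r.
apply: (le_trans (h' _ (lrate a gam (- ln t)))).
apply: (@le_trans _ _ (C' * expR L * (svlog (lrate a gam (- ln t))))).
  rewrite ler_wpM2r ?(ltW (svlog_gt0 _))//.
  by rewrite ler_pM2l// ler_expR mul1r distrC.
by rewrite (mulrC D) -[leRHS]mulrA ler_pM2l// mulr_gt0 ?expR_gt0.
Qed.

(* The exponential factor beats the slow variation, at the price of half the
   growth of [srate]. *)
Lemma svlog_srate (a gam tau : R) : 0 < a -> 0 < tau ->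
  exists C delta : R, [/\ 0 < C, 0 < delta & forall i j, (i <= j)%N ->
    let q := C * expR (tau * (srate a gam j - srate a gam i)) *
             expR (- (delta * (j%:R - i%:R))) in
    svlog (srate a gam j) <= q * svlog (srate a gam i) /\
    svlog (srate a gam i) <= q * svlog (srate a gam j)].
Proof.
move=> a0 tau0; have [D D0 grow] := srate_growth gam a0.
set L := a + `|gam|; have L0 : 0 < L by rewrite ltr_wpDr.
(* By [srate_lip] this rate loses at most tau a / 4 per index, while [srate_growth] gains tau a / 2;
   the surplus is the decay rate. *)
have e0 : 0 < tau * a / 4 / L by rewrite !divr_gt0 ?mulr_gt0.
have [C C0 h] := svlog_tempered e0.
exists (C * expR (tau * D)), (tau * a / 4); split.
- by rewrite mulr_gt0 ?expR_gt0.
- by rewrite divr_gt0 ?mulr_gt0.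
move=> i j ij q.
have qC : C * expR (tau * a / 4 / L * `|srate a gam j - srate a gam i|) <= q.
  rewrite /q -!mulrA ler_pM2l// -!expRD ler_expR.
  have lip := srate_lip gam a0 ij.
  have := ler_wpM2l (ltW e0) lip.
  have eL : tau * a / 4 / L * L = tau * a / 4 by rewrite divfK ?gt_eqF.
  rewrite -/L [leRHS]mulrA eL => h1.
  have := ler_wpM2l (ltW tau0) (grow i j ij).
  by lra.
split.
  by apply: le_trans (h _ (srate a gam i)) _; rewrite ler_wpM2r ?(ltW (svlog_gt0 _)).
by apply: le_trans (h _ (srate a gam j)) _; rewrite ler_wpM2r ?(ltW (svlog_gt0 _))// distrC.
Qed.

End slowly_varying.

(** * The K-functional *)

Section power_inequalities.
Local Open Scope classical_set_scope.
Local Open Scope ring_scope.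
Context (R : realType).
Implicit Types (p q : R) (x y z : nat -> R).

(** A ratio in [0, 1] is at most its q-th power when q <= 1; apply this to u / (u + v) and v / (u +
    v) and add. *)
Lemma powR_subadd q (u v : R) : 0 < q -> q <= 1 -> 0 <= u -> 0 <= v ->
  (u + v) `^ q <= u `^ q + v `^ q.
Proof.
move=> q0 q1 u0 v0; have [s0|s0] := ltP 0 (u + v); last first.
  have -> : u + v = 0 by apply/eqP; rewrite eq_le s0 addr_ge0.
  by rewrite powR0 ?gt_eqF// addr_ge0 ?powR_ge0.
have key w : 0 <= w -> w <= u + v -> w / (u + v) * (u + v) `^ q <= w `^ q.
  move=> w0 wuv; have [->|wn0] := eqVneq w 0.
    by rewrite mul0r mul0r powR_ge0.
  have wp : 0 < w by rewrite lt_neqAle eq_sym wn0.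
  have -> : w `^ q = (w / (u + v)) `^ q * (u + v) `^ q.
    by rewrite -powRM ?divr_ge0 ?(ltW s0)// divfK ?gt_eqF.
  rewrite ler_wpM2r ?powR_ge0// ger1_powR// divr_gt0//=.
  by rewrite ler_pdivrMr// mul1r.
apply: le_trans (lerD (key u u0 _) (key v v0 _)); rewrite ?lerDl ?lerDr//.
by rewrite -mulrDl -mulrDl divff ?gt_eqF// mul1r.
Qed.

Lemma powR_sum_le q (F : nat -> R) k m : 0 < q -> q <= 1 -> (forall j, 0 <= F j) ->
  (\sum_(k <= j < m) F j) `^ q <= \sum_(k <= j < m) F j `^ q.
Proof.
move=> q0 q1 F0; rewrite /index_iota; move: (m - k)%N => n; elim: n k => [|n IH] k /=.
  by rewrite !big_nil powR0 ?gt_eqF.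
rewrite !big_cons; apply: le_trans (powR_subadd _ _ _ _) _ => //.
  by apply: sumr_ge0.
by rewrite lerD2l.
Qed.

(** The embedding of l^1 in l^p. It makes the inner norms linear in x, as Hardy's inequality
    requires. *)
Lemma blocksum_powV_le p x k m : 1 <= p -> (forall j, 0 <= x j) ->
  blocksum p x k m `^ p^-1 <= \sum_(k <= j < m) expR (- j%:R) `^ p^-1 * x j.
Proof.
move=> p1 x0; have p0 : 0 < p by apply: lt_le_trans p1.
apply: le_trans (powR_sum_le _ _ _ _ _) _; rewrite ?invr_gt0 ?invf_le1//.
  by move=> j; rewrite mulr_ge0 ?expR_ge0 ?powR_ge0.
apply: ler_sum => j _; rewrite powRM ?expR_ge0 ?powR_ge0//.
by rewrite -powRrM mulfV ?gt_eqF// powRr1.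
Qed.

Lemma blocksum1_powV p x k : 0 < p -> (forall j, 0 <= x j) ->
  blocksum p x k k.+1 `^ p^-1 = expR (- k%:R) `^ p^-1 * x k.
Proof.
move=> p0 x0; rewrite /blocksum big_nat1 powRM ?expR_ge0 ?powR_ge0//.
by rewrite -powRrM mulfV ?gt_eqF// powRr1.
Qed.

(** A crude substitute for Minkowski's inequality: y + z is at most twice the maximum, whose p-th
    power is at most y^p + z^p. *)
Lemma blocksum_powV_add p x y z k m : 1 <= p ->
  (forall j, 0 <= x j) -> (forall j, 0 <= y j) -> (forall j, 0 <= z j) ->
  (forall j, x j <= y j + z j) ->
  blocksum p x k m `^ p^-1 <=
  2 * (blocksum p y k m `^ p^-1 + blocksum p z k m `^ p^-1).
Proof.
move=> p1 x0 y0 z0 xyz; have p0 : 0 < p by apply: lt_le_trans p1.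
have h : blocksum p x k m <= 2 `^ p * (blocksum p y k m + blocksum p z k m).
  rewrite /blocksum -big_split/= mulr_sumr; apply: ler_sum => j _.
  rewrite -mulrDr mulrCA ler_wpM2l ?expR_ge0//.
  apply: (@le_trans _ _ ((2 * Num.max (y j) (z j)) `^ p)).
    apply: ge0_ler_powR; rewrite ?nnegrE ?mulr_ge0 ?le_max ?y0 ?(ltW p0)//.
    apply: (le_trans (xyz j)); rewrite /Num.max /Order.max.
    by case: ifPn; rewrite -?leNgt; lra.
  rewrite powRM ?le_max ?y0// ler_wpM2l ?powR_ge0//.
  by rewrite /Num.max /Order.max; case: ifP => _; rewrite ?lerDl ?lerDr powR_ge0.
apply: (@le_trans _ _ ((2 `^ p * (blocksum p y k m + blocksum p z k m)) `^ p^-1)).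
  by apply: ge0_ler_powR; rewrite ?nnegrE ?mulr_ge0 ?addr_ge0 ?blocksum_ge0 ?powR_ge0 ?invr_ge0 ?(ltW p0).
rewrite powRM ?powR_ge0 ?addr_ge0 ?blocksum_ge0// -powRrM mulfV ?gt_eqF// powRr1//.
by rewrite ler_wpM2l// powR_subadd ?blocksum_ge0 ?invr_gt0 ?invf_le1.
Qed.

Lemma blocksum_powV_shift p x k m : 1 <= p ->
  blocksum p (fun j => x j.+1) k m `^ p^-1 <= expR 1 * blocksum p x k.+1 m.+1 `^ p^-1.
Proof.
move=> p1; have p0 : 0 < p by apply: lt_le_trans p1.
rewrite blocksum_shift powRM ?expR_ge0 ?blocksum_ge0// ler_wpM2r ?powR_ge0//.
by rewrite expR_powR ler_expR mulr1 invf_le1.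
Qed.

End power_inequalities.

(** * Lower bound for an arbitrary decomposition, at the level of sequences *)

Section sequence_K_bounds.
Local Open Scope classical_set_scope.
Local Open Scope ring_scope.
Context (R : realType) (p0 p1 sig0 sig1 : R).
Hypotheses (p0_ge1 : 1 <= p0) (p01 : p0 < p1).
Hypotheses (sig0_ge0 : 0 <= sig0) (sig1_ge0 : 0 <= sig1).
Implicit Types (x y z : nat -> R).

Let p0_gt0 : 0 < p0. Proof. exact: lt_le_trans p0_ge1. Qed.
Let p1_ge1 : 1 <= p1. Proof. by rewrite (le_trans p0_ge1)// ltW. Qed.
Let p1_gt0 : 0 < p1. Proof. exact: lt_le_trans p1_ge1. Qed.

Definition Rsum p sig x k m : R := logweight sig m * blocksum p x k m `^ p^-1.

Let a : R := p0^-1 - p1^-1.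
Let gam : R := sig1 - sig0.

Lemma rate_gt0 : 0 < a.
Proof. by rewrite subr_gt0 ltf_pV2 ?posrE. Qed.

Local Notation s := (srate a gam).

(* The function rho of the theorem at [expR (- k)], see [expR_lrate]. *)
Definition rhoseq k : R := expR (- s k).

Definition term0 x j : R := logweight sig0 j * (expR (- j%:R) `^ p0^-1 * x j).

Lemma term0_ge0 x j : (forall j, 0 <= x j) -> 0 <= term0 x j.
Proof. by move=> x0; rewrite !mulr_ge0 ?powR_ge0. Qed.

Lemma logweightE sig k : logweight sig k = expR (- (sig * ln (1 + k%:R))) :> R.
Proof.
have k1 : 0 < 1 + k%:R :> R by rewrite ltr_wpDr.
by rewrite /logweight -{1}(lnK k1) expR_powR mulNr.
Qed.

(** This identity dictates rho: it is the quotient of the local weights of the two spaces. *)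
Lemma term0E x j :
  term0 x j = rhoseq j * (logweight sig1 j * (expR (- j%:R) `^ p1^-1 * x j)).
Proof.
rewrite /term0 !mulrA; congr (_ * _).
rewrite !logweightE !expR_powR /rhoseq -!expRD; congr expR.
rewrite /srate /lrate /a /gam; ring.
Qed.

Lemma Rsum_le_term p sig x k m : 1 <= p -> 0 <= sig -> (forall j, 0 <= x j) ->
  Rsum p sig x k m <=
  \sum_(k <= j < m) logweight sig j * (expR (- j%:R) `^ p^-1 * x j).
Proof.
move=> p1' s0 x0; rewrite /Rsum.
apply: (le_trans (ler_wpM2l (ltW (logweight_gt0 _ _)) (blocksum_powV_le _ _ p1' x0))).
rewrite mulr_sumr; apply: ler_sum_nat => j /andP[_ jm].
by rewrite ler_wpM2r ?mulr_ge0 ?powR_ge0// le_logweight// ltnW.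
Qed.

Lemma term_le_Rsum p sig x k j : 1 <= p -> 0 <= sig -> (forall j, 0 <= x j) ->
  (k <= j)%N ->
  logweight sig j * (expR (- j%:R) `^ p^-1 * x j) <= 2 `^ sig * Rsum p sig x k j.+1.
Proof.
move=> p1' s0 x0 kj; have p0' : 0 < p by exact: lt_le_trans p1'.
rewrite -blocksum1_powV// /Rsum mulrA.
apply: ler_pM; rewrite ?powR_ge0 ?logweightS//.
apply: ge0_ler_powR; rewrite ?nnegrE ?blocksum_ge0 ?invr_ge0 ?(ltW p0')//.
exact: le_blocksum.
Qed.

Lemma rhoseq_ratio : exists C delta : R, [/\ 0 < C, 0 < delta &
  forall i j, (i <= j)%N ->
  rhoseq j <= C * expR (- (delta * (j%:R - i%:R))) * rhoseq i].
Proof.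
have [D D0 grow] := srate_growth gam rate_gt0.
exists (expR D), (a / 2); split; rewrite ?expR_gt0 ?divr_gt0 ?rate_gt0// => i j ij.
by rewrite /rhoseq -!expRD ler_expR; have := grow i j ij; lra.
Qed.

Lemma mulDD_ge (u v A B : R) : 0 <= u -> 0 <= v -> 0 <= A -> 0 <= B ->
  u * A + v * B <= (u + v) * (A + B).
Proof.
move=> u0 v0 A0 B0; rewrite mulrDl !mulrDr addrACA lerD ?lerDl ?lerDr ?mulr_ge0//.
Qed.

(** y in the first space and z in the second are bounded directly by A0 and A1. The crossed
    contributions pass through local terms: [term0E] trades one space for the other, and the
    geometric behaviour of rho makes the sums over j > k of z and over j <= k of y converge. *)
Lemma sequence_K_lower : exists2 C : R, 0 < C & forall x y z A0 A1 k m,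
  (forall j, 0 <= x j) -> (forall j, 0 <= y j) -> (forall j, 0 <= z j) ->
  (forall j, x j <= y j.+1 + z j.+1) -> 0 <= A0 -> 0 <= A1 ->
  (forall m, Rsum p0 sig0 y 0 m <= A0) -> (forall m, Rsum p1 sig1 z 0 m <= A1) ->
  Rsum p0 sig0 x k.+1 m <= C * (A0 + rhoseq k * A1) /\
  ((m <= k.+1)%N -> rhoseq k * Rsum p1 sig1 x 0 m <= C * (A0 + rhoseq k * A1)).
Proof.
have [C [delta [C0 d0 ratio]]] := rhoseq_ratio.
have G0 := geosum_gt0 d0; set G := geosum delta in G0.
(* [c0] and [c1] pay for shifting y and z by one index; [d0'] and [d1] also for extracting a local
   term from a sum. *)
pose c0 : R := 2 `^ sig0 * expR 1; pose c1 : R := 2 `^ sig1 * expR 1.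
have c00 : 0 < c0 by rewrite mulr_gt0 ?powR_gt0 ?expR_gt0.
have c10 : 0 < c1 by rewrite mulr_gt0 ?powR_gt0 ?expR_gt0.
pose d0' : R := c0 * 2 `^ sig0; pose d1 : R := c1 * 2 `^ sig1.
have d00 : 0 < d0' by rewrite mulr_gt0 ?powR_gt0.
have d10 : 0 < d1 by rewrite mulr_gt0 ?powR_gt0.
have shift p sig x k m : 1 <= p -> 0 <= sig ->
    Rsum p sig (fun j => x j.+1) k m <= 2 `^ sig * expR 1 * Rsum p sig x 0 m.+1.
  move=> p1' s0; rewrite /Rsum.
  apply: (le_trans (ler_pM _ _ (logweightS _ s0) (blocksum_powV_shift _ _ _ p1'))); rewrite ?powR_ge0//.
  rewrite -!mulrA [expR 1 * (_ * _)]mulrCA !ler_pM2l ?powR_gt0 ?logweight_gt0 ?expR_gt0//.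
  apply: ge0_ler_powR; rewrite ?nnegrE ?blocksum_ge0 ?invr_ge0 ?(le_trans _ p1')//.
  exact: le_blocksum.
have termS p sig x A j : 1 <= p -> 0 <= sig -> (forall j, 0 <= x j) ->
    (forall m, Rsum p sig x 0 m <= A) ->
    logweight sig j * (expR (- j%:R) `^ p^-1 * x j.+1) <=
    2 `^ sig * expR 1 * 2 `^ sig * A.
  move=> p1' s0 x0 hA.
  have := @term_le_Rsum p sig (fun j => x j.+1) 0%N j p1' s0 (fun j => x0 j.+1) isT.
  move/le_trans; apply.
  rewrite (_ : _ * A = 2 `^ sig * (2 `^ sig * expR 1 * A)); last by ring.
  rewrite ler_wpM2l ?powR_ge0//.
  apply: (le_trans (shift _ _ _ _ _ p1' s0)); rewrite ler_wpM2l ?mulr_ge0 ?expR_ge0 ?powR_ge0//.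
exists (2 * (c0 + d1 * (C * G) + (d0' * (C * G) + c1))).
  by rewrite mulr_gt0// !addr_gt0// !mulr_gt0.
move=> x y z A0 A1 k m x0 y0 z0 xyz A00 A10 hy hz.
have r0 j : 0 < rhoseq j by exact: expR_gt0.
have cA : 0 <= rhoseq k * A1 by rewrite mulr_ge0// ltW.
have y'0 j : 0 <= y j.+1 by []. have z'0 j : 0 <= z j.+1 by [].
have CG0 : 0 < C * G by rewrite mulr_gt0.
have split_ p sig l : 1 <= p -> Rsum p sig x l m <=
    2 * (Rsum p sig (fun j => y j.+1) l m + Rsum p sig (fun j => z j.+1) l m).
  move=> p1'; rewrite /Rsum -mulrDr mulrCA ler_pM2l ?logweight_gt0//.
  exact: blocksum_powV_add.
split.
  apply: (le_trans (split_ _ _ _ p0_ge1)); rewrite -mulrA ler_pM2l//.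
  have h1 : Rsum p0 sig0 (fun j => y j.+1) k.+1 m <= c0 * A0.
    apply: (le_trans (shift _ _ _ _ _ p0_ge1 sig0_ge0)).
    by rewrite ler_pM2l.
  (* Crossed term: each local term of z is at most [d1 * A1], and for j > k the factor [rhoseq j]
     decays geometrically from [rhoseq k]. *)
  have h2 : Rsum p0 sig0 (fun j => z j.+1) k.+1 m <= d1 * (C * G) * (rhoseq k * A1).
    apply: (le_trans (Rsum_le_term _ _ p0_ge1 sig0_ge0 z'0)).
    apply: (@le_trans _ _ (\sum_(k.+1 <= j < m) (d1 * (C * (rhoseq k * A1))) * expR (- (delta * (j%:R - k%:R))))).
      apply: ler_sum_nat => j /andP[kj _].
      have := term0E (fun j => z j.+1) j; rewrite /term0 => ->.
      apply: (@le_trans _ _ ((C * expR (- (delta * (j%:R - k%:R))) * rhoseq k) * (d1 * A1))).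
        apply: ler_pM; rewrite ?(ltW (r0 _)) ?mulr_ge0 ?powR_ge0 ?ratio ?(ltnW kj)//.
        exact: termS.
      by rewrite le_eqVlt; apply/orP; left; apply/eqP; ring.
    rewrite -mulr_sumr.
    have -> : d1 * (C * G) * (rhoseq k * A1) = d1 * (C * (rhoseq k * A1)) * G by ring.
    rewrite ler_wpM2l ?mulr_ge0 ?(ltW d10) ?(ltW C0) ?(ltW (r0 k))//.
    apply: (le_trans _ (sum_expR_le k m d0)).
    have [km|mk] := ltnP k m; last by rewrite !big_geq// ltnW.
    by rewrite [leRHS]big_ltn// lerDr expR_ge0.
  apply: (le_trans (lerD h1 h2)).
  have P0 : 0 <= d1 * (C * G) by rewrite mulr_ge0 ?ltW.
  rewrite [leRHS]mulrDl ler_wpDr//; last exact: mulDD_ge (ltW c00) P0 A00 cA.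
  by rewrite mulr_ge0 ?addr_ge0// mulr_ge0 ?ltW.
move=> mk.
have [<-|m0] := eqVneq 0%N m.
  have -> : Rsum p1 sig1 x 0 0 = 0.
    by rewrite /Rsum /blocksum big_geq// powR0 ?mulr0// invr_eq0 gt_eqF.
  rewrite mulr0 mulr_ge0 ?addr_ge0// mulr_ge0// !addr_ge0 ?mulr_ge0 ?ltW//.
apply: (le_trans (ler_wpM2l (ltW (r0 k)) (split_ _ _ _ p1_ge1))).
rewrite mulrCA -mulrA ler_pM2l// mulrDr.
have h1 : rhoseq k * Rsum p1 sig1 (fun j => z j.+1) 0 m <= c1 * (rhoseq k * A1).
  rewrite [leRHS]mulrCA ler_pM2l//.
  apply: (le_trans (shift _ _ _ _ _ p1_ge1 sig1_ge0)).
  by rewrite ler_pM2l.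
(* Crossed term: m <= k + 1 gives j <= k, so [rhoseq k] is geometrically smaller than [rhoseq j],
   which turns the local term of y into [term0]. *)
have h2 : rhoseq k * Rsum p1 sig1 (fun j => y j.+1) 0 m <= d0' * (C * G) * A0.
  apply: (le_trans (ler_wpM2l (ltW (r0 k)) (Rsum_le_term _ _ p1_ge1 sig1_ge0 y'0))).
  rewrite mulr_sumr.
  apply: (@le_trans _ _ (\sum_(0 <= j < m) (d0' * (C * A0)) * expR (- (delta * (k%:R - j%:R))))).
    apply: ler_sum_nat => j /andP[_ jm].
    have jk : (j <= k)%N by rewrite -ltnS (leq_trans jm).
    apply: (@le_trans _ _ ((C * expR (- (delta * (k%:R - j%:R)))) * term0 (fun j => y j.+1) j)).
      rewrite term0E [leRHS]mulrA ler_wpM2r ?mulr_ge0 ?powR_ge0//.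
      exact: ratio.
    apply: (@le_trans _ _ ((C * expR (- (delta * (k%:R - j%:R)))) * (d0' * A0))).
      rewrite ler_wpM2l ?mulr_ge0 ?expR_ge0 ?(ltW C0)//.
      exact: termS.
    by rewrite le_eqVlt; apply/orP; left; apply/eqP; ring.
  rewrite -mulr_sumr.
  have -> : d0' * (C * G) * A0 = d0' * (C * A0) * G by ring.
  rewrite ler_wpM2l ?mulr_ge0 ?(ltW d00) ?(ltW C0)//.
  exact: sum_expR_rev_le.
apply: (le_trans (lerD h2 h1)).
have P0 : 0 <= d0' * (C * G) by rewrite mulr_ge0 ?ltW.
rewrite [leRHS]mulrDl ler_wpDl//; last exact: mulDD_ge P0 (ltW c10) A00 cA.
by rewrite mulr_ge0 ?addr_ge0 ?(ltW c00)// mulr_ge0 ?ltW.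
Qed.

End sequence_K_bounds.

(** * Rearrangements of sums and truncations *)

Section decreasing_rearrangement.
Local Open Scope classical_set_scope.
Local Open Scope ring_scope.
Local Open Scope ereal_scope.
Context d (Omega : measurableType d) (R : realType) (mu : probability Omega R).
Implicit Types (f g : Omega -> R).

Lemma fstar_ge0 f t : 0 <= fstar mu f t. Proof. exact: rearr_ge0. Qed.

Lemma fstar_anti f (s t : R) : (s <= t)%R -> fstar mu f t <= fstar mu f s.
Proof. exact: rearr_anti. Qed.

(** f is real valued and mu is finite, so the mass of the set where |f| > n tends to 0 and is below
    t for some n. *)
Lemma fstar_lty f (t : R) : measurable_fun setT f -> (0 < t)%R -> fstar mu f t < +oo.
Proof.
move=> mf t0; have mf' : measurable_fun setT (EFin \o f) by exact/measurable_EFinP.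
pose F n := [set x | n%:R%:E < `|(EFin \o f) x|].
have mF n : measurable (F n) by exact: measurable_distr_set.
have F0 : \bigcap_n F n = set0.
  rewrite -subset0 => x /(_ (Num.truncn `|f x|).+1 I); rewrite /F/= lte_fin.
  by rewrite ltNge ltW// truncnS_gt.
have : mu (F n) @[n --> \oo] --> mu (\bigcap_n F n).
  apply: nonincreasing_cvg_mu => //.
  - by rewrite (le_lt_trans (probability_le1 mu (mF 0%N)))// ltry.
  - by rewrite F0.
  - move=> m n mn; apply/subsetPset => x; rewrite /F/=; apply: le_lt_trans.
    by rewrite lee_fin ler_nat.
rewrite F0 measure0 => cF.
have [n Fn] : exists n, mu (F n) <= t%:E.
  apply: contrapT => /forallNP h; have : t%:E <= 0.
    rewrite -(cvg_lim _ cF)//; apply: lime_ge.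
      by apply/cvg_ex; eexists; exact: cF.
    by apply: nearW => n; apply/ltW; rewrite ltNge; apply/negP/h.
  by rewrite lee_fin leNgt t0.
apply: (@le_lt_trans _ _ n%:R%:E); last exact: ltry.
by apply/rearr_leP.
Qed.

Definition fseq f (k : nat) : R := fine (fstar mu f (expR (- k%:R))).

Lemma fstarE f k : measurable_fun setT f ->
  fstar mu f (expR (- k%:R)) = (fseq f k)%:E.
Proof.
move=> mf; rewrite /fseq fineK// ge0_fin_numE ?fstar_ge0//.
by rewrite fstar_lty// expR_gt0.
Qed.

Lemma fseq_ge0 f k : (0 <= fseq f k)%R.
Proof. exact/fine_ge0/fstar_ge0. Qed.

Lemma fseq0 f : measurable_fun setT f -> fseq f 0%N = 0%R.
Proof.
move=> mf; have mf' : measurable_fun setT (EFin \o f) by exact/measurable_EFinP.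
apply/eqP; rewrite eq_le fseq_ge0 andbT -lee_fin -fstarE//.
apply/rearr_leP => //; rewrite oppr0 expR0.
by apply: probability_le1; exact: measurable_distr_set.
Qed.

Lemma distr_fseq f k : measurable_fun setT f ->
  distr mu (EFin \o f) (fseq f k) <= (expR (- k%:R))%:E.
Proof.
move=> mf; have mf' : measurable_fun setT (EFin \o f) by exact/measurable_EFinP.
by apply/rearr_leP => //; rewrite ?fseq_ge0// -fstarE.
Qed.

Lemma fseq_le f k (c : R) : measurable_fun setT f -> (0 <= c)%R ->
  distr mu (EFin \o f) c <= (expR (- k%:R))%:E -> (fseq f k <= c)%R.
Proof.
move=> mf c0 fc; have mf' : measurable_fun setT (EFin \o f) by exact/measurable_EFinP.
by rewrite -lee_fin -fstarE//; apply/rearr_leP.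
Qed.

Lemma le_fseq f g k : measurable_fun setT f -> measurable_fun setT g ->
  (forall x, (`|f x| <= `|g x|)%R) -> (fseq f k <= fseq g k)%R.
Proof.
move=> mf mg fg; apply: fseq_le; rewrite ?fseq_ge0//.
apply: le_trans (distr_fseq k mg); apply: le_measure; rewrite ?inE.
- by apply: measurable_distr_set; exact/measurable_EFinP.
- by apply: measurable_distr_set; exact/measurable_EFinP.
- by move=> x /=; rewrite !lte_fin => /lt_le_trans; apply; exact: fg.
Qed.

(** The usual bound of (f + g)* at t by the sum of f* and g* at t/2, with t/e instead: 2 e^-(k+1) <=
    e^-k because e >= 2. *)
Lemma fseqD f g k : measurable_fun setT f -> measurable_fun setT g ->
  (fseq (f + g) k <= fseq f k.+1 + fseq g k.+1)%R.
Proof.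
move=> mf mg; have mfg : measurable_fun setT (f + g)%R by exact: measurable_funD.
apply: fseq_le => //; first by rewrite addr_ge0 ?fseq_ge0.
have m1 s : measurable [set x | s%:E < `|(EFin \o f) x|].
  by apply: measurable_distr_set; exact/measurable_EFinP.
have m2 s : measurable [set x | s%:E < `|(EFin \o g) x|].
  by apply: measurable_distr_set; exact/measurable_EFinP.
apply: (@le_trans _ _ (distr mu (EFin \o f) (fseq f k.+1) + distr mu (EFin \o g) (fseq g k.+1))).
  apply: le_trans (measureU2 _ (m1 _) (m2 _)); apply: le_measure; rewrite ?inE.
  - by apply: measurable_distr_set; exact/measurable_EFinP.
  - exact: measurableU.
  - move=> x /=; rewrite !lte_fin.
    have [fx|fx fgx] := ltP (fseq f k.+1) `|f x|%R; first by left.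
    right; rewrite ltNge; apply/negP => gx.
    move: fgx; apply/negP; rewrite -leNgt.
    by apply: le_trans (ler_normD _ _) _; exact: lerD.
apply: (le_trans (leeD (distr_fseq _ mf) (distr_fseq _ mg))).
rewrite -EFinD lee_fin -natr1 opprD expRD.
have e2 : (2 <= expR 1 :> R)%R by have := expR_ge1Dx (1 : R); lra.
rewrite -mulrDr ger_pMr ?expR_gt0// expRN.
have e0 : (0 < expR 1 :> R)%R by exact: expR_gt0.
by rewrite -mulr2n -mulr_natr ler_pdivrMl// mulr1.
Qed.

Definition clip (c : R) f : Omega -> R := fun x => Num.max (- c)%R (Num.min c (f x)).

Lemma measurable_clip c f : measurable_fun setT f -> measurable_fun setT (clip c f).
Proof.
move=> mf; apply: measurable_maxr; first exact: measurable_cst.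
by apply: measurable_minr => //; exact: measurable_cst.
Qed.

Lemma clip_normP c f x : (0 <= c)%R ->
  [/\ `|clip c f x| <= c, `|clip c f x| <= `|f x|, `|f x - clip c f x| <= `|f x|
    & 0 < `|f x - clip c f x| -> c < `|f x| ]%R.
Proof.
move=> c0; rewrite /clip.
have [f0|f0] := leP 0%R (f x).
  have [cf|fc] := ltP c (f x).
    rewrite max_r; last by lra.
    rewrite (ger0_norm c0) (ger0_norm f0) ger0_norm; last by lra.
    by split; [lra|lra|lra|move=> h; lra].
  rewrite max_r; last by lra.
  by rewrite subrr normr0 (ger0_norm f0); split; [lra|lra|lra|move=> h; lra].
rewrite (ltr0_norm f0) (min_r (ltW (lt_le_trans f0 c0))).
have [cf|fc] := ltP (- c)%R (f x).
  by rewrite subrr normr0 (ltr0_norm f0); split; [lra|lra|lra|move=> h; lra].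
rewrite normrN (ger0_norm c0) opprK ler0_norm; last by lra.
by split; [lra|lra|lra|move=> h; lra].
Qed.

Lemma fseq_clip f j k : measurable_fun setT f ->
  (fseq (clip (fseq f k) f) j <= Num.min (fseq f j) (fseq f k))%R.
Proof.
move=> mf; have c0 := fseq_ge0 f k; have mc := measurable_clip (fseq f k) mf.
rewrite le_min; apply/andP; split.
  by apply: le_fseq => // x; have [] := clip_normP f x c0.
apply: fseq_le => //; rewrite /distr (_ : [set x | _] = set0) ?measure0 ?lee_fin ?expR_ge0//.
rewrite -subset0 => x /=; rewrite lte_fin ltNge.
by have [-> _ _ _] := clip_normP f x c0.
Qed.

Lemma fseq_sub_clip f j k : measurable_fun setT f ->
  (fseq (f - clip (fseq f k) f) j <= if (j <= k)%N then 0 else fseq f j)%R.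
Proof.
move=> mf; have c0 := fseq_ge0 f k; have mc := measurable_clip (fseq f k) mf.
have md : measurable_fun setT (f - clip (fseq f k) f)%R by exact: measurable_funB.
case: ifPn => [jk|_]; last first.
  by apply: le_fseq => // x; have [_ _ h _] := clip_normP f x c0.
apply: fseq_le => //; apply: (@le_trans _ _ (expR (- k%:R))%:E); last first.
  by rewrite lee_fin ler_expR lerN2 ler_nat.
apply: le_trans (distr_fseq k mf); apply: le_measure; rewrite ?inE.
- by apply: measurable_distr_set; exact/measurable_EFinP.
- by apply: measurable_distr_set; exact/measurable_EFinP.
- move=> x /=; rewrite !lte_fin => h.
  by have [_ _ _] := clip_normP f x c0; apply.
Qed.

(** f0 is the part of f beyond the height [fseq f k]: it lives where |f| exceeds this height, a set
    of mass at most e^-k, so its rearrangement vanishes from e^-k on. f1 is bounded by that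
    height. *)
Lemma truncation_split f k : measurable_fun setT f -> exists f0 f1 : Omega -> R,
  [/\ measurable_fun setT f0, measurable_fun setT f1, f = (f0 + f1)%R,
      forall j, (fseq f0 j <= if (j <= k)%N then 0 else fseq f j)%R &
      forall j, (fseq f1 j <= Num.min (fseq f j) (fseq f k))%R].
Proof.
move=> mf; exists (f - clip (fseq f k) f)%R, (clip (fseq f k) f); split.
- by apply: measurable_funB => //; exact: measurable_clip.
- exact: measurable_clip.
- by rewrite subrK.
- by move=> j; exact: fseq_sub_clip.
- by move=> j; exact: fseq_clip.
Qed.

End decreasing_rearrangement.

(** * The K-functional of two grand Lebesgue spaces *)

Section K_functional.
Local Open Scope classical_set_scope.
Local Open Scope ring_scope.
Local Open Scope ereal_scope.
Context d (Omega : measurableType d) (R : realType) (mu : probability Omega R).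
Implicit Types (f g : Omega -> R).

Lemma fstar_fseq f : measurable_fun setT f ->
  forall k, fstar mu f (expR (- k%:R)) = (fseq mu f k)%:E.
Proof. by move=> mf k; exact: fstarE. Qed.

(** The grand Lebesgue norm is [RLnorm] at u = 1, in the cell of index 0; hence [supR] at index 1 in
    the next lemmas. *)
Lemma cell0_1 : cell (@didx R) 0 1%R.
Proof. by apply/cellP; rewrite oppr0 expR0 lexx andbT expRNn_lt1. Qed.

Lemma grand_L_ub p al f : measurable_fun setT f -> (0 < p)%R -> (0 <= al)%R ->
  nnorm (grand_L mu p al) f <=
  (wconst p (al / p))%:E * supR (fseq mu f) p (al / p) 1.
Proof.
move=> mf p0 al0; have s0 : (0 <= al / p)%R by rewrite divr_ge0// ltW.
exact: (RLnorm_ub (fstar_ge0 mu f) (fstar_anti mu f) (fstar_fseq mf) p0 s0 cell0_1).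
Qed.

Lemma grand_L_lb p al f : measurable_fun setT f -> (0 < p)%R -> (0 <= al)%R ->
  supR (fseq mu f) p (al / p) 1 <=
  (wconst p (al / p))%:E * nnorm (grand_L mu p al) f.
Proof.
move=> mf p0 al0; have s0 : (0 <= al / p)%R by rewrite divr_ge0// ltW.
exact: (RLnorm_lb (fstar_ge0 mu f) (fstar_anti mu f) (fstar_fseq mf) p0 s0 cell0_1).
Qed.

Lemma grand_L_supR p al : (0 < p)%R -> (0 <= al)%R ->
  exists2 w : R, (0 < w)%R & forall f, measurable_fun setT f ->
  nnorm (grand_L mu p al) f <= w%:E * supR (fseq mu f) p (al / p) 1 /\
  supR (fseq mu f) p (al / p) 1 <= w%:E * nnorm (grand_L mu p al) f.
Proof.
move=> p0 al0; exists (wconst p (al / p)); first exact: wconst_gt0.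
by move=> f mf; split; [exact: grand_L_ub|exact: grand_L_lb].
Qed.

Lemma supL_lty (x : nat -> R) p sigma k : (0 <= p)%R -> (0 <= sigma)%R ->
  supL x p sigma k < +oo.
Proof.
move=> p0 s0; apply: (@le_lt_trans _ _ (logweight sigma 0 * blocksum p x 0 k `^ p^-1)%:E); last exact: ltry.
apply: ge_ereal_sup => _ [m /= mk <-]; rewrite lee_fin.
apply: ler_pM; rewrite ?powR_ge0 ?le_logweight//.
apply: ge0_ler_powR; rewrite ?nnegrE ?blocksum_ge0 ?invr_ge0//.
exact: le_blocksum.
Qed.

(** Beyond k the sequence z is at most [x k], so the rest of the block is a geometric series bounded
    by a multiple of its term of index k, already present in the block stopped at k + 1. Stopping
    earlier only increases the weight. *)
Lemma Rsum_truncation p sigma (x z : nat -> R) k m :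
  (1 <= p)%R -> (0 <= sigma)%R -> (forall j, 0 <= x j)%R -> (forall j, 0 <= z j)%R ->
  (forall j, z j <= Num.min (x j) (x k))%R ->
  (Rsum p sigma z 1 m <=
   (1 + geosum 1) * Rsum p sigma x 0 (minn m k.+1))%R.
Proof.
move=> p1 s0 x0 z0 zx; have p0 : (0 < p)%R by exact: lt_le_trans p1.
have G0 : (0 < geosum (1 : R))%R by exact: geosum_gt0.
have pV : (0 <= p^-1)%R by rewrite invr_ge0 ltW.
have zj j : (z j `^ p <= x j `^ p)%R.
  apply: ge0_ler_powR; rewrite ?nnegrE ?(ltW p0)//.
  by apply: (le_trans (zx j)); rewrite ge_min lexx.
have zk j : (z j `^ p <= x k `^ p)%R.
  apply: ge0_ler_powR; rewrite ?nnegrE ?(ltW p0)//.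
  by apply: (le_trans (zx j)); rewrite ge_min lexx orbT.
have le_zx l n : (blocksum p z l n <= blocksum p x l n)%R.
  by apply: ler_sum => j _; rewrite ler_wpM2l ?expR_ge0.
suff h : (blocksum p z 1 m <= (1 + geosum 1) * blocksum p x 0 (minn m k.+1))%R.
  rewrite /Rsum mulrCA; apply: ler_pM; rewrite ?powR_ge0//.
    by apply: le_logweight => //; exact: geq_minl.
  apply: (@le_trans _ _ (((1 + geosum 1) * blocksum p x 0 (minn m k.+1)) `^ p^-1)%R).
    by apply: ge0_ler_powR; rewrite ?nnegrE ?mulr_ge0 ?addr_ge0 ?blocksum_ge0 ?(ltW G0).
  rewrite powRM ?blocksum_ge0 ?addr_ge0 ?(ltW G0)// ler_wpM2r ?powR_ge0//.
  by rewrite ler1_powR ?lerDl ?(ltW G0)// invf_le1.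
have [mk|km] := leqP m k.+1.
  apply: (@le_trans _ _ (blocksum p x 0 m)).
    by apply: (le_trans (le_zx _ _)); apply: le_blocksum.
  by rewrite ler_peMl ?blocksum_ge0// lerDl ltW.
rewrite mulrDl mul1r /blocksum (big_cat_nat (n := k.+1)) ?(ltnW km)//= -/(blocksum p x 0 k.+1).
apply: lerD.
  by apply: (le_trans (le_zx _ _)); apply: le_blocksum.
apply: (@le_trans _ _ (\sum_(k <= j < m) expR (- (1 * (j%:R - k%:R))) * (expR (- k%:R) * x k `^ p))%R).
  rewrite [leRHS]big_ltn; last by rewrite ltnW.
  apply: ler_wpDl; first by rewrite !mulr_ge0 ?expR_ge0 ?powR_ge0.
  apply: ler_sum => j _; rewrite mulrA -expRD.
  rewrite (_ : - (1 * (j%:R - k%:R)) - k%:R = - j%:R)%R; last by ring.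
  by rewrite ler_wpM2l ?expR_ge0.
rewrite -mulr_suml; apply: ler_pM; rewrite ?sum_expR_le//.
- by apply: sumr_ge0 => j _; exact: expR_ge0.
- by rewrite mulr_ge0 ?expR_ge0 ?powR_ge0.
- apply: (le_trans _ (le_blocksum p x (leq0n k) (leqnn k.+1))).
  by rewrite /blocksum big_nat1.
Qed.

Lemma blocksum_support_le p (x y : nat -> R) k m : (0 < p)%R ->
  (forall j, 0 <= y j)%R -> (forall j, y j <= if (j <= k)%N then 0 else x j)%R ->
  (blocksum p y 1 m <= blocksum p x k.+1 m)%R.
Proof.
move=> p0 y0 yx; rewrite /blocksum [leRHS](big_nat_widenl k.+1 1 m)//.
rewrite [leRHS]big_mkcond/=; apply: ler_sum => j _.
have := yx j; case: (leqP j k) => [jk yj|kj yj].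
  have -> : y j = 0%R by apply/eqP; rewrite eq_le yj y0.
  by rewrite powR0 ?mulr0 ?gt_eqF.
rewrite ler_wpM2l ?expR_ge0//; apply: ge0_ler_powR; rewrite ?nnegrE ?(ltW p0)//.
exact: le_trans yj.
Qed.

Context (p0 p1 alpha beta : R).
Hypotheses (hp0 : (1 < p0)%R) (hp01 : (p0 < p1)%R).
Hypotheses (halpha : (0 < alpha)%R) (hbeta : (0 < beta)%R).

Local Notation Y0 := (grand_L mu p0 alpha).
Local Notation Y1 := (grand_L mu p1 beta).
Local Notation sig0 := (alpha / p0)%R.
Local Notation sig1 := (beta / p1)%R.
Local Notation rho := (rhoseq p0 p1 sig0 sig1).

Let p0_gt0 : (0 < p0)%R. Proof. by rewrite (lt_trans _ hp0). Qed.
Let p1_gt1 : (1 < p1)%R. Proof. exact: lt_trans hp01. Qed.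
Let p1_gt0 : (0 < p1)%R. Proof. by rewrite (lt_trans _ p1_gt1). Qed.
Let sig0_ge0 : (0 <= sig0)%R. Proof. by rewrite divr_ge0// ltW. Qed.
Let sig1_ge0 : (0 <= sig1)%R. Proof. by rewrite divr_ge0// ltW. Qed.

Definition Kseq f k : \bar R :=
  supR (fseq mu f) p0 sig0 k.+1 + (rho k)%:E * supL (fseq mu f) p1 sig1 k.+1.

Lemma rho_gt0 k : (0 < rho k)%R. Proof. exact: expR_gt0. Qed.

Lemma Kseq_ge0 f k : 0 <= Kseq f k.
Proof.
by rewrite adde_ge0 ?supR_ge0// mule_ge0 ?supL_ge0// lee_fin ltW ?rho_gt0.
Qed.

Lemma Kfun_le : exists2 C : R, (0 < C)%R & forall f k, measurable_fun setT f ->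
  Kfun Y0 Y1 (rho k) f <= C%:E * Kseq f k.
Proof.
have [w0 w00 N0] := grand_L_supR p0_gt0 (ltW halpha).
have [w1 w10 N1] := grand_L_supR p1_gt0 (ltW hbeta).
have [G G0 trunc] : exists2 G : R, (0 < G)%R & forall (x z : nat -> R) k m,
    (forall j, 0 <= x j)%R -> (forall j, 0 <= z j)%R ->
    (forall j, z j <= Num.min (x j) (x k))%R ->
    (Rsum p1 sig1 z 1 m <= G * Rsum p1 sig1 x 0 (minn m k.+1))%R.
  exists (1 + geosum 1)%R; first by rewrite addr_gt0// geosum_gt0.
  by move=> x z k m; apply: Rsum_truncation; rewrite ?(ltW p1_gt1).
exists (w0 + w1 * G)%R => [|f k mf]; first by rewrite addr_gt0// mulr_gt0.
(* An infinite first supremum makes [Kseq] infinite. Otherwise the truncation is an admissible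
   decomposition, [supL] being finite for every f. *)
have [fin|] := ltP (supR (fseq mu f) p0 sig0 k.+1) +oo; last first.
  have nz : (rho k)%:E * supL (fseq mu f) p1 sig1 k.+1 != -oo.
    by rewrite gt_eqF// (lt_le_trans ltNy0)// mule_ge0 ?supL_ge0// lee_fin ltW ?rho_gt0.
  rewrite leye_eq => /eqP e; rewrite /Kseq e addye// gt0_muley ?leey//.
  by rewrite lte_fin addr_gt0// mulr_gt0.
have [f0 [f1 [mf0 mf1 fE hf0 hf1]]] := truncation_split mu k mf.
have n0 : nnorm Y0 f0 <= w0%:E * supR (fseq mu f) p0 sig0 k.+1.
  apply: (le_trans (N0 _ mf0).1).
  apply: lee_wpmul2l; first by rewrite lee_fin ltW.
  apply: ge_ereal_sup => _ [m _ <-].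
  apply: (le_trans _ (wsum_supR (fseq mu f) p0 sig0 k.+1 m)).
  rewrite lee_fin; apply: ler_wpM2l; first exact: powR_ge0.
  apply: ge0_ler_powR; rewrite ?nnegrE; [by rewrite invr_ge0 ltW|exact: blocksum_ge0..|].
  apply: blocksum_support_le p0_gt0 _ hf0; exact: fseq_ge0.
have n1 : nnorm Y1 f1 <= (w1 * G)%:E * supL (fseq mu f) p1 sig1 k.+1.
  apply: (le_trans (N1 _ mf1).1).
  rewrite EFinM -muleA; apply: lee_wpmul2l; first by rewrite lee_fin ltW.
  apply: ge_ereal_sup => _ [m _ <-].
  apply: (@le_trans _ _ (G * Rsum p1 sig1 (fseq mu f) 0 (minn m k.+1))%:E).
    rewrite lee_fin; apply: trunc.
    - exact: fseq_ge0.
    - exact: fseq_ge0.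
    - exact: hf1.
  rewrite EFinM; apply: lee_wpmul2l; first by rewrite lee_fin ltW.
  by apply: wsum_supL; exact: geq_minr.
apply: (@le_trans _ _ (nnorm Y0 f0 + (rho k)%:E * nnorm Y1 f1)).
  apply: ereal_inf_lbound; exists f0, f1; split; [| |exact: fE|by []].
  - split; first exact: mf0.
    apply: (le_lt_trans n0); apply: lte_mul_pinfty; [|by []|exact: fin].
    by rewrite lee_fin ltW.
  - split; first exact: mf1.
    apply: (le_lt_trans n1); apply: lte_mul_pinfty; [|by []|].
      by rewrite lee_fin mulr_ge0 ?ltW.
    by apply: supL_lty => //; exact: ltW.
have A0 := supR_ge0 (fseq mu f) p0 sig0 k.+1.
have D0 : 0 <= (rho k)%:E * supL (fseq mu f) p1 sig1 k.+1.
  by rewrite mule_ge0 ?supL_ge0// lee_fin ltW ?rho_gt0.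
rewrite /Kseq (ge0_muleDr _ A0 D0); apply: leeD.
  apply: (le_trans n0); apply: lee_wpmul2r; first exact: A0.
  by rewrite lee_fin lerDl mulr_ge0 ?ltW.
apply: (@le_trans _ _ ((rho k)%:E * ((w1 * G)%:E * supL (fseq mu f) p1 sig1 k.+1))).
  by apply: lee_wpmul2l; [rewrite lee_fin ltW ?rho_gt0|exact: n1].
by rewrite muleCA; apply: lee_wpmul2r; [exact: D0|rewrite lee_fin lerDr ltW].
Qed.

(** For any admissible decomposition [fseqD] supplies the shifted inequality of [sequence_K_lower],
    with A0 and A1 multiples of the two norms. *)
Lemma le_Kfun : exists2 C : R, (0 < C)%R & forall f k, measurable_fun setT f ->
  Kseq f k <= C%:E * Kfun Y0 Y1 (rho k) f.
Proof.
have [w0 w00 N0] := grand_L_supR p0_gt0 (ltW halpha).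
have [w1 w10 N1] := grand_L_supR p1_gt0 (ltW hbeta).
have [C C0 lower] := sequence_K_lower (ltW hp0) hp01 sig0_ge0 sig1_ge0.
exists (2 * C * (w0 + w1))%R => [|f k mf]; first by rewrite !mulr_gt0// addr_gt0.
have C2 : (0 < 2 * C * (w0 + w1))%R by rewrite !mulr_gt0// addr_gt0.
rewrite -lee_pdivrMl//; apply: le_ereal_inf_tmp => _ [f0 [f1 [[mf0 f0fin] [mf1 f1fin] -> ->]]].
rewrite lee_pdivrMl//.
have N0_ge0 : 0 <= nnorm Y0 f0 by exact: Lnorm_ge0.
have N1_ge0 : 0 <= nnorm Y1 f1 by exact: Lnorm_ge0.
have [n0 e0] : exists n0, nnorm Y0 f0 = n0%:E.
  by exists (fine (nnorm Y0 f0)); rewrite fineK// ge0_fin_numE.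
have [n1 e1] : exists n1, nnorm Y1 f1 = n1%:E.
  by exists (fine (nnorm Y1 f1)); rewrite fineK// ge0_fin_numE.
rewrite e0 lee_fin in N0_ge0; rewrite e1 lee_fin in N1_ge0.
(* The norm controls blocks starting at 1; [blocksum1] lets them start at 0. *)
have hy m : (Rsum p0 sig0 (fseq mu f0) 0 m <= w0 * n0)%R.
  rewrite -lee_fin; have := (N0 _ mf0).2.
  rewrite e0; apply: le_trans; rewrite /Rsum -(blocksum1 (fseq0 mu mf0))//.
  exact: wsum_supR.
have hz m : (Rsum p1 sig1 (fseq mu f1) 0 m <= w1 * n1)%R.
  rewrite -lee_fin; have := (N1 _ mf1).2.
  rewrite e1; apply: le_trans; rewrite /Rsum -(blocksum1 (fseq0 mu mf1))//.
  exact: wsum_supR.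
have xyz j : (fseq mu (f0 + f1) j <= fseq mu f0 j.+1 + fseq mu f1 j.+1)%R.
  exact: fseqD.
have a0 : (0 <= w0 * n0)%R by rewrite mulr_ge0 ?(ltW w00).
have a1 : (0 <= w1 * n1)%R by rewrite mulr_ge0 ?(ltW w10).
have low m := lower _ _ _ (w0 * n0)%R (w1 * n1)%R k m
  (fseq_ge0 mu (f0 + f1)%R) (fseq_ge0 mu f0) (fseq_ge0 mu f1) xyz a0 a1 hy hz.
rewrite e0 e1 -(EFinM (rho k) n1) -EFinD -EFinM.
set M := (C * (w0 * n0 + rho k * (w1 * n1)))%R in low.
have h1 : supR (fseq mu (f0 + f1)%R) p0 sig0 k.+1 <= M%:E.
  by apply: ge_ereal_sup => _ [m _ <-]; rewrite lee_fin; have [] := low m.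
have h2 : (rho k)%:E * supL (fseq mu (f0 + f1)%R) p1 sig1 k.+1 <= M%:E.
  rewrite -lee_pdivlMl ?rho_gt0// -EFinM; apply: ge_ereal_sup => _ [m /= mk <-].
  rewrite lee_fin ler_pdivlMl ?rho_gt0//.
  by have [_ /(_ mk)] := low m.
apply: (le_trans (leeD h1 h2)); rewrite -EFinD lee_fin /M.
have r0 : (0 <= rho k * n1)%R by rewrite mulr_ge0 ?(ltW (rho_gt0 k)).
have h3 : (w0 * n0 + rho k * (w1 * n1) <= (w0 + w1) * (n0 + rho k * n1))%R.
  by rewrite [(rho k * _)%R]mulrCA; exact: mulDD_ge (ltW w00) (ltW w10) N0_ge0 r0.
move: h3; move: (w0 * n0 + _)%R => r h3.
rewrite (_ : C * r + C * r = 2 * C * r)%R; last by ring.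
rewrite -[leRHS]mulrA; apply: ler_wpM2l h3.
by rewrite mulr_ge0// ltW.
Qed.

End K_functional.

(** * Interpolation norms *)

Section domination.
Local Open Scope classical_set_scope.
Local Open Scope ring_scope.
Local Open Scope ereal_scope.
Context (R : realType) (T : Type) (D : set T).
Implicit Types (F G H : T -> \bar R) (A B : T -> nat -> \bar R).

Definition dominated F G := exists2 C : R, (0 < C)%R &
  forall f, D f -> F f <= C%:E * G f.

Lemma dominated_le F G : (forall f, D f -> F f <= G f) -> dominated F G.
Proof. by move=> FG; exists 1%R => // f Df; rewrite mul1e FG. Qed.

Lemma dominated_trans F G H : dominated F G -> dominated G H -> dominated F H.
Proof.
move=> [C C0 FG] [C' C'0 GH]; exists (C * C')%R; first exact: mulr_gt0.
move=> f Df; apply: (le_trans (FG f Df)); rewrite EFinM -muleA.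
by apply: lee_wpmul2l; [rewrite lee_fin ltW|exact: GH].
Qed.

Lemma dominated_add F G H : (forall f, 0 <= H f) ->
  dominated F H -> dominated G H -> dominated (fun f => F f + G f) H.
Proof.
move=> H0 [C C0 FH] [C' C'0 GH]; exists (C + C')%R; first exact: addr_gt0.
move=> f Df; rewrite EFinD ge0_muleDl ?lee_fin ?(ltW C0) ?(ltW C'0)//.
by apply: leeD; [exact: FH|exact: GH].
Qed.

Lemma dominated_max F G H : (forall f, 0 <= H f) ->
  dominated F H -> dominated G H -> dominated (fun f => maxe (F f) (G f)) H.
Proof.
move=> H0 [C C0 FH] [C' C'0 GH]; exists (C + C')%R; first exact: addr_gt0.
move=> f Df; rewrite ge_max; apply/andP; split.
  apply: (le_trans (FH f Df)); apply: lee_wpmul2r; first exact: H0.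
  by rewrite lee_fin lerDl ltW.
apply: (le_trans (GH f Df)); apply: lee_wpmul2r; first exact: H0.
by rewrite lee_fin lerDr ltW.
Qed.

Context (E : ri_space (halfline R)).

Lemma dominated_eseq_inj A B (S : set nat) (phi : nat -> nat) (C : R) : (0 < C)%R ->
  (forall f, D f -> nnseq (A f)) -> (forall f, D f -> nnseq (B f)) ->
  set_inj S phi ->
  (forall f k, D f -> S k -> A f k <= C%:E * B f (phi k)) ->
  (forall f k, D f -> ~ S k -> A f k = 0) ->
  dominated (fun f => eseq E (A f)) (fun f => eseq E (B f)).
Proof.
move=> C0 A0 B0 iphi AB nA; exists C => // f Df.
rewrite -(eseqZ E (ltW C0) (B0 f Df)).
apply: (@eseq_inj _ _ _ _ S phi); [exact: A0| |exact: iphi| |].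
- by move=> k; rewrite mule_ge0 ?lee_fin ?(ltW C0)//; exact: B0.
- by move=> k Sk; exact: AB.
- by move=> k Sk; exact: nA.
Qed.

Lemma dominated_eseq A B (C : R) : (0 < C)%R ->
  (forall f, D f -> nnseq (A f)) -> (forall f, D f -> nnseq (B f)) ->
  (forall f k, D f -> A f k <= C%:E * B f k) ->
  dominated (fun f => eseq E (A f)) (fun f => eseq E (B f)).
Proof.
move=> C0 A0 B0 AB.
apply: (@dominated_eseq_inj A B setT id C C0 A0 B0); first by move=> i j.
  by move=> f k Df _; exact: AB.
by move=> f k _; case.
Qed.

Lemma dominated_eseqS A B (C : R) : (0 < C)%R ->
  (forall f, D f -> nnseq (A f)) -> (forall f, D f -> nnseq (B f)) ->
  (forall f k, D f -> A f k <= C%:E * B f k.+1) ->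
  dominated (fun f => eseq E (A f)) (fun f => eseq E (B f)).
Proof.
move=> C0 A0 B0 AB.
apply: (@dominated_eseq_inj A B setT S C C0 A0 B0); first by move=> i j _ _ [].
  by move=> f k Df _; exact: AB.
by move=> f k _; case.
Qed.

(** [predn] is injective only on positive indices, hence the condition on the entry of index 0. *)
Lemma dominated_eseqP A B (C : R) : (0 < C)%R ->
  (forall f, D f -> nnseq (A f)) -> (forall f, D f -> nnseq (B f)) ->
  (forall f, D f -> A f 0%N = 0) ->
  (forall f k, D f -> A f k.+1 <= C%:E * B f k) ->
  dominated (fun f => eseq E (A f)) (fun f => eseq E (B f)).
Proof.
move=> C0 A0 B0 Az AB.
apply: (@dominated_eseq_inj A B [set k | (0 < k)%N] predn C C0 A0 B0).
- by move=> [|i] [|j]; rewrite ?inE//= => _ _ ->.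
- by move=> f [|k] Df //= _; exact: AB.
- by move=> f [|k] Df; [move=> _; exact: Az|case].
Qed.

Lemma dominated_tilde_ub (G : T -> R -> \bar R) A (C : R) : (0 < C)%R ->
  (forall f, D f -> nnseq (A f)) ->
  (forall f k u, D f -> cell (@didx R) k u -> (u < 1)%R ->
    `|G f u| <= C%:E * A f k) ->
  dominated (fun f => norm_itv (tilde E) 0 1 (G f)) (fun f => eseq E (A f)).
Proof.
move=> C0 A0 GA; exists C => // f Df; rewrite -(eseqZ E (ltW C0) (A0 f Df)).
apply: norm_itv_tilde_ub => [k|k t kt t1]; last exact: GA.
by rewrite mule_ge0 ?lee_fin ?(ltW C0)//; exact: A0.
Qed.

Lemma dominated_tilde_lb (G : T -> R -> \bar R) A (C : R) : (0 < C)%R ->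
  (forall f, D f -> nnseq (A f)) ->
  (forall f k u, D f -> cell (@didx R) k.+1 u -> A f k <= C%:E * `|G f u|) ->
  dominated (fun f => eseq E (A f)) (fun f => norm_itv (tilde E) 0 1 (G f)).
Proof.
move=> C0 A0 GA; exists C => // f Df.
have Ci : (0 <= C^-1)%R by rewrite invr_ge0 ltW.
rewrite -lee_pdivrMl// -(eseqZ E Ci (A0 f Df)).
apply: norm_itv_tilde_lb => [k|k t kt].
  by rewrite mule_ge0 ?lee_fin//; exact: A0.
by rewrite lee_pdivrMl//; exact: GA.
Qed.

End domination.

(** * Monotonicity and scaling of the K-functional *)

Section K_scaling.
Local Open Scope classical_set_scope.
Local Open Scope ring_scope.
Local Open Scope ereal_scope.
Context (V : zmodType) (R : realType) (Y0 Y1 : nspace V R).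
Hypotheses (Y0_ge0 : forall f, 0 <= nnorm Y0 f) (Y1_ge0 : forall f, 0 <= nnorm Y1 f).

Lemma Kfun_ge0 (t : R) f : (0 <= t)%R -> 0 <= Kfun Y0 Y1 t f.
Proof.
move=> t0; apply: le_ereal_inf_tmp => _ [f0 [f1 [_ _ _ ->]]].
by rewrite adde_ge0 ?Y0_ge0// mule_ge0 ?Y1_ge0// lee_fin.
Qed.

Lemma le_Kfun_param (s t : R) f : (0 <= s)%R -> (s <= t)%R ->
  Kfun Y0 Y1 s f <= Kfun Y0 Y1 t f.
Proof.
move=> s0 st; apply: le_ereal_inf_tmp => _ [f0 [f1 [c0 c1 e ->]]].
apply: (@le_trans _ _ (nnorm Y0 f0 + s%:E * nnorm Y1 f1)).
  by apply: ereal_inf_lbound; exists f0, f1.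
by apply: leeD => //; apply: lee_wpmul2r; [exact: Y1_ge0|rewrite lee_fin].
Qed.

Lemma Kfun_scale (c t : R) f : (1 <= c)%R -> (0 <= t)%R ->
  Kfun Y0 Y1 (c * t) f <= c%:E * Kfun Y0 Y1 t f.
Proof.
move=> c1 t0; have c0 : (0 < c)%R by exact: lt_le_trans c1.
rewrite -lee_pdivrMl//; apply: le_ereal_inf_tmp => _ [f0 [f1 [h0 h1 e ->]]].
rewrite lee_pdivrMl//; apply: (@le_trans _ _ (nnorm Y0 f0 + (c * t)%:E * nnorm Y1 f1)).
  by apply: ereal_inf_lbound; exists f0, f1.
rewrite ge0_muleDr ?Y0_ge0//; last by rewrite mule_ge0 ?Y1_ge0// lee_fin.
by rewrite muleA -EFinM leeD2r// lee_pemull ?Y0_ge0// lee_fin.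
Qed.

(** K(t) is nondecreasing and K(ct) <= c K(t) for c >= 1, so its growth rate in -ln t is at most
    1. *)
Lemma Kfun_expR_tempered f : tempered 1 1 (fun r => Kfun Y0 Y1 (expR (- r)) f).
Proof.
move=> r s; rewrite !mul1r.
apply: (@le_trans _ _ (Kfun Y0 Y1 (expR `|r - s| * expR (- s))%R f)).
  apply: le_Kfun_param; first exact: expR_ge0.
  rewrite -expRD ler_expR; have := ler_norm (- (r - s))%R; rewrite normrN; lra.
apply: Kfun_scale; last exact: expR_ge0.
by rewrite -[leLHS]expR0 ler_expR.
Qed.

End K_scaling.

(** * The interpolation norm as a sequence norm *)

Section interpolation_norm.
Local Open Scope classical_set_scope.
Local Open Scope ring_scope.
Local Open Scope ereal_scope.
Context d (Omega : measurableType d) (R : realType) (mu : probability Omega R).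
Context (E : ri_space (halfline R)) (b : R -> R) (p0 p1 alpha beta theta : R).
Hypotheses (hb : SV01 b) (hp0 : (1 < p0)%R) (hp01 : (p0 < p1)%R).
Hypotheses (halpha : (0 < alpha)%R) (hbeta : (0 < beta)%R).
Hypothesis theta_ge0 : (0 <= theta)%R.

Local Notation Y0 := (grand_L mu p0 alpha).
Local Notation Y1 := (grand_L mu p1 beta).
Local Notation sig0 := (alpha / p0)%R.
Local Notation sig1 := (beta / p1)%R.
Local Notation a := (p0^-1 - p1^-1)%R.
Local Notation gam := (sig1 - sig0)%R.
Local Notation s := (srate a gam).
Local Notation rho := (rhoseq p0 p1 sig0 sig1).
Local Notation D := [set f : Omega -> R | measurable_fun setT f].

Let p0_gt0 : (0 < p0)%R. Proof. by rewrite (lt_trans _ hp0). Qed.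
Let p1_gt1 : (1 < p1)%R. Proof. exact: lt_trans hp01. Qed.
Let p1_gt0 : (0 < p1)%R. Proof. by rewrite (lt_trans _ p1_gt1). Qed.
Let sig0_ge0 : (0 <= sig0)%R. Proof. by rewrite divr_ge0// ltW. Qed.
Let sig1_ge0 : (0 <= sig1)%R. Proof. by rewrite divr_ge0// ltW. Qed.
Let a_gt0 : (0 < a)%R. Proof. exact: rate_gt0 (ltW hp0) hp01. Qed.

(** The weight t^(-theta) b(t) at t = e^-r, with b frozen as in [svlog] so that it makes sense for
    all real r. *)
Definition gweight (r : R) : R := (expR (theta * r) * svlog b r)%R.

Lemma gweight_gt0 r : (0 < gweight r)%R.
Proof. by rewrite mulr_gt0 ?expR_gt0 ?svlog_gt0. Qed.

Lemma gweight_tempered : exists2 C : R, (0 < C)%R & forall r r',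
  (gweight r <= C * expR ((theta + 1) * `|r - r'|) * gweight r')%R.
Proof.
have [C C0 h] := svlog_tempered hb ltr01; exists C => // r r'.
apply: (@le_trans _ _ (expR (theta * r') * expR (theta * `|r - r'|) *
    (C * expR (1 * `|r - r'|) * svlog b r'))%R).
  apply: ler_pM; rewrite ?expR_ge0 ?(ltW (svlog_gt0 _ _))//.
  rewrite -expRD ler_expR -mulrDr ler_wpM2l//.
  by have := ler_norm (r - r')%R; lra.
rewrite mulrDl expRD mul1r le_eqVlt; apply/orP; left; apply/eqP; rewrite /gweight; ring.
Qed.

(* [rho(e^-k)^-theta * b(rho(e^-k))], see [rhoseq]. *)
Definition gseq k : R := gweight (s k).

Lemma gseqS : exists2 C : R, (0 < C)%R & forall k,
  (gseq k <= C * gseq k.+1 /\ gseq k.+1 <= C * gseq k)%R.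
Proof.
have [C C0 h] := gweight_tempered.
exists (C * expR ((theta + 1) * (a + `|gam|)))%R; first by rewrite mulr_gt0 ?expR_gt0.
move=> k; have := srate_lip gam a_gt0 (leqnSn k).
rewrite (_ : k.+1%:R - k%:R = 1)%R; last by rewrite -natr1; ring.
rewrite mulr1 => lip.
have t1 : (0 <= theta + 1)%R by rewrite addr_ge0.
split.
  apply: (le_trans (h (s k) (s k.+1))); rewrite ler_wpM2r ?(ltW (gweight_gt0 _))//.
  by rewrite ler_wpM2l ?(ltW C0)// ler_expR ler_wpM2l// distrC.
apply: (le_trans (h (s k.+1) (s k))); rewrite ler_wpM2r ?(ltW (gweight_gt0 _))//.
by rewrite ler_wpM2l ?(ltW C0)// ler_expR ler_wpM2l.
Qed.

Let Y0_ge0 f : 0 <= nnorm Y0 f. Proof. exact: Lnorm_ge0. Qed.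
Let Y1_ge0 f : 0 <= nnorm Y1 f. Proof. exact: Lnorm_ge0. Qed.

Let K_ge0 t f : (0 <= t)%R -> 0 <= Kfun Y0 Y1 t f.
Proof. exact: Kfun_ge0. Qed.

(** The integrand of the interpolation norm at t = e^-r. Negative r are needed since [srate] may be
    negative. *)
Definition gK (f : Omega -> R) (r : R) : \bar R :=
  (gweight r)%:E * Kfun Y0 Y1 (expR (- r)) f.

Lemma gK_ge0 f r : 0 <= gK f r.
Proof. by rewrite mule_ge0 ?lee_fin ?(ltW (gweight_gt0 _))// K_ge0 ?expR_ge0. Qed.

Lemma gK_tempered : exists2 C : R, (0 < C)%R & forall f, tempered (theta + 2) C (gK f).
Proof.
have [C C0 h] := gweight_tempered; exists C => // f r r'.
have C1 := h r r'; have K1 := Kfun_expR_tempered Y0_ge0 Y1_ge0 f r r'.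
apply: (@le_trans _ _ ((C * expR ((theta + 1) * `|r - r'|) * gweight r')%:E *
    ((1 * expR (1 * `|r - r'|))%:E * Kfun Y0 Y1 (expR (- r')) f))).
  apply: lee_pmul; [|exact: K_ge0 (expR_ge0 _)|by rewrite lee_fin|exact: K1].
  by rewrite lee_fin ltW ?gweight_gt0.
rewrite /gK !muleA -!EFinM; apply: lee_wpmul2r; first exact: K_ge0 (expR_ge0 _).
rewrite lee_fin (_ : theta + 2 = (theta + 1) + 1)%R; last by ring.
rewrite [((theta + 1 + 1) * _)%R]mulrDl expRD le_eqVlt; apply/orP; left; apply/eqP; ring.
Qed.

Let interp_fun (f : Omega -> R) (t : R) : \bar R :=
  (t `^ (- theta) * b t)%:E * Kfun Y0 Y1 t f.

Let interp_fun_cell : exists2 C : R, (0 < C)%R & forall f k t,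
  cell (@didx R) k t -> (t < 1)%R ->
  `|interp_fun f t| <= C%:E * gK f k%:R /\ gK f k%:R <= C%:E * `|interp_fun f t|.
Proof.
have [K K0 h] := svlog_cell hb.
exists (expR theta * K * expR 1)%R; first by rewrite !mulr_gt0 ?expR_gt0.
move=> f k t kt t1; have t0 := cell_gt0 kt; have /cellP/andP[kt1 kt2] := kt.
have [b1 b2] := h _ _ kt t1.
have bt : (0 < b t)%R by have [_ bp _] := hb; apply: bp; rewrite t0.
set x := (- ln t)%R; have tx : t = expR (- x) by rewrite opprK lnK.
have l1 : (k%:R <= x)%R by rewrite lerNr -ler_expR lnK ?posrE.
have l2 : (x <= k%:R + 1)%R by rewrite natr1 lerNl -ler_expR lnK ?posrE// ltW.
have tth : (t `^ (- theta) = expR (theta * x))%R by rewrite tx expR_powR mulrNN.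
have F0 : 0 <= interp_fun f t.
  by rewrite mule_ge0 ?K_ge0 ?(ltW t0)// lee_fin mulr_ge0 ?powR_ge0// ltW.
rewrite gee0_abs// /interp_fun tth /gK.
have Kt : forall r r' : R, (`|r - r'| <= 1)%R ->
    Kfun Y0 Y1 (expR (- r)) f <= (expR 1)%:E * Kfun Y0 Y1 (expR (- r')) f.
  move=> r r' rr; apply: (le_trans (Kfun_expR_tempered Y0_ge0 Y1_ge0 f r r')).
  apply: lee_wpmul2r; first exact: K_ge0 (expR_ge0 _).
  by rewrite lee_fin !mul1r ler_expR.
have d1 : (`|x - k%:R| <= 1)%R by rewrite ler_norml; apply/andP; split; lra.
have d2 : (`|k%:R - x| <= 1)%R by rewrite distrC.
have K1 := Kt _ _ d1; have K2 := Kt _ _ d2; rewrite -tx in K1 K2.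
have eth0 : (0 <= expR theta * K)%R by rewrite mulr_ge0 ?expR_ge0 ?ltW.
split.
  apply: (@le_trans _ _ ((expR theta * K * gweight k%:R)%:E *
      ((expR 1)%:E * Kfun Y0 Y1 (expR (- k%:R)) f))).
    apply: lee_pmul; [|exact: K_ge0 (ltW t0)| |exact: K1].
      by rewrite lee_fin mulr_ge0 ?expR_ge0 ?(ltW bt).
    rewrite lee_fin; apply: (@le_trans _ _ ((expR theta * expR (theta * k%:R)) * (K * svlog b k%:R))%R).
      apply: ler_pM; rewrite ?expR_ge0 ?(ltW bt)//.
      by rewrite -expRD ler_expR; have := ler_wpM2l theta_ge0 l2; lra.
    rewrite /gweight le_eqVlt; apply/orP; left; apply/eqP; ring.
  rewrite !muleA -!EFinM; apply: lee_wpmul2r; first exact: K_ge0 (expR_ge0 _).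
  rewrite lee_fin le_eqVlt; apply/orP; left; apply/eqP; ring.
apply: (@le_trans _ _ ((expR theta * K * (expR (theta * x) * b t))%:E *
    ((expR 1)%:E * Kfun Y0 Y1 t f))).
  apply: lee_pmul; [|exact: K_ge0 (expR_ge0 _)| |exact: K2].
    by rewrite lee_fin ltW ?gweight_gt0.
  rewrite lee_fin; apply: (@le_trans _ _ (expR (theta * x) * (K * b t))%R).
    apply: ler_pM; rewrite ?expR_ge0 ?(ltW (svlog_gt0 _ _))//.
    by rewrite ler_expR ler_wpM2l.
  rewrite (_ : expR theta * K * (expR (theta * x) * b t) =
    expR theta * (expR (theta * x) * (K * b t)))%R; last by ring.
  rewrite ler_peMl ?mulr_ge0 ?expR_ge0 ?(ltW K0) ?(ltW bt)//.
  by rewrite -[leLHS]expR0 ler_expR.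
rewrite !muleA -!EFinM; apply: lee_wpmul2r; first exact: K_ge0 (ltW t0).
rewrite lee_fin le_eqVlt; apply/orP; left; apply/eqP; ring.
Qed.

Local Notation x f := (fseq mu f).
Local Notation KS := (@Kseq d Omega R mu p0 p1 alpha beta).

Definition Zseq f k : \bar R := (gseq k)%:E * KS f k.

Lemma Zseq_ge0 f : nnseq (Zseq f).
Proof. by move=> k; rewrite mule_ge0 ?Kseq_ge0// lee_fin ltW ?gweight_gt0. Qed.

(** Sample the integrand at t = e^-m, change variables by [eseq_srate] to reach t = rho(e^-k), then
    replace K by [Kseq]. *)
Lemma interp_dominated :
  dominated D (interp_norm Y0 Y1 theta b E) (fun f => eseq E (Zseq f)) /\
  dominated D (fun f => eseq E (Zseq f)) (interp_norm Y0 Y1 theta b E).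
Proof.
have [C1 C10 h1] := interp_fun_cell.
have [C2 C20 h2] := gK_tempered.
have th2 : (0 <= theta + 2)%R by rewrite addr_ge0.
have [C3 C30 h3] := eseq_srate E gam a_gt0 th2 C20.
have [C4 C40 h4] := Kfun_le mu hp0 hp01 halpha hbeta.
have [C5 C50 h5] := le_Kfun mu hp0 hp01 halpha hbeta.
have A0 f : D f -> nnseq (fun m => gK f m%:R) by move=> _ k; exact: gK_ge0.
have B0 f : D f -> nnseq (gK f \o s) by move=> _ k; exact: gK_ge0.
have Z0 f : D f -> nnseq (Zseq f) by move=> _; exact: Zseq_ge0.
have g0 k : 0 <= (gseq k)%:E by rewrite lee_fin ltW ?gweight_gt0.
split.
  apply: (@dominated_trans _ _ _ _ (fun f => eseq E (fun m => gK f m%:R))).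
    apply: (@dominated_tilde_ub R (Omega -> R) D E interp_fun
      (fun f m => gK f m%:R) C1 C10 A0) => f k u _ ku u1.
    exact: (h1 f k u ku u1).1.
  apply: (@dominated_trans _ _ _ _ (fun f => eseq E (gK f \o s))).
    by exists C3 => // f _; have [] := h3 (gK f) (gK_ge0 f) (h2 f).
  apply: (@dominated_eseq R (Omega -> R) D E (fun f => gK f \o s) Zseq C4 C40 B0 Z0) => f k mf.
  rewrite /Zseq muleCA; apply: lee_wpmul2l; first exact: g0.
  exact: h4.
apply: (@dominated_trans _ _ _ _ (fun f => eseq E (gK f \o s))).
  apply: (@dominated_eseq R (Omega -> R) D E Zseq (fun f => gK f \o s) C5 C50 Z0 B0) => f k mf.
  rewrite /Zseq muleCA; apply: lee_wpmul2l; first exact: g0.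
  exact: h5.
apply: (@dominated_trans _ _ _ _ (fun f => eseq E (fun m => gK f m%:R))).
  by exists C3 => // f _; have [] := h3 (gK f) (gK_ge0 f) (h2 f).
(* The entry k is compared with the cell k + 1; moving [gK] by one unit costs
   [C2 * expR (theta + 2)]. *)
have C6 : (0 < C2 * expR (theta + 2) * C1)%R by rewrite !mulr_gt0 ?expR_gt0.
apply: (@dominated_tilde_lb R (Omega -> R) D E interp_fun
  (fun f m => gK f m%:R) _ C6 A0) => f k u _ ku.
have /(_ (cellS_lt1 ku)) [_ h] := h1 f k.+1 u ku.
apply: (le_trans (h2 f k%:R k.+1%:R)).
rewrite [X in _ <= X * _]EFinM -[leRHS]muleA.
apply: lee_pmul; [|exact: gK_ge0| |exact: h].
  by rewrite lee_fin mulr_ge0 ?expR_ge0 ?ltW.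
rewrite (_ : k%:R - k.+1%:R = -1 :> R)%R; last by rewrite -natr1; ring.
by rewrite normrN1 mulr1.
Qed.

(* The two summands of [Zseq], and the local terms. *)
Definition Aseq f k : \bar R := (gseq k)%:E * supR (x f) p0 sig0 k.+1.
Definition Dseq f k : \bar R := (gseq k)%:E * ((rho k)%:E * supL (x f) p1 sig1 k.+1).
Definition Tseq f k : \bar R := (gseq k * term0 p0 sig0 (x f) k)%:E.

Let rho0 k : (0 < rho k)%R. Proof. exact: expR_gt0. Qed.
Let gs0 k : (0 < gseq k)%R. Proof. exact: gweight_gt0. Qed.
Let gs0e k : 0 <= (gseq k)%:E. Proof. by rewrite lee_fin ltW. Qed.

Lemma Aseq_ge0 f : nnseq (Aseq f).
Proof. by move=> k; rewrite mule_ge0 ?gs0e ?supR_ge0. Qed.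

Lemma Dseq_ge0 f : nnseq (Dseq f).
Proof.
by move=> k; rewrite mule_ge0 ?gs0e// mule_ge0 ?supL_ge0// lee_fin ltW.
Qed.

Lemma Tseq_ge0 f : nnseq (Tseq f).
Proof.
by move=> k; rewrite lee_fin mulr_ge0 ?(ltW (gs0 _))// term0_ge0//; exact: fseq_ge0.
Qed.

Let An f : D f -> nnseq (Aseq f). Proof. by move=> _; exact: Aseq_ge0. Qed.
Let Dn f : D f -> nnseq (Dseq f). Proof. by move=> _; exact: Dseq_ge0. Qed.
Let Tn f : D f -> nnseq (Tseq f). Proof. by move=> _; exact: Tseq_ge0. Qed.
Let Zn f : D f -> nnseq (Zseq f). Proof. by move=> _; exact: Zseq_ge0. Qed.

Lemma ZseqE f k : Zseq f k = Aseq f k + Dseq f k.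
Proof.
rewrite /Zseq /Kseq ge0_muleDr ?supR_ge0// mule_ge0 ?supL_ge0//.
by rewrite lee_fin ltW.
Qed.

Lemma Zseq_dominated H : (forall f, 0 <= H f) ->
  dominated D (fun f => eseq E (Aseq f)) H ->
  dominated D (fun f => eseq E (Dseq f)) H ->
  dominated D (fun f => eseq E (Zseq f)) H.
Proof.
move=> H0 AH DH; apply: dominated_trans (dominated_add H0 AH DH).
apply: dominated_le => f _.
have -> : Zseq f = (fun k => Aseq f k + Dseq f k) by apply/funext => k; exact: ZseqE.
by apply: eseqD; [exact: Aseq_ge0|exact: Dseq_ge0].
Qed.

Lemma Aseq_le_Zseq : dominated D (fun f => eseq E (Aseq f)) (fun f => eseq E (Zseq f)).
Proof.
apply: (@dominated_eseq R (Omega -> R) D E Aseq Zseq 1%R ltr01 An Zn) => f k _.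
by rewrite mul1e ZseqE leeDl// Dseq_ge0.
Qed.

Lemma Dseq_le_Zseq : dominated D (fun f => eseq E (Dseq f)) (fun f => eseq E (Zseq f)).
Proof.
apply: (@dominated_eseq R (Omega -> R) D E Dseq Zseq 1%R ltr01 Dn Zn) => f k _.
by rewrite mul1e ZseqE leeDr// Aseq_ge0.
Qed.

(** The block of [Aseq] at k starts at k + 1, so it controls the local term k + 1; the local term 0
    vanishes. *)
Lemma Tseq_le_Aseq : dominated D (fun f => eseq E (Tseq f)) (fun f => eseq E (Aseq f)).
Proof.
have [C C0 h] := gseqS.
have C1 : (0 < C * 2 `^ sig0)%R by rewrite mulr_gt0 ?powR_gt0.
apply: (@dominated_eseqP R (Omega -> R) D E Tseq Aseq _ C1 Tn An) => [f mf|f k mf].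
  by rewrite /Tseq /term0 fseq0// !mulr0.
rewrite /Tseq /Aseq muleA -EFinM.
apply: (@le_trans _ _ ((C * gseq k) * (2 `^ sig0 * Rsum p0 sig0 (x f) k.+1 k.+2))%:E).
  rewrite lee_fin; apply: ler_pM; rewrite ?(ltW (gs0 _))//.
  - by rewrite term0_ge0//; exact: fseq_ge0.
  - exact: (h k).2.
  - apply: term_le_Rsum; rewrite ?(ltW hp0)//; exact: fseq_ge0.
rewrite [X in X%:E <= _]mulrA [leLHS]EFinM; apply: lee_pmul; rewrite ?lee_fin.
- by apply: mulr_ge0 (powR_ge0 _ _); apply: mulr_ge0; apply: ltW.
- by rewrite mulr_ge0 ?powR_ge0.
- by rewrite [(C * 2 `^ _ * _)%R]mulrAC.
- exact: wsum_supR.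
Qed.

Lemma Tseq_le_Dseq : dominated D (fun f => eseq E (Tseq f)) (fun f => eseq E (Dseq f)).
Proof.
have C1 : (0 < 2 `^ sig1 :> R)%R by rewrite powR_gt0.
apply: (@dominated_eseq R (Omega -> R) D E Tseq Dseq _ C1 Tn Dn) => f k mf.
rewrite /Dseq muleCA /Tseq EFinM; apply: lee_wpmul2l; first exact: gs0e.
rewrite (term0E p0 p1 sig0 sig1) EFinM [leRHS]muleCA.
apply: lee_wpmul2l; first by rewrite lee_fin ltW.
apply: (@le_trans _ _ (2 `^ sig1 * Rsum p1 sig1 (x f) 0 k.+1)%:E).
  by rewrite lee_fin; apply: term_le_Rsum; rewrite ?(ltW p1_gt1)//; exact: fseq_ge0.
rewrite EFinM; apply: lee_wpmul2l; first by rewrite lee_fin ltW.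
exact: wsum_supL.
Qed.

(** For theta > 0 the factor rho^(-theta) makes [gseq] grow geometrically, so [gseq k] is at most C
    e^(-delta i) [gseq (k + i)]: the upward Hardy inequality applies. *)
Lemma Aseq_le_Tseq : (0 < theta)%R ->
  dominated D (fun f => eseq E (Aseq f)) (fun f => eseq E (Tseq f)).
Proof.
move=> th0; have [C [delta [C0 d0 h]]] := svlog_srate hb gam a_gt0 th0.
exists (C * geosum delta)%R => [|f mf]; first by rewrite mulr_gt0 ?geosum_gt0.
apply: (@eseq_hardy_up R E delta C _ _ d0 (ltW C0) (Aseq_ge0 f) (Tseq_ge0 f)) => k.
rewrite /Aseq -lee_pdivlMl//; apply: ge_ereal_sup => _ [m _ <-].
rewrite lee_pdivlMl//.
have gk i : (gseq k <= C * expR (- (delta * i%:R)) * gseq (k + i)%N)%R.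
  have [_] := h k (k + i)%N (leq_addr _ _).
  rewrite (_ : (k + i)%N%:R - k%:R = i%:R :> R)%R; last by rewrite natrD; ring.
  move=> hs.
  rewrite /gseq /gweight; apply: (le_trans (ler_wpM2l (expR_ge0 _) hs)).
  rewrite le_eqVlt; apply/orP; left; apply/eqP.
  have -> : (expR (theta * s (k + i)%N) =
    expR (theta * s k) * expR (theta * (s (k + i)%N - s k)))%R.
    by rewrite -expRD; congr expR; ring.
  ring.
apply: (@le_trans _ _ (\sum_(0 <= i < m) ((C * expR (- (delta * i%:R)))%:E * Tseq f (k + i)%N))).
  rewrite -EFinM [leRHS](_ : _ = (\sum_(0 <= i < m)
     (C * expR (- (delta * i%:R)) * (gseq (k + i) * term0 p0 sig0 (x f) (k + i))))%:E); last first.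
    by rewrite -sumEFin.
  rewrite lee_fin.
  (* The block is enlarged to the m indices starting at k, so that i = j - k runs over 0, ..., m -
     1. *)
  apply: (@le_trans _ _ (gseq k * \sum_(k <= j < k + m) term0 p0 sig0 (x f) j)%R).
    rewrite ler_wpM2l ?(ltW (gs0 _))//.
    apply: (le_trans (Rsum_le_term _ _ (ltW hp0) sig0_ge0 (fseq_ge0 mu f))).
    rewrite (big_nat_widen k.+1 m (k + m)) ?leq_addl// (big_nat_widenl k.+1 k)//.
    rewrite big_mkcond; apply: ler_sum => j _.
    by case: ifP => // _; rewrite term0_ge0//; exact: fseq_ge0.
  have -> : (\sum_(k <= j < k + m) term0 p0 sig0 (x f) j =
      \sum_(0 <= i < m) term0 p0 sig0 (x f) (k + i)%N)%R.
    rewrite -[in LHS](add0n k) big_addn add0n addKn.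
    by apply: eq_bigr => i _; rewrite addnC.
  rewrite mulr_sumr; apply: ler_sum => i _.
  rewrite mulrA; apply: ler_wpM2r; last exact: gk.
  by rewrite term0_ge0//; exact: fseq_ge0.
apply: nneseries_lim_ge => i _ _; rewrite mule_ge0 ?Tseq_ge0//.
by rewrite lee_fin mulr_ge0 ?expR_ge0 ?ltW.
Qed.

(** The weight is now [gseq] times rho, of order rho^(1 - theta) b(rho), which decays geometrically
    for theta < 1: the downward Hardy inequality applies. *)
Lemma Dseq_le_Tseq : (theta < 1)%R ->
  dominated D (fun f => eseq E (Dseq f)) (fun f => eseq E (Tseq f)).
Proof.
move=> th1; have th0 : (0 < 1 - theta)%R by rewrite subr_gt0.
have [C [delta [C0 d0 h]]] := svlog_srate hb gam a_gt0 th0.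
exists (C * geosum delta)%R => [|f mf]; first by rewrite mulr_gt0 ?geosum_gt0.
apply: (@eseq_hardy_down R E delta C _ _ d0 (ltW C0) (Dseq_ge0 f) (Tseq_ge0 f)) => k.
have gr : (0 < gseq k * rho k)%R by apply: mulr_gt0; [exact: gs0|exact: rho0].
rewrite /Dseq muleA -EFinM -(lee_pdivlMl _ _ gr).
apply: ge_ereal_sup => _ [m /= mk <-]; rewrite (lee_pdivlMl _ _ gr).
have gk j : (j <= k)%N ->
    (gseq k * rho k <= C * expR (- (delta * (k%:R - j%:R))) * (gseq j * rho j))%R.
  move=> jk; have [hs _] := h j k jk.
  rewrite /gseq /gweight /rhoseq mulrAC.
  apply: (le_trans (ler_wpM2l (mulr_ge0 (expR_ge0 _) (expR_ge0 _)) hs)).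
  rewrite le_eqVlt; apply/orP; left; apply/eqP.
  set q := expR (- (delta * _)).
  have e1 : (expR (theta * s k) * expR (- s k) * expR ((1 - theta) * (s k - s j)) =
      expR (theta * s j) * expR (- s j))%R.
    by rewrite -!expRD; congr expR; ring.
  transitivity (C * q * svlog b (s j) *
    (expR (theta * s k) * expR (- s k) * expR ((1 - theta) * (s k - s j))))%R.
    by ring.
  rewrite e1; ring.
rewrite [leRHS](_ : _ = (\sum_(0 <= j < k.+1)
   (C * expR (- (delta * (k%:R - j%:R))) * (gseq j * term0 p0 sig0 (x f) j)))%:E); last first.
  by rewrite -sumEFin.
rewrite -EFinM lee_fin.
apply: (le_trans (ler_wpM2l _ (Rsum_le_term _ _ (ltW p1_gt1) sig1_ge0 (fseq_ge0 mu f)))).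
  by rewrite mulr_ge0 ?(ltW (gs0 _)) ?(ltW (rho0 _)).
rewrite mulr_sumr (big_nat_widen 0 m k.+1)//= big_mkcond/=.
rewrite [leLHS]big_nat [leRHS]big_nat.
apply: ler_sum => j /andP[_ jk]; rewrite ltnS in jk.
have t0 : (0 <= logweight sig1 j * (expR (- j%:R) `^ p1^-1 * x f j))%R.
  by rewrite !mulr_ge0 ?powR_ge0 ?fseq_ge0.
case: ifP => _; last first.
  apply: mulr_ge0; first by rewrite mulr_ge0 ?expR_ge0 ?(ltW C0).
  by apply: mulr_ge0; [exact: ltW|rewrite term0_ge0//; exact: fseq_ge0].
rewrite (term0E p0 p1 sig0 sig1) [(gseq j * _)%R]mulrA [leRHS]mulrA.
by apply: ler_wpM2r; [exact: t0|exact: gk].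
Qed.

End interpolation_norm.

(** * Norms of the target spaces *)

Section function_space_norms.
Local Open Scope classical_set_scope.
Local Open Scope ring_scope.
Local Open Scope ereal_scope.
Context d (Omega : measurableType d) (R : realType) (mu : probability Omega R).
Context (E : ri_space (halfline R)) (b : R -> R) (p0 p1 alpha beta : R).
Hypotheses (hb : SV01 b) (hp0 : (1 < p0)%R) (hp01 : (p0 < p1)%R).
Hypotheses (halpha : (0 < alpha)%R) (hbeta : (0 < beta)%R).

Local Notation Y0 := (grand_L mu p0 alpha).
Local Notation Y1 := (grand_L mu p1 beta).
Local Notation sig0 := (alpha / p0)%R.
Local Notation sig1 := (beta / p1)%R.
Local Notation a := (p0^-1 - p1^-1)%R.
Local Notation gam := (sig1 - sig0)%R.
Local Notation s := (srate a gam).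
Local Notation rho := (rhoseq p0 p1 sig0 sig1).
Local Notation D := [set f : Omega -> R | measurable_fun setT f].
Local Notation brho := (fun u : R => extend1 b (u `^ a * ell gam u)%R).
Local Notation gk := (gseq b p0 p1 alpha beta).
Local Notation x f := (fseq mu f).

Let p0_gt0 : (0 < p0)%R. Proof. by rewrite (lt_trans _ hp0). Qed.
Let p1_gt1 : (1 < p1)%R. Proof. exact: lt_trans hp01. Qed.
Let p1_gt0 : (0 < p1)%R. Proof. by rewrite (lt_trans _ p1_gt1). Qed.
Let sig0_ge0 : (0 <= sig0)%R. Proof. by rewrite divr_ge0// ltW. Qed.
Let sig1_ge0 : (0 <= sig1)%R. Proof. by rewrite divr_ge0// ltW. Qed.
Let a_gt0 : (0 < a)%R. Proof. exact: rate_gt0 (ltW hp0) hp01. Qed.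
Let gk0 theta k : (0 < gk theta k)%R. Proof. exact: gweight_gt0. Qed.

(** Here [q] is rho(u)^(-theta) b(rho(u)), with the extension of b by 1; on a cell -ln rho(u) stays
    within L of [srate k]. *)
Let weight_cell theta : (0 <= theta)%R -> exists2 K : R, (0 < K)%R &
  forall k u, cell (@didx R) k u ->
  let q := (expR (theta * lrate a gam (- ln u)) * brho u)%R in
  (q <= K * gk theta k /\ gk theta k <= K * q)%R.
Proof.
move=> th0; have [K K0 h] := svlog_extend1 hb gam a_gt0.
set L := (a + `|gam|)%R; have L0 : (0 < L)%R by rewrite ltr_wpDr.
exists (expR (theta * L) * K)%R; first by rewrite mulr_gt0 ?expR_gt0.
move=> k u ku; have u0 := cell_gt0 ku.
have u1 : (u <= 1)%R by have /cellP/andP[_ /le_trans] := ku; apply; exact: expRNn_le1.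
have [h1 h2] := h k u ku; have := lrate_cell gam a_gt0 ku; rewrite -/L => lip.
rewrite (expR_lrate a gam u0 u1) /=; move: h1 h2 lip.
move: (lrate a gam (- ln u)) => r h1 h2 lip.
have e0 : (0 <= extend1 b (expR (- r)))%R.
  by rewrite -(pmulr_rge0 _ K0); apply: le_trans h2; rewrite ltW ?svlog_gt0.
rewrite /gseq /gweight; split.
  apply: (@le_trans _ _ ((expR (theta * L) * expR (theta * s k)) * (K * svlog b (s k)))%R).
    apply: ler_pM; [exact: expR_ge0|exact: e0| |exact: h1].
    rewrite -expRD ler_expR -mulrDr ler_wpM2l//.
    by move: lip; rewrite ler_norml; lra.
  rewrite le_eqVlt; apply/orP; left; apply/eqP; ring.
apply: (@le_trans _ _ ((expR (theta * L) * expR (theta * r)) * (K * extend1 b (expR (- r))))%R).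
  apply: ler_pM; [exact: expR_ge0|by rewrite ltW ?svlog_gt0| |exact: h2].
  rewrite -expRD ler_expR -mulrDr ler_wpM2l//.
  by move: lip; rewrite ler_norml; lra.
rewrite le_eqVlt; apply/orP; left; apply/eqP; ring.
Qed.

Let brho_cell : exists2 K : R, (0 < K)%R & forall k u, cell (@didx R) k u ->
  (0 <= brho u /\ brho u <= K * gk 0 k /\ gk 0 k <= K * brho u)%R.
Proof.
have [K K0 h] := weight_cell (lexx 0%R); exists K => // k u ku.
have := h k u ku; rewrite /= mul0r expR0 mul1r => -[h1 h2]; split => //.
by rewrite -(pmulr_rge0 _ K0); apply: le_trans h2; exact: ltW.
Qed.

Lemma fseq_leS f k : measurable_fun setT f -> (x f k <= x f k.+1)%R.
Proof.
move=> mf; rewrite -lee_fin -!fstarE//; apply: fstar_anti.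
by rewrite ler_expR lerN2 ler_nat.
Qed.

(** For a nondecreasing sequence [y j] <= [y j.+1], so a block starting at k is bounded by e times
    the one shifted to start at k + 1. *)
Lemma supR_leS p sigma (y : nat -> R) k : (1 <= p)%R -> (0 <= sigma)%R ->
  (forall j, 0 <= y j)%R -> (forall j, y j <= y j.+1)%R ->
  supR y p sigma k <= (2 `^ sigma * expR 1)%:E * supR y p sigma k.+1.
Proof.
move=> p1' s0 y0 yS; apply: ge_ereal_sup => _ [m _ <-].
apply: (@le_trans _ _ ((2 `^ sigma * expR 1)%:E * wsum y p sigma k.+1 m.+1)); last first.
  apply: lee_wpmul2l; last exact: wsum_supR.
  by rewrite lee_fin mulr_ge0 ?powR_ge0 ?expR_ge0.
rewrite -EFinM lee_fin.
apply: (@le_trans _ _ ((2 `^ sigma * logweight sigma m.+1) *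
    (expR 1 * blocksum p y k.+1 m.+1 `^ p^-1))%R).
  apply: ler_pM; rewrite ?powR_ge0 ?logweightS//.
  apply: (le_trans _ (blocksum_powV_shift y k m p1')).
  have p0' : (0 <= p)%R by rewrite (le_trans _ p1').
  apply: ge0_ler_powR; rewrite ?nnegrE ?blocksum_ge0 ?invr_ge0//.
  apply: ler_sum => j _; rewrite ler_wpM2l ?expR_ge0//.
  by apply: ge0_ler_powR; rewrite ?nnegrE.
rewrite le_eqVlt; apply/orP; left; apply/eqP; ring.
Qed.

Section intermediate.
Context (theta p : R).
Hypotheses (theta0 : (0 <= theta)%R).
Hypothesis hp : (p^-1 = (1 - theta) / p0 + theta / p1)%R.

Let B u : R := (ell (- (alpha * (1 - theta) / p0 + beta * theta / p1)) u * brho u)%R.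

Let GL (f : Omega -> R) t : \bar R := (t `^ p^-1 * B t)%:E * fstar mu f t.

(** The weight of the intermediate space is the geometric mean of the two local weights, with
    exponents 1 - theta and theta, times b(rho). As rho is their quotient, this is rho^(-theta)
    b(rho) times the first local weight. *)
Let GLE k t : cell (@didx R) k t ->
  (t `^ p^-1 * B t = (expR (theta * lrate a gam (- ln t)) * brho t) *
    (ell (- sig0) t * t `^ p0^-1))%R.
Proof.
move=> kt; have t0 := cell_gt0 kt; rewrite /B.
have t1 : (t <= 1)%R by have /cellP/andP[_ /le_trans] := kt; apply; exact: expRNn_le1.
have l0 : (0 <= - ln t)%R by rewrite oppr_ge0 ln_le0.
have ellE (c : R) : (ell c t = expR (c * ln (1 - ln t)))%R.
  rewrite /ell -[in `|ln t|%R](opprK (ln t)) normrN ger0_norm//.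
  by rewrite -{1}[(1 - ln t)%R]lnK ?expR_powR// posrE ltr_wpDr.
have tE (q : R) : (t `^ q = expR (q * ln t))%R by rewrite -{1}(lnK t0) expR_powR.
rewrite !ellE !tE /lrate hp.
set e := extend1 _ _; move: (ln (1 - ln t)) (ln t) => l y.
rewrite [LHS]mulrA [RHS]mulrAC -!expRD; congr (_ * _)%R.
by congr expR; field; rewrite !gt_eqF.
Qed.

Lemma space_L_dominated :
  dominated D (nnorm (space_L mu p B (tilde E)))
    (fun f => eseq E (Tseq mu b p0 p1 alpha beta theta f)) /\
  dominated D (fun f => eseq E (Tseq mu b p0 p1 alpha beta theta f))
    (nnorm (space_L mu p B (tilde E))).
Proof.
have [K K0 hK] := weight_cell theta0.
have [C C0 hC] := gseqS alpha beta hb hp0 hp01 theta0.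
set T := Tseq mu b p0 p1 alpha beta theta.
have T0 f : D f -> nnseq (T f) by move=> _; exact: Tseq_ge0.
have TS0 f : D f -> nnseq (fun k => T f k.+1) by move=> Df k; exact: T0.
have tp0 k t : cell (@didx R) k t ->
    (expR (- k.+1%:R) `^ p0^-1 <= t `^ p0^-1 <= expR (- k%:R) `^ p0^-1)%R.
  move=> kt; have /cellP/andP[k1 k2] := kt; have t0 := cell_gt0 kt.
  by apply/andP; split; apply: ge0_ler_powR; rewrite ?nnegrE ?expR_ge0 ?invr_ge0 ?(ltW p0_gt0) ?(ltW t0) ?(ltW k1).
have ep k : (expR (- k%:R) `^ p0^-1 <= expR 1 * expR (- k.+1%:R) `^ p0^-1 :> R)%R.
  rewrite !expR_powR -expRD ler_expR -natr1.
  have : (p0^-1 <= 1)%R by rewrite invf_le1// ltW.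
  by lra.
have x0 f k : (0 <= x f k)%R by exact: fseq_ge0.
have q_ge0 k t : cell (@didx R) k t -> (0 <= expR (theta * lrate a gam (- ln t)) * brho t)%R.
  move=> kt; rewrite -(pmulr_rge0 _ K0); apply: le_trans (hK k t kt).2.
  exact: ltW.
have G0 f k t : cell (@didx R) k t -> `|GL f t| =
    ((expR (theta * lrate a gam (- ln t)) * brho t) * (ell (- sig0) t * t `^ p0^-1))%:E * fstar mu f t.
  move=> kt; rewrite /GL (GLE kt) gee0_abs//.
  rewrite mule_ge0 ?fstar_ge0// lee_fin.
  by apply: mulr_ge0; [exact: (q_ge0 _ _ kt)|rewrite mulr_ge0 ?powR_ge0].
split.
  (* On the cell k the rearrangement is bounded by its value at e^-(k+1), hence the shifted local
     terms. *)
  apply: (@dominated_trans _ _ _ _ (fun f => eseq E (fun k => T f k.+1))).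
    have C1 : (0 < K * C * (2 `^ sig0 * expR 1))%R by rewrite !mulr_gt0 ?powR_gt0 ?expR_gt0.
    apply: (@dominated_tilde_ub R (Omega -> R) D E GL (fun f k => T f k.+1) _ C1 TS0).
    move=> f k t mf kt _; rewrite (G0 f k t kt).
    have /andP[_ ek] := ell_cell sig0_ge0 kt; have /andP[_ tk] := tp0 k t kt.
    have /andP[_ xk] := X_cell (fstar_anti mu f) (fstar_fseq mu mf) kt.
    rewrite /T /Tseq -EFinM.
    apply: (@le_trans _ _ (((K * (C * gk theta k.+1)) *
      ((2 `^ sig0 * logweight sig0 k.+1) * (expR 1 * expR (- k.+1%:R) `^ p0^-1)))%:E * (x f k.+1)%:E)).
      apply: lee_pmul; [|exact: fstar_ge0| |exact: xk].
        by rewrite lee_fin; apply: mulr_ge0; [exact: (q_ge0 _ _ kt)|rewrite mulr_ge0 ?powR_ge0].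
      rewrite lee_fin; apply: ler_pM; [exact: (q_ge0 _ _ kt)|by rewrite mulr_ge0 ?powR_ge0| |].
        apply: (le_trans (hK k t kt).1); rewrite ler_pM2l//.
        exact: (hC k).1.
      apply: ler_pM; rewrite ?powR_ge0//.
        exact: le_trans ek (logweightS _ sig0_ge0).
      exact: le_trans tk (ep k).
    rewrite -EFinM lee_fin /term0 le_eqVlt; apply/orP; left; apply/eqP; ring.
  apply: (@dominated_eseqS R (Omega -> R) D E (fun f k => T f k.+1) T 1%R ltr01 TS0 T0).
  by move=> f k _; rewrite mul1e.
(* Dropping [T f 0] = 0 leaves the entries controlled by cells contained in (0,1). *)
apply: (@dominated_trans _ _ _ _ (fun f => eseq E (fun k => T f k.+1))).
  apply: (@dominated_eseqP R (Omega -> R) D E T (fun f k => T f k.+1) 1%R ltr01 T0 TS0).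
    by move=> f mf; rewrite /T /Tseq /term0 fseq0// !mulr0.
  by move=> f k _; rewrite mul1e.
have C1 : (0 < K * (2 `^ sig0 * expR 1))%R by rewrite !mulr_gt0 ?powR_gt0 ?expR_gt0.
apply: (@dominated_tilde_lb R (Omega -> R) D E GL (fun f k => T f k.+1) _ C1 TS0).
move=> f k t mf kt; rewrite (G0 f k.+1 t kt).
have /andP[ek _] := ell_cell sig0_ge0 kt; have /andP[tk _] := tp0 _ t kt.
have /andP[xk _] := X_cell (fstar_anti mu f) (fstar_fseq mu mf) kt.
rewrite muleA -EFinM /T /Tseq /term0.
rewrite (_ : _ * (_ * (_ * x f k.+1)) =
  gk theta k.+1 * (logweight sig0 k.+1 * expR (- k.+1%:R) `^ p0^-1) * x f k.+1)%R; last by ring.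
rewrite [leLHS]EFinM; apply: lee_pmul; [|by rewrite lee_fin| |exact: xk].
  by rewrite lee_fin; apply: mulr_ge0; [exact: ltW|rewrite mulr_ge0 ?powR_ge0].
rewrite lee_fin.
apply: (@le_trans _ _ ((K * (expR (theta * lrate a gam (- ln t)) * brho t)) *
  ((2 `^ sig0 * ell (- sig0) t) * (expR 1 * t `^ p0^-1)))%R).
  apply: ler_pM; [exact: ltW|by rewrite mulr_ge0 ?powR_ge0|exact: (hK _ t kt).2|].
  apply: ler_pM; rewrite ?powR_ge0//.
    apply: (le_trans (logweightS _ sig0_ge0)).
    by rewrite ler_pM2l ?powR_gt0.
  apply: (le_trans (ep _)).
  by rewrite ler_pM2l ?expR_gt0.
rewrite le_eqVlt; apply/orP; left; apply/eqP; ring.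
Qed.

End intermediate.

Lemma Lpitv_mul1 (X : R -> \bar R) p t u :
  norm_itv (Ltilde p%:E) t u (fun r => (r `^ p^-1 * 1)%:E * X r) = Lpitv X p t u.
Proof.
by rewrite /Lpitv; congr norm_itv; apply/funext => r; rewrite mulr1.
Qed.

Let GRL (f : Omega -> R) (u : R) : \bar R :=
  (brho u)%:E * RLnorm (fstar mu f) p0 sig0 u.

Lemma space_RL_normE f :
  nnorm (space_RL mu p0 brho (tilde E) (ell (- sig0)) (Ltilde +oo)
    (fun=> 1%R) (Ltilde p0%:E)) f = norm_itv (tilde E) 0 1 (GRL f).
Proof.
rewrite /=; congr norm_itv; apply/funext => u; rewrite /GRL /RLnorm.
by congr (_ * norm_itv _ _ _ _); apply/funext => t; rewrite Lpitv_mul1.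
Qed.

Lemma RL_dominated :
  dominated D (fun f => norm_itv (tilde E) 0 1 (GRL f))
    (fun f => eseq E (Aseq mu b p0 p1 alpha beta 0 f)) /\
  dominated D (fun f => eseq E (Aseq mu b p0 p1 alpha beta 0 f))
    (fun f => norm_itv (tilde E) 0 1 (GRL f)).
Proof.
have [K K0 hK] := brho_cell.
have [C C0 hC] := gseqS alpha beta hb hp0 hp01 (lexx 0%R).
set A := Aseq mu b p0 p1 alpha beta 0.
have A0 f : D f -> nnseq (A f) by move=> _; exact: Aseq_ge0.
have w0 := wconst_gt0 p0 sig0; set w := wconst p0 sig0 in w0.
have RL0 f u : 0 <= RLnorm (fstar mu f) p0 sig0 u by exact: Lnorm_ge0.
have G0 f k u : cell (@didx R) k u -> `|GRL f u| = GRL f u.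
  by move=> ku; rewrite gee0_abs// mule_ge0 ?RL0// lee_fin (hK k u ku).1.
split.
  have C1 : (0 < K * w)%R by rewrite mulr_gt0.
  apply: (@dominated_tilde_ub R (Omega -> R) D E GRL A _ C1 A0) => f k u mf ku _.
  rewrite (G0 f k u ku) /GRL.
  have [b0 [b1 _]] := hK k u ku.
  have h := RLnorm_ub (fstar_ge0 mu f) (fstar_anti mu f) (fstar_fseq mu mf) p0_gt0 sig0_ge0 ku.
  apply: (@le_trans _ _ ((K * gk 0 k)%:E * (w%:E * supR (x f) p0 sig0 k.+1))).
    by apply: lee_pmul; [rewrite lee_fin|exact: RL0|rewrite lee_fin|exact: h].
  rewrite /A /Aseq !muleA -!EFinM; apply: lee_wpmul2r; first exact: supR_ge0.
  by rewrite lee_fin mulrAC.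
set c2 := (2 `^ sig0 * expR 1 : R)%R; have c20 : (0 < c2)%R by rewrite mulr_gt0 ?powR_gt0 ?expR_gt0.
have C1 : (0 < C * K * (c2 * w))%R by rewrite !mulr_gt0.
apply: (@dominated_tilde_lb R (Omega -> R) D E GRL A _ C1 A0) => f k u mf ku.
rewrite (G0 f k.+1 u ku) /GRL.
have [b0 [_ b1]] := hK k.+1 u ku.
have h := RLnorm_lb (fstar_ge0 mu f) (fstar_anti mu f) (fstar_fseq mu mf) p0_gt0 sig0_ge0 ku.
(* The cell k + 1 yields [supR] at k + 2, whereas [Aseq] at k needs it at k + 1. *)
have hS := supR_leS k.+1 (ltW hp0) sig0_ge0 (fseq_ge0 mu f) (fun j => fseq_leS j mf).
apply: (@le_trans _ _ ((C * (K * brho u))%:E *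
  (c2%:E * (w%:E * RLnorm (fstar mu f) p0 sig0 u)))).
  apply: lee_pmul; [by rewrite lee_fin ltW|exact: supR_ge0| |].
    rewrite lee_fin; apply: (le_trans (hC k).1); rewrite ler_pM2l//.
  apply: (le_trans hS); apply: lee_wpmul2l; [by rewrite lee_fin ltW|exact: h].
rewrite !muleA -!EFinM; apply: lee_wpmul2r; first exact: RL0.
rewrite lee_fin le_eqVlt; apply/orP; left; apply/eqP; ring.
Qed.

Let GR (f : Omega -> R) (u : R) : \bar R :=
  (ell (- sig1) u * brho u)%:E * Lpitv (fstar mu f) p1 u 1.

Let GRR (f : Omega -> R) (u : R) : \bar R :=
  (brho u)%:E * RRnorm (fstar mu f) p1 sig1 u.

Lemma space_R_normE f :
  nnorm (space_R mu p1 (fun u => ell (- sig1) u * brho u)%R (tilde E)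
    (fun=> 1%R) (Ltilde p1%:E)) f = norm_itv (tilde E) 0 1 (GR f).
Proof.
rewrite /=; congr norm_itv; apply/funext => u; rewrite /GR.
by rewrite Lpitv_mul1.
Qed.

Lemma space_RR_normE f :
  nnorm (space_RR mu p1 brho (tilde E) (ell (- sig1)) (Ltilde +oo)
    (fun=> 1%R) (Ltilde p1%:E)) f = norm_itv (tilde E) 0 1 (GRR f).
Proof.
rewrite /=; congr norm_itv; apply/funext => u; rewrite /GRR /RRnorm.
by congr (_ * norm_itv _ _ _ _); apply/funext => t; rewrite Lpitv_mul1.
Qed.

(** Both integrands are bounded by [supL]: [GR] takes the inner norm at t = u, while [GRR] takes a
    supremum over t > u. *)
Lemma RR_dominated :
  [/\ dominated D (fun f => norm_itv (tilde E) 0 1 (GR f))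
        (fun f => eseq E (Dseq mu b p0 p1 alpha beta 1 f)),
      dominated D (fun f => norm_itv (tilde E) 0 1 (GRR f))
        (fun f => eseq E (Dseq mu b p0 p1 alpha beta 1 f)) &
      dominated D (fun f => eseq E (Dseq mu b p0 p1 alpha beta 1 f))
        (fun f => norm_itv (tilde E) 0 1 (GRR f))].
Proof.
have [K K0 hK] := brho_cell.
have [C C0 hC] := gseqS alpha beta hb hp0 hp01 (lexx 0%R).
set Ds := Dseq mu b p0 p1 alpha beta 1.
have D0 f : D f -> nnseq (Ds f) by move=> _; exact: Dseq_ge0.
have DS0 f : D f -> nnseq (fun k => Ds f k.+1) by move=> Df k; exact: D0.
have w0 := wconst_gt0 p1 sig1; set w := wconst p1 sig1 in w0.
(* At theta = 1 the factor rho cancels rho^(-1), leaving b(rho) alone. *)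
have DsE f k : Ds f k = (gk 0 k)%:E * supL (x f) p1 sig1 k.+1.
  rewrite /Ds /Dseq muleA -EFinM; congr (_%:E * _).
  rewrite /gseq /gweight /rhoseq mul1r mul0r expR0 mul1r mulrAC -expRD subrr expR0 mul1r//.
have RR0 f u : 0 <= RRnorm (fstar mu f) p1 sig1 u by exact: Lnorm_ge0.
have key f k (r : R) (y : \bar R) : (0 <= r)%R -> 0 <= y ->
    (r <= K * gk 0 k)%R -> y <= w%:E * supL (x f) p1 sig1 k.+2 ->
    r%:E * y <= (K * C * w)%:E * Ds f k.+1.
  move=> r0 y0 rK yw; rewrite DsE.
  apply: (@le_trans _ _ ((K * (C * gk 0 k.+1))%:E * (w%:E * supL (x f) p1 sig1 k.+2))).
    apply: lee_pmul => //; rewrite lee_fin; apply: (le_trans rK).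
    by rewrite ler_pM2l//; exact: (hC k).1.
  rewrite !muleA -!EFinM; apply: lee_wpmul2r; first exact: supL_ge0.
  rewrite lee_fin le_eqVlt; apply/orP; left; apply/eqP; ring.
have C1 : (0 < K * C * w)%R by rewrite !mulr_gt0.
have DSD : dominated D (fun f => eseq E (fun k => Ds f k.+1)) (fun f => eseq E (Ds f)).
  apply: (@dominated_eseqS R (Omega -> R) D E (fun f k => Ds f k.+1) Ds 1%R ltr01 DS0 D0).
  by move=> f k _; rewrite mul1e.
split.
- apply: dominated_trans DSD.
  apply: (@dominated_tilde_ub R (Omega -> R) D E GR (fun f k => Ds f k.+1) _ C1 DS0).
  move=> f k u mf ku _; have [b0 [b1 _]] := hK k u ku.
  have L0 : 0 <= (ell (- sig1) u)%:E * Lpitv (fstar mu f) p1 u 1.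
    by rewrite mule_ge0 ?lee_fin ?powR_ge0// Lnorm_ge0.
  have GE : GR f u = (brho u)%:E * ((ell (- sig1) u)%:E * Lpitv (fstar mu f) p1 u 1).
    by rewrite /GR muleA -EFinM [(_ * brho u)%R]mulrC.
  rewrite GE gee0_abs; last by rewrite mule_ge0 ?lee_fin.
  apply: (key f k _ _ b0 L0 b1).
  exact: (Lpitv_cell1_ub (fstar_ge0 mu f) (fstar_anti mu f) (fstar_fseq mu mf) (fseq0 mu mf) p1_gt0 sig1_ge0 ku).
- apply: dominated_trans DSD.
  apply: (@dominated_tilde_ub R (Omega -> R) D E GRR (fun f k => Ds f k.+1) _ C1 DS0).
  move=> f k u mf ku _; have [b0 [b1 _]] := hK k u ku.
  rewrite /GRR gee0_abs; last by rewrite mule_ge0 ?lee_fin.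
  apply: (key f k _ _ b0 (RR0 f u) b1).
  exact: (RRnorm_ub (fstar_ge0 mu f) (fstar_anti mu f) (fstar_fseq mu mf) (fseq0 mu mf) p1_gt0 sig1_ge0 ku).
(* What [RRnorm_lb] gives on the cell k + 1. Reaching [supL] at k + 1 requires [B] at k + 1, whose
   weight has index k + 2: two shifts of [gseq]. *)
- pose B f k := (gk 0 k.+1)%:E * supL (x f) p1 sig1 k.
  have B0 f : D f -> nnseq (B f).
    by move=> _ k; rewrite mule_ge0 ?supL_ge0// lee_fin ltW.
  apply: (@dominated_trans _ _ _ _ (fun f => eseq E (B f))).
    have C2 : (0 < C * C)%R by rewrite mulr_gt0.
    apply: (@dominated_eseqS R (Omega -> R) D E Ds B _ C2 D0 B0) => f k mf.
    rewrite DsE /B muleA -EFinM; apply: lee_wpmul2r; first exact: supL_ge0.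
    rewrite lee_fin -mulrA; apply: (le_trans (hC k).1); rewrite ler_pM2l//.
    exact: (hC k.+1).1.
  have C2 : (0 < K * w)%R by rewrite mulr_gt0.
  apply: (@dominated_tilde_lb R (Omega -> R) D E GRR B _ C2 B0) => f k u mf ku.
  have [b0 [_ b1]] := hK k.+1 u ku.
  rewrite /GRR gee0_abs; last by rewrite mule_ge0 ?lee_fin.
  have h := RRnorm_lb (fstar_ge0 mu f) (fstar_anti mu f) (fstar_fseq mu mf) (fseq0 mu mf) p1_gt0 sig1_ge0 ku.
  apply: (@le_trans _ _ ((K * brho u)%:E * (w%:E * RRnorm (fstar mu f) p1 sig1 u))).
    by apply: lee_pmul; [rewrite lee_fin ltW|exact: supL_ge0|rewrite lee_fin|exact: h].
  rewrite !muleA -!EFinM; apply: lee_wpmul2r; first exact: RR0.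
  by rewrite lee_fin mulrAC.
Qed.

Lemma nspace_eq_interp theta (X : nspace (Omega -> R) R) : (0 <= theta)%R ->
  ncarrier X = [set f | measurable_fun setT f /\ nnorm X f < +oo] ->
  (forall f, 0 <= nnorm X f) ->
  dominated D (nnorm X) (fun f => eseq E (Zseq mu b p0 p1 alpha beta theta f)) ->
  dominated D (fun f => eseq E (Zseq mu b p0 p1 alpha beta theta f)) (nnorm X) ->
  nspace_eq (interp Y0 Y1 theta b E) X.
Proof.
move=> th0 cX X0 XZ ZX.
have [IZ ZI] := interp_dominated mu E hb hp0 hp01 halpha hbeta th0.
have [C1 C10 IX] := dominated_trans IZ ZX.
have [C2 C20 XI] := dominated_trans XZ ZI.
(* The carrier of the interpolation space also requires f in Y0. Finiteness of the entry 0 of [Zseq]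
   gives it, since [supR] at index 1 is equivalent to the norm of Y0. *)
have fin0 f : D f -> nnorm X f < +oo -> nnorm Y0 f < +oo.
  move=> mf Xf; have [C3 C30 h] := ZX.
  have Zf : eseq E (Zseq mu b p0 p1 alpha beta theta f) < +oo.
    apply: (le_lt_trans (h f mf)); apply: lte_mul_pinfty; [|by []|exact: Xf].
    by rewrite lee_fin ltW.
  have := eseq_lty 0%N (Zseq_ge0 mu p0 p1 alpha beta theta hb f) Zf.
  rewrite ZseqE => hZ.
  have Af : (gk theta 0)%:E * supR (x f) p0 sig0 1 < +oo.
    apply: le_lt_trans hZ; rewrite leeDl//; exact: Dseq_ge0.
  have Sf : supR (x f) p0 sig0 1 < +oo.
    have := supR_ge0 (x f) p0 sig0 1; move: Af.
    case: (supR (x f) p0 sig0 1) => // [r _ _|]; first exact: ltry.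
    by rewrite gt0_muley// lte_fin.
  apply: (le_lt_trans (grand_L_ub mu mf p0_gt0 (ltW halpha))).
  apply: lte_mul_pinfty; [|by []|exact: Sf].
  by rewrite lee_fin ltW ?wconst_gt0.
split.
  rewrite cX; apply/seteqP; split => f /=.
    move=> [[mf _] If]; split => //; apply: (le_lt_trans (XI f mf)).
    by apply: lte_mul_pinfty; [rewrite lee_fin ltW|by []|exact: If].
  move=> [mf Xf]; split; first by split => //; exact: fin0.
  apply: (le_lt_trans (IX f mf)).
  by apply: lte_mul_pinfty; [rewrite lee_fin ltW|by []|exact: Xf].
exists C1^-1%R, C2; split; [by rewrite invr_gt0|exact: C20|move=> f [[mf _] _]; split].
  by rewrite lee_pdivrMl//; exact: IX.
exact: XI.
Qed.

Lemma nspace_eq_interp_cap theta (N1 N2 : (Omega -> R) -> \bar R) : (0 <= theta)%R ->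
  (forall f, 0 <= N1 f) -> (forall f, 0 <= N2 f) ->
  dominated D N1 (fun f => eseq E (Zseq mu b p0 p1 alpha beta theta f)) ->
  dominated D N2 (fun f => eseq E (Zseq mu b p0 p1 alpha beta theta f)) ->
  dominated D (fun f => eseq E (Zseq mu b p0 p1 alpha beta theta f)) N2 ->
  nspace_eq (interp Y0 Y1 theta b E) (nspace_cap (fspace N1) (fspace N2)).
Proof.
move=> th0 N10 N20 N1Z N2Z ZN2; apply: nspace_eq_interp => //.
- apply/seteqP; split => f /=.
    by move=> [[mf h1] [_ h2]]; rewrite gt_max; split => //; apply/andP.
  by rewrite gt_max => -[mf /andP[h1 h2]].
- by move=> f /=; rewrite le_max N10.
- by apply: dominated_max => // f; exact: eseq_ge0.
- by apply: dominated_trans ZN2 _; apply: dominated_le => f _ /=; rewrite le_max lexx orbT.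
Qed.

End function_space_norms.

(** * The cases 0 < theta < 1, theta = 0 and theta = 1 *)

Theorem corollary5p5 (R : realType) (d : measure_display)
    (Omega : measurableType d) (mu : probability Omega R)
    (E : ri_space (halfline R)) (b : R -> R) (p0 p1 alpha beta : R)
    (hb : SV01 b) (hp0 : 1 < p0) (hp01 : p0 < p1)
    (halpha : 0 < alpha) (hbeta : 0 < beta) :
  let rho := fun u : R =>
    u `^ (p0^-1 - p1^-1) * ell (beta / p1 - alpha / p0) u in
  let brho := fun u : R => extend1 b (rho u) in
  let Y0 := grand_L mu p0 alpha in
  let Y1 := grand_L mu p1 beta in
  [/\
    forall theta p : R, 0 < theta < 1 ->
      p^-1 = (1 - theta) / p0 + theta / p1 ->
      nspace_eq (interp Y0 Y1 theta b E)
        (space_L mu p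
          (fun u => ell (- (alpha * (1 - theta) / p0 + beta * theta / p1)) u
                    * brho u) (tilde E)),
    nspace_eq (interp Y0 Y1 0 b E)
      (space_RL mu p0 brho (tilde E) (ell (- (alpha / p0))) (Ltilde +oo%E)
        (fun=> 1) (Ltilde p0%:E))
  & (norm_itv (tilde E) 0 1 (fun t => (b t)%:E) < +oo)%E ->
    nspace_eq (interp Y0 Y1 1 b E)
      (nspace_cap
        (space_R mu p1 (fun u => ell (- (beta / p1)) u * brho u) (tilde E)
          (fun=> 1) (Ltilde p1%:E))
        (space_RR mu p1 brho (tilde E) (ell (- (beta / p1))) (Ltilde +oo%E)
          (fun=> 1) (Ltilde p1%:E)))].
Proof.
move=> rho brho Y0 Y1.
pose D := [set f : Omega -> R | measurable_fun setT f]%classic.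
pose A theta f := eseq E (Aseq mu b p0 p1 alpha beta theta f).
pose B theta f := eseq E (Dseq mu b p0 p1 alpha beta theta f).
pose T theta f := eseq E (Tseq mu b p0 p1 alpha beta theta f).
have norm_ge0 (g : R -> \bar R) : (0 <= norm_itv (tilde E) 0 1 g)%E.
  by apply: ri_norm_ge0; exact: Mplus_rearr.
have AZ theta := Aseq_le_Zseq mu E p0 p1 alpha beta theta hb.
have BZ theta := Dseq_le_Zseq mu E p0 p1 alpha beta theta hb.
have TA theta (th0 : 0 <= theta) : dominated D (T theta) (A theta) :=
  Tseq_le_Aseq mu E beta hb hp0 hp01 halpha th0.
have TB theta : dominated D (T theta) (B theta) :=
  Tseq_le_Dseq mu E alpha theta hb hp0 hp01 hbeta.
have AT theta (th0 : 0 < theta) : dominated D (A theta) (T theta) :=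
  Aseq_le_Tseq mu E beta hb hp0 hp01 halpha th0.
have BT theta (th1 : theta < 1) : dominated D (B theta) (T theta) :=
  Dseq_le_Tseq mu E alpha hb hp0 hp01 hbeta th1.
split.
(* Both Hardy inequalities hold, so A, B and the target norm are all equivalent to the local
   terms. *)
- move=> theta p /andP[th0 th1] hp; have th0' := ltW th0.
  have [XT TX] := space_L_dominated mu E beta hb hp0 hp01 halpha th0' hp.
  apply: (nspace_eq_interp hb hp0 hp01 halpha hbeta th0').
  + exact: erefl.
  + by move=> f; exact: norm_ge0.
  + exact: dominated_trans (dominated_trans XT (TA _ th0')) (AZ theta).
  + apply: (Zseq_dominated hb); first by move=> f; exact: norm_ge0.
      exact: dominated_trans (AT _ th0) TX.
    exact: dominated_trans (BT _ th1) TX.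
(* At theta = 0 the target norm is A itself up to constants, and B is absorbed through the local
   terms. *)
- have [XA AX] := RL_dominated mu E beta hb hp0 hp01 halpha.
  have XE := funext (space_RL_normE mu E b p0 p1 alpha beta).
  rewrite -XE in XA AX.
  apply: (nspace_eq_interp hb hp0 hp01 halpha hbeta (lexx 0)).
  + exact: erefl.
  + by move=> f; exact: norm_ge0.
  + exact: dominated_trans XA (AZ 0).
  + apply: (Zseq_dominated hb); first by move=> f; exact: norm_ge0.
      exact: AX.
    exact: dominated_trans (BT _ ltr01) (dominated_trans (TA _ (lexx 0)) AX).
(* At theta = 1 the roles are exchanged: B remains, and A is absorbed through the local terms. *)
- move=> _; have [RB RRB BRR] := RR_dominated mu E alpha hb hp0 hp01 hbeta.
  have R1E := funext (space_R_normE mu E b p0 p1 alpha beta).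
  have R2E := funext (space_RR_normE mu E b p0 p1 alpha beta).
  rewrite -R1E in RB; rewrite -R2E in RRB BRR.
  apply: (nspace_eq_interp_cap hb hp0 hp01 halpha hbeta ler01).
  + by move=> f; exact: norm_ge0.
  + by move=> f; exact: norm_ge0.
  + exact: dominated_trans RB (BZ 1).
  + exact: dominated_trans RRB (BZ 1).
  + apply: (Zseq_dominated hb _ _ BRR); first by move=> f; exact: norm_ge0.
    exact: dominated_trans (AT _ ltr01) (dominated_trans (TB 1) BRR).
Qed.
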